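(* Consider the pure no-flux case $\Gamma^D=\emptyset$. There exists a constant $\nu>0$, depending only on the domain $\Omega$, the mesh regularity parameter $\Theta$, the initial condition $u_0$, the potential $V$, and the ellipticity constants $\lambda_m,\lambda^M$ of the anisotropy tensor $\boldsymbol\Lambda$, such that every solution $(u_{\mathcal T}^n)_{n\ge0}$ of the nonlinear DDFV scheme satisfies $$\mathbb E_{1,\mathcal T}^n\le(1+\nu\,\Delta t)^{-n}\,\mathbb E_{1,\mathcal T}^0\qquad\text{for all }n\ge0 .$$ Consequently, for any $k>0$, if $\Delta t\le k$, then $\mathbb E_{1,\mathcal T}^n\le e^{-\tilde\nu t^n}\,\mathbb E_{1,\mathcal T}^0$ for all $n\ge0$, where $\tilde\nu=\log(1+\nu k)/k$ and $t^n=n\Delta t$.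
   Context: **Data.** $\Omega\subset\mathbb R^2$ is a polygonal connected open bounded set, $V\in C^1(\overline\Omega,\mathbb R)$, $u_0\in L^2(\Omega)$, $u_0\ge0$, $M^1:=\int_\Omega u_0\,d\boldsymbol x>0$; $\boldsymbol\Lambda\in L^\infty(\Omega)^{2\times2}$ is symmetric with $\lambda_m|\boldsymbol v|^2\le\boldsymbol\Lambda(\boldsymbol x)\boldsymbol v\cdot\boldsymbol v\le\lambda^M|\boldsymbol v|^2$ for all $\boldsymbol v\in\mathbb R^2$ and a.e. $\boldsymbol x$, where $0<\lambda_m\le\lambda^M$. The scheme discretizes $\partial_tu-\mathrm{div}(\boldsymbol\Lambda(\nabla u+u\nabla V))=0$ with no-flux boundary condition on $\partial\Omega$ and initial datum $u_0$. **DDFV meshes.** The primal mesh is $\overline{\mathfrak M}=\mathfrak M\cup\partial\mathfrak M$, where $\mathfrak M$ is a finite partition of $\Omega$ into polygonal control volumes $K$, each with a center $\boldsymbol x_K$, and $\partial\mathfrak M$ is the set of boundary edges, viewed as degenerate control volumes, with center $\boldsymbol x_K$ the midpoint of the edge. The dual mesh $\overline{\mathfrak M^*}=\mathfrak M^*\cup\partial\mathfrak M^*$ has one polygonal cell $K^*$ for each vertex $\boldsymbol x_{K^*}$ of the primal mesh: if $\boldsymbol x_{K^*}\in\Omega$ ($K^*\in\mathfrak M^*$), $K^*$ is obtained by connecting the centers of the primal cells having $\boldsymbol x_{K^*}$ as a vertex; if $\boldsymbol x_{K^*}\in\partial\Omega$ ($K^*\in\partial\mathfrak M^*$), $K^*$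 is the polygon with vertex $\boldsymbol x_{K^*}$ obtained by connecting the centers of the interior primal cells and the midpoints of the boundary edges having $\boldsymbol x_{K^*}$ as a vertex. Any two neighbouring primal cells $K,L\in\overline{\mathfrak M}$ share a segment $\sigma=K|L=[\boldsymbol x_{K^*},\boldsymbol x_{L^*}]$ (for $L\in\partial\mathfrak M$, $\sigma$ is the boundary edge $L$ itself); the corresponding dual edge is $\sigma^*=K^*|L^*=[\boldsymbol x_K,\boldsymbol x_L]$. To each such pair is associated the diamond $\mathcal D=\mathcal D_{\sigma,\sigma^*}$, the quadrilateral with diagonals $\sigma,\sigma^*$ (a triangle if $\sigma\subset\partial\Omega$). The set $\mathfrak D$ of diamonds is a partition of $\Omega$; $\mathcal D\cap K$ is the triangle with base $\sigma$ and apex $\boldsymbol x_K$, and $\mathcal D\cap K^*$ the triangle with base $\sigma^*$ and apex $\boldsymbol x_{K^*}$. Denote by $\mathrm m_K,\mathrm m_{K^*},\mathrm m_{\mathcal D}$ (and $\mathrm m_{\mathcal D\cap K}$, etc.) the areas, $\mathrm m_\sigma,\mathrm m_{\sigma^*}$ the lengths, $\alpha_{\mathcal D}$ the angle between the lines $(\boldsymbol x_K,\boldsymbol x_L)$ and $(\boldsymbol x_{K^*},\boldsymbol x_{L^*})$, so that $\mathrm m_{\mathcal D}=\frac12\mathrm m_\sigma\mathrm m_{\sigma^*}\sin\alpha_{\mathcal D}$; $\boldsymbol n_{\sigma K}$ is the unit normal to $\sigma$ outward from $K$, $\boldsymbol n_{\sigma^*K^*}$ the unit normal to $\sigma^*$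 outward from $K^*$. **Regularity.** $\Theta\ge1$ is such that for every $\mathcal D=\mathcal D_{\sigma,\sigma^*}\in\mathfrak D$: $\frac1{2\sin\alpha_{\mathcal D}}\Big(\frac{\mathrm m_\sigma}{\mathrm m_{\sigma^*}}+\frac{\mathrm m_{\sigma^*}}{\mathrm m_\sigma}\Big)\le\Theta$, and $\mathrm m_{\mathcal D}\le\Theta\,\mathrm m_{\mathcal D\cap K}$ for all $K\in\mathfrak M$ with $\mathrm m_{\mathcal D\cap K}>0$, and $\mathrm m_{\mathcal D}\le\Theta\,\mathrm m_{\mathcal D\cap K^*}$ for all $K^*\in\overline{\mathfrak M^*}$ with $\mathrm m_{\mathcal D\cap K^*}>0$. **Discrete objects.** $\mathcal T=(\overline{\mathfrak M},\overline{\mathfrak M^*})$; $\mathbb R^{\mathcal T}$ is the set of $u_{\mathcal T}=((u_K)_{K\in\overline{\mathfrak M}},(u_{K^*})_{K^*\in\overline{\mathfrak M^*}})$; operations such as $\log$, products and quotients on $\mathbb R^{\mathcal T}$ are componentwise. Define $$[\![v_{\mathcal T},u_{\mathcal T}]\!]_{\mathcal T}=\tfrac12\Big(\sum_{K\in\mathfrak M}\mathrm m_Ku_Kv_K+\sum_{K^*\in\overline{\mathfrak M^*}}\mathrm m_{K^*}u_{K^*}v_{K^*}\Big),$$ $\delta^{\mathcal D}u_{\mathcal T}=(u_K-u_L,\;u_{K^*}-u_{L^*})^T\in\mathbb R^2$, $\boldsymbol\Lambda^{\mathcal D}=\frac1{\mathrm m_{\mathcal D}}\int_{\mathcal D}\boldsymbol\Lambda\,d\boldsymbol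 x$, and the symmetric matrix $\mathbb A^{\mathcal D}=\begin{pmatrix} A_{\sigma,\sigma} & A_{\sigma,\sigma^*} \\ A_{\sigma,\sigma^*} & A_{\sigma^*,\sigma^*} \end{pmatrix}$ with $A_{\sigma,\sigma}=\frac{\mathrm m_\sigma^2}{4\mathrm m_{\mathcal D}}\boldsymbol\Lambda^{\mathcal D}\boldsymbol n_{\sigma K}\cdot\boldsymbol n_{\sigma K}$, $A_{\sigma,\sigma^*}=\frac{\mathrm m_\sigma\mathrm m_{\sigma^*}}{4\mathrm m_{\mathcal D}}\boldsymbol\Lambda^{\mathcal D}\boldsymbol n_{\sigma K}\cdot\boldsymbol n_{\sigma^*K^*}$, $A_{\sigma^*,\sigma^*}=\frac{\mathrm m_{\sigma^*}^2}{4\mathrm m_{\mathcal D}}\boldsymbol\Lambda^{\mathcal D}\boldsymbol n_{\sigma^*K^*}\cdot\boldsymbol n_{\sigma^*K^*}$. Put $r^{\mathcal D}(u_{\mathcal T})=f\big(r(u_K,u_L),r(u_{K^*},u_{L^*})\big)$, where $f(x,y)=\max(x,y)$ or $f(x,y)=(x+y)/2$, and $r:(0,\infty)^2\to(0,\infty)$ is monotonically increasing (non-strictly) in each variable, $r(x,x)=x$, $r(x,y)=r(y,x)$, $r(\lambda x,\lambda y)=\lambda r(x,y)$ for $\lambda>0$, and $\frac{x-y}{\log x-\log y}\le r(x,y)\le\max(x,y)$ for $x\neq y$. **Scheme.** $V_K=V(\boldsymbol x_K)$, $V_{K^*}=V(\boldsymbol x_{K^*})$; $u_K^0=\frac1{\mathrm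 m_K}\int_Ku_0$ for $K\in\mathfrak M$, $u_{K^*}^0=\frac1{\mathrm m_{K^*}}\int_{K^*}u_0$ for $K^*\in\overline{\mathfrak M^*}$, $u_K^0=0$ for $K\in\partial\mathfrak M$; $\Delta t>0$. A solution is a sequence with $u_{\mathcal T}^{n+1}\in(0,\infty)^{\mathcal T}$ for all $n\ge0$ such that, with $g_{\mathcal T}^{n+1}=\log u_{\mathcal T}^{n+1}+V_{\mathcal T}$, $$\Big[\!\Big[\frac{u_{\mathcal T}^{n+1}-u_{\mathcal T}^n}{\Delta t},\psi_{\mathcal T}\Big]\!\Big]_{\mathcal T}+\sum_{\mathcal D\in\mathfrak D}r^{\mathcal D}(u_{\mathcal T}^{n+1})\,\delta^{\mathcal D}g_{\mathcal T}^{n+1}\cdot\mathbb A^{\mathcal D}\delta^{\mathcal D}\psi_{\mathcal T}=0\qquad\forall\psi_{\mathcal T}\in\mathbb R^{\mathcal T}.$$ **Steady state and entropy.** $u_K^\infty=\rho e^{-V_K}$ with $\rho=M^1(\sum_{K\in\mathfrak M}\mathrm m_Ke^{-V_K})^{-1}$, $u_{K^*}^\infty=\rho^*e^{-V_{K^*}}$ with $\rho^*=M^1(\sum_{K^*\in\overline{\mathfrak M^*}}\mathrm m_{K^*}e^{-V_{K^*}})^{-1}$; and $$\mathbb E_{1,\mathcal T}^n=[\![u_{\mathcal T}^\infty\,\Phi_1(u_{\mathcal T}^n/u_{\mathcal T}^\infty),1_{\mathcal T}]\!]_{\mathcal T},\qquad\Phi_1(s)=s\log s-s+1\ (0\log0=0),$$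 where $1_{\mathcal T}$ has all components equal to $1$. *)

(* Defs.v *)
From HB Require Import structures.
From mathcomp Require Import all_boot all_order all_algebra.
From mathcomp Require Import all_classical all_reals all_analysis.
Import Order.TTheory GRing.Theory Num.Theory numFieldNormedType.Exports.

Set Implicit Arguments.
Unset Strict Implicit.
Unset Printing Implicit Defensive.

Local Open Scope classical_set_scope.
Local Open Scope ring_scope.

Definition mu2 (R : realType) :
    {measure set (measurableTypeR R * measurableTypeR R) -> \bar R} :=
  (@lebesgue_measure R \x @lebesgue_measure R)%E.

Definition area (R : realType) (A : set (R * R)) : R := fine (mu2 R A).

(* The library norm on R * R is the sup norm, hence an explicit Euclidean
   norm. *)
Definition dot (R : realType) (v w : R * R) : R := v.1 * w.1 + v.2 * w.2.

Definition enorm (R : realType) (v : R * R) : R := Num.sqrt (dot v v).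

Definition mxapp (R : realType) (A : 'M[R]_2) (v : R * R) : R * R :=
  (A 0 0 * v.1 + A 0 1 * v.2, A 1 0 * v.1 + A 1 1 * v.2).

Definition mx22 (R : realType) (a b c d : R) : 'M[R]_2 :=
  \matrix_(i, j) if i == 0 then (if j == 0 then a else b)
                 else (if j == 0 then c else d).

Definition segment (R : realType) (a b : R * R) : set (R * R) :=
  [set a + t *: (b - a) | t in [set t : R | 0 <= t <= 1]].

(* closed, possibly degenerate *)
Definition triangle (R : realType) (a b c : R * R) : set (R * R) :=
  [set a + st.1 *: (b - a) + st.2 *: (c - a)
    | st in [set st : R * R | [/\ 0 <= st.1, 0 <= st.2 & st.1 + st.2 <= 1]]].

Definition is_open_triangle (R : realType) (A : set (R * R))
    (a b c : R * R) : Prop :=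
  A = (triangle a b c)° /\ A !=set0.

Definition frontier (R : realType) (A : set (R * R)) : set (R * R) :=
  closure A `\` A°.

Definition midpoint (R : realType) (a b : R * R) : R * R :=
  2^-1 *: (a + b).

(* angle, in [0, pi/2], between the lines directed by v and w *)
Definition line_angle (R : realType) (v w : R * R) : R :=
  acos (`|dot v w| / (enorm v * enorm w)).

(* unit normal to the segment [a, b] pointing away from the point p *)
Definition normal_away (R : realType) (a b p : R * R) : R * R :=
  let n : R * R := (- (b - a).2, (b - a).1) in
  (Num.sg (dot n (a - p)) / enorm (b - a)) *: n.

(* Polygonal: the interior of a finite union of closed triangles; holes are
   allowed, slits are not. *)
Definition polygonal (R : realType) (A : set (R * R)) : Prop :=
  exists ts : seq ((R * R) * (R * R) * (R * R)),
    A = (\bigcup_(t in [set` ts]) triangle t.1.1 t.1.2 t.2)°.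

Definition polygonal_domain (R : realType) (Omega : set (R * R)) : Prop :=
  [/\ polygonal Omega, connected Omega, open Omega & bounded_set Omega].

(* V is C^1 in Omega, and V and its gradient extend continuously to the
   closure; G is the extended gradient. *)
Definition C1_closure (R : realType) (Omega : set (R * R))
    (V : R * R -> R) : Prop :=
  {within closure Omega, continuous V} /\
  exists2 G : R * R -> R * R, {within closure Omega, continuous G} &
    forall x : R * R, Omega x ->
      [/\ differentiable V x,
          is_derive x ((1, 0) : R * R) V (G x).1 &
          is_derive x ((0, 1) : R * R) V (G x).2].

Definition square_integrable (R : realType) (Omega : set (R * R))
    (u : R * R -> R) : Prop :=
  measurable_fun Omega u /\
  (mu2 R).-integrable Omega (EFin \o (fun x => u x ^+ 2)).

Definition ess_bounded (R : realType) (Omega : set (R * R))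
    (h : R * R -> R) : Prop :=
  measurable_fun Omega h /\
  exists C : R, {ae mu2 R, forall x, Omega x -> `|h x| <= C}.

Definition anisotropy_tensor (R : realType) (Omega : set (R * R))
    (lm lM : R) (Lambda : R * R -> 'M[R]_2) : Prop :=
  [/\ forall i j, ess_bounded Omega (fun x => Lambda x i j),
      {ae mu2 R, forall x, Omega x -> (Lambda x)^T = Lambda x} &
      {ae mu2 R, forall x, Omega x -> forall v : R * R,
        lm * enorm v ^+ 2 <= dot (mxapp (Lambda x) v) v <= lM * enorm v ^+ 2}].

(* Data of a DDFV mesh.  A diamond d carries an (arbitrary) orientation of its
   two diagonals: sigma = [x_(dKs d), x_(dLs d)] and sigma* = [x_(dK d), x_(dL d)];
   all the quantities built below are independent of that choice.  The first
   primal cell of a diamond is always an interior one. *)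
Record mesh (R : realType) := Mesh {
  primal : finType;
  bedge : finType;
  vertex : finType;          (* also indexes the dual cells *)
  diam : finType;
  cell : primal -> set (R * R);
  pcenter : primal -> R * R;
  vert : vertex -> R * R;
  bends : bedge -> vertex * vertex;
  dK : diam -> primal;
  dL : diam -> primal + bedge;
  dKs : diam -> vertex;
  dLs : diam -> vertex
}.

Section MeshGeometry.
Context {R : realType} (T : mesh R).

Definition bseg (b : bedge T) : set (R * R) :=
  segment (vert (bends b).1) (vert (bends b).2).

Definition center (K : primal T + bedge T) : R * R :=
  match K with
  | inl K => pcenter K
  | inr b => midpoint (vert (bends b).1) (vert (bends b).2)
  end.

Definition xK (d : diam T) : R * R := pcenter (dK d).
Definition xL (d : diam T) : R * R := center (dL d).
Definition xKs (d : diam T) : R * R := vert (dKs d).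
Definition xLs (d : diam T) : R * R := vert (dLs d).

Definition sigma (d : diam T) : set (R * R) := segment (xKs d) (xLs d).

Definition edge_of (K : primal T) (d : diam T) : bool :=
  (dK d == K) || (dL d == inl K).

Definition has_vertex (s : vertex T) (d : diam T) : bool :=
  (dKs d == s) || (dLs d == s).

(* the open quadrilateral with diagonals sigma and sigma* *)
Definition diamond (d : diam T) : set (R * R) :=
  (triangle (xK d) (xKs d) (xLs d) `|` triangle (xL d) (xKs d) (xLs d))°.

(* The polygon obtained by connecting the centers around the vertex s, as the
   union of the triangles with apex s and bases the sigma*.  For s on the
   boundary, the centers include the midpoints of the boundary edges at s, and s
   itself is a vertex of the polygon. *)
Definition dual_cell (s : vertex T) : set (R * R) :=
  (\bigcup_(d in [set d | has_vertex s d]) triangle (vert s) (xK d) (xL d))°.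

End MeshGeometry.

(* finite partition by nonempty open sets, up to their boundaries *)
Definition open_partition (R : realType) (Omega : set (R * R)) (I : finType)
    (F : I -> set (R * R)) : Prop :=
  [/\ forall i, open (F i) /\ F i !=set0,
      forall i, F i `<=` Omega,
      trivIset [set: I] F &
      Omega `<=` \bigcup_i closure (F i)].

Record ddfv_mesh (R : realType) (Omega : set (R * R)) (T : mesh R) : Prop :=
  DdfvMesh {
  primal_partition : open_partition Omega (@cell R T);
  (* each primal cell is a polygon whose sides are its edges sigma *)
  cell_frontier : forall K : primal T,
    frontier (cell K) = \bigcup_(d in [set d | edge_of K d]) sigma d;
  vert_inj : injective (@vert R T);
  vertex_of_edge : forall s : vertex T, exists d, has_vertex s d;
  boundary_edges : frontier Omega = \bigcup_(b : bedge T) bseg b;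
  boundary_diamond : forall b : bedge T, exists! d : diam T, dL d = inr b;
  boundary_sigma : forall (b : bedge T) (d : diam T),
    dL d = inr b -> bends b = (dKs d, dLs d);
  diamond_partition : open_partition Omega (@diamond R T);
  diamond_cap_K : forall d : diam T,
    is_open_triangle (diamond d `&` cell (dK d)) (xK d) (xKs d) (xLs d);
  diamond_cap_L : forall (d : diam T) (L : primal T), dL d = inl L ->
    is_open_triangle (diamond d `&` cell L) (xL d) (xKs d) (xLs d);
  diamond_cap_Ks : forall d : diam T,
    is_open_triangle (diamond d `&` dual_cell (dKs d)) (xKs d) (xK d) (xL d);
  diamond_cap_Ls : forall d : diam T,
    is_open_triangle (diamond d `&` dual_cell (dLs d)) (xLs d) (xK d) (xL d)
}.

Section MeshQuantities.
Context {R : realType} (T : mesh R).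

Definition m_sigma (d : diam T) : R := enorm (xLs d - xKs d).
Definition m_sigmas (d : diam T) : R := enorm (xL d - xK d).

Definition alphaD (d : diam T) : R :=
  line_angle (xL d - xK d) (xLs d - xKs d).

Definition n_sigmaK (d : diam T) : R * R :=
  normal_away (xKs d) (xLs d) (xK d).
Definition n_sigmasKs (d : diam T) : R * R :=
  normal_away (xK d) (xL d) (xKs d).

Definition mesh_regularity (Theta : R) : Prop :=
  forall d : diam T,
  [/\ 1 / (2 * sin (alphaD d)) *
        (m_sigma d / m_sigmas d + m_sigmas d / m_sigma d) <= Theta,
      forall K : primal T, 0 < area (diamond d `&` cell K) ->
        area (diamond d) <= Theta * area (diamond d `&` cell K) &
      forall s : vertex T, 0 < area (diamond d `&` dual_cell s) ->
        area (diamond d) <= Theta * area (diamond d `&` dual_cell s)].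

Definition LambdaD (Lambda : R * R -> 'M[R]_2) (d : diam T) : 'M[R]_2 :=
  \matrix_(i, j)
    ((area (diamond d))^-1 * \int[mu2 R]_(x in diamond d) Lambda x i j).

Definition AD (Lambda : R * R -> 'M[R]_2) (d : diam T) : 'M[R]_2 :=
  let L := mxapp (LambdaD Lambda d) in
  let mD := area (diamond d) in
  let Ass := m_sigma d ^+ 2 / (4 * mD) * dot (L (n_sigmaK d)) (n_sigmaK d) in
  let Ass' := m_sigma d * m_sigmas d / (4 * mD)
              * dot (L (n_sigmaK d)) (n_sigmasKs d) in
  let As's' := m_sigmas d ^+ 2 / (4 * mD)
               * dot (L (n_sigmasKs d)) (n_sigmasKs d) in
  mx22 Ass Ass' Ass' As's'.

(* inl (inl K), inl (inr b) and inr s index the interior primal, boundary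
   primal and dual unknowns. *)
Definition unknown : Type := ((primal T + bedge T) + vertex T)%type.

Definition prodT (v u : unknown -> R) : R :=
  2^-1 * (\sum_(K : primal T)
            area (cell K) * u (inl (inl K)) * v (inl (inl K))
          + \sum_(s : vertex T) area (dual_cell s) * u (inr s) * v (inr s)).

Definition deltaD (d : diam T) (u : unknown -> R) : R * R :=
  (u (inl (inl (dK d))) - u (inl (dL d)), u (inr (dKs d)) - u (inr (dLs d))).

Definition rD (r f : R -> R -> R) (d : diam T) (u : unknown -> R) : R :=
  f (r (u (inl (inl (dK d)))) (u (inl (dL d))))
    (r (u (inr (dKs d))) (u (inr (dLs d)))).

Definition sampleT (V : R * R -> R) : unknown -> R :=
  fun i => match i with inl K => V (center K) | inr s => V (vert s) end.

Definition initT (u0 : R * R -> R) : unknown -> R :=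
  fun i => match i with
  | inl (inl K) => (area (cell K))^-1 * \int[mu2 R]_(x in cell K) u0 x
  | inl (inr _) => 0
  | inr s => (area (dual_cell s))^-1 * \int[mu2 R]_(x in dual_cell s) u0 x
  end.

Definition ddfv_solution (V u0 : R * R -> R) (Lambda : R * R -> 'M[R]_2)
    (r f : R -> R -> R) (dt : R) (u : nat -> unknown -> R) : Prop :=
  [/\ u 0%N = initT u0,
      forall n i, 0 < u n.+1 i &
      forall n (psi : unknown -> R),
        let g i := ln (u n.+1 i) + sampleT V i in
        prodT (fun i => (u n.+1 i - u n i) / dt) psi
        + \sum_(d : diam T) rD r f d (u n.+1)
            * dot (deltaD d g) (mxapp (AD Lambda d) (deltaD d psi)) = 0].

Definition steadyT (V : R * R -> R) (M1 : R) : unknown -> R :=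
  let rho := M1 / \sum_(K : primal T)
                    area (cell K) * expR (- V (pcenter K)) in
  let rhos := M1 / \sum_(s : vertex T)
                     area (dual_cell s) * expR (- V (vert s)) in
  fun i => match i with
  | inl K => rho * expR (- V (center K))
  | inr s => rhos * expR (- V (vert s))
  end.

End MeshQuantities.

(* ln 0 = 0 in the library, so Phi1 0 = 1. *)
Definition Phi1 (R : realType) (s : R) : R := s * ln s - s + 1.

Definition entropy1 (R : realType) (T : mesh R) (V : R * R -> R) (M1 : R)
    (u : unknown T -> R) : R :=
  prodT (fun i => steadyT V M1 i * Phi1 (u i / steadyT V M1 i)) (fun=> 1).

Record mean_function (R : realType) (r : R -> R -> R) : Prop := MeanFunction {
  mean_gt0 : forall x y, 0 < x -> 0 < y -> 0 < r x y;
  mean_le : forall x x' y y', 0 < x -> 0 < y -> x <= x' -> y <= y' ->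
    r x y <= r x' y';
  mean_diag : forall x, 0 < x -> r x x = x;
  mean_sym : forall x y, 0 < x -> 0 < y -> r x y = r y x;
  mean_homog : forall l x y, 0 < l -> 0 < x -> 0 < y ->
    r (l * x) (l * y) = l * r x y;
  mean_bounds : forall x y, 0 < x -> 0 < y -> x != y ->
    (x - y) / (ln x - ln y) <= r x y <= Num.max x y
}.

Definition max_or_average (R : realType) (f : R -> R -> R) : Prop :=
  (f = fun x y => Num.max x y) \/ (f = fun x y => (x + y) / 2).

(* Main.v *)
(** The entropy dissipation of one step is [sum_D r^D (delta g) . A^D (delta g)],
    with [A^D >= c Id] by mesh regularity.  It controls the entropy without any
    logarithmic Sobolev inequality: writing [w = u / u_infty] on one of the two
    meshes, with cell weights [m_i], we have [Phi1 w <= (w - 1)^2]; as the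
    weighted mean of [w] is [1], the entropy is at most [sum_i m_i (w_i - t)^2]
    for every [t].  In dimension two this sum is bounded, for a suitable [t],
    by the square of the total variation [sum_d |S_d| |w_i - w_j|].  As
    [|x - y| <= r(x, y) |log x - log y|], Cauchy-Schwarz gives
      [TV^2 <= (sum_d r |delta (log w)|^2) (sum_d |S_d|^2 r)],
    and the last sum is at most a constant times the mass since
    [|S_d|^2 <= C m_D].

    The total variation inequality is first proved on a parallelogram [P].  For
    [p, p'] in [P] let [a(p)], [b(p)] be the sums of the jumps met by the two
    lines through [p] parallel to the sides.  The two broken lines from [p] to
    [p'] give [|G p - G p'|^2 <= (a(p) + b(p')) (b(p) + a(p'))]; integrating in
    [p], with [p'] minimising [a + b], gives the claim.  Parallelograms with an
    overlap are glued together, each triangle being covered by three of them. *)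
Require Import Defs.
From mathcomp Require Import all_boot all_order all_algebra.
From mathcomp Require Import all_classical all_reals all_analysis.
From mathcomp Require Import measurable_realfun ring lra.
Import Order.TTheory GRing.Theory Num.Theory numFieldNormedType.Exports.
Set Implicit Arguments.
Unset Strict Implicit.
Unset Printing Implicit Defensive.
Local Open Scope classical_set_scope.
Local Open Scope ring_scope.

(** * Areas in the plane *)

Section Plane.
Variable R : realType.
Implicit Types (p q v w : R * R) (x y s t : R).

(** The constant must not see the mesh. The total variation inequality is therefore proved for an
    abstract partition of $\Omega$ whose jumps sit on segments, with its constant fixed before the
    partition; it is used once for the primal cells with the $\sigma$ and once for the dual cells
    with the $\sigma^*$. The obstacle is topological: the mesh hypotheses describe each half-diamond
    by itself, while the inequality requires that a point common to the closures of two dual cells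
    lie, up to finitely many points, on a $\sigma^*$ separating exactly these two cells. This rests
    on two facts: the diagonals of a diamond cross, and no vertex of a cell hides another one when
    seen from the center. The two meshes decouple because both choices of $f$ dominate the half-sum
    of the two means, and because each mesh conserves its own mass, in agreement with the separate
    normalisations $\rho$ and $\rho^*$. Areas are compared only up to numerical factors, from above
    by strips and from below by inscribed parallelograms; the constants 2, 16, 32 and 64 originate
    there. *)

Definition crs v w : R := v.1 * w.2 - v.2 * w.1.

Lemma lin_continuous (al be : R) :
  continuous (fun p : R * R => al * p.1 + be * p.2).
Proof.
move=> p; apply: cvgD; apply: cvgM; try exact: cvg_cst.
  exact: cvg_fst.
exact: cvg_snd.
Qed.

Lemma open_lin_lt (al be c : R) : open [set p : R * R | c < al * p.1 + be * p.2].
Proof.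
have := @open_comp _ _ (fun p : R * R => al * p.1 + be * p.2) [set x | c < x].
by apply; [move=> p _; exact: lin_continuous | exact: open_gt].
Qed.

Lemma closed_lin_le (al be c : R) :
  closed [set p : R * R | c <= al * p.1 + be * p.2].
Proof.
have /continuous_closedP/(_ [set x | c <= x]) : continuous (fun p : R * R => al * p.1 + be * p.2).
  exact: lin_continuous.
by apply; exact: closed_ge.
Qed.

(** The product sigma-algebra is generated by rectangles, so an open set is exhibited as the union
    of the countably many rational boxes that it contains. *)
Lemma open_measurable2 (A : set (R * R)) :
  open A -> measurable (A : set (measurableTypeR R * measurableTypeR R)).
Proof.
move=> oA.
pose J (r : (rat * rat) * (rat * rat)) : set (R * R) :=
  `]ratr r.1.1, ratr r.1.2[%classic `*` `]ratr r.2.1, ratr r.2.2[%classic.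
pose box (r : (rat * rat) * (rat * rat)) : set (R * R) :=
  [set p | J r `<=` A /\ J r p].
have -> : A = \bigcup_r box r.
  apply/seteqP; split => [p Ap|p [r _ [JA]]]; last exact: JA.
  have /nbhs_ballP[e /= e0 eA] : nbhs p A by exact: open_nbhs_nbhs.
  have rat_near (z : R) : exists r : rat * rat,
      [/\ ratr r.1 < z, z < ratr r.2, z - e < ratr r.1 & ratr r.2 < z + e].
    have [q1] := @rat_in_itvoo R (z - e) z ltac:(lra).
    have [q2] := @rat_in_itvoo R z (z + e) ltac:(lra).
    rewrite !in_itv /= => /andP[a1 a2] /andP[b1 b2].
    by exists (q1, q2).
  have [r1 [a1 a2 a3 a4]] := rat_near p.1.
  have [r2 [b1 b2 b3 b4]] := rat_near p.2.
  exists (r1, r2) => //.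
  split; last by split; rewrite /= in_itv /=; apply/andP.
  move=> q [] /=; rewrite !in_itv /= => /andP[c1 c2] /andP[d1 d2].
  by apply: eA; split; rewrite /ball /= ltr_norml; apply/andP; split; lra.
apply: countable_bigcupT_measurable; first exact: countableP.
move=> r; have [JA|JA] := pselect (J r `<=` A); last first.
  rewrite (_ : box r = set0); first exact: measurable0.
  by rewrite -subset0 => p [].
rewrite (_ : box r = J r); last by apply/seteqP; split => p // [].
by apply: measurableX; exact: measurable_itv.
Qed.

Lemma closed_measurable2 (A : set (R * R)) :
  closed A -> measurable (A : set (measurableTypeR R * measurableTypeR R)).
Proof.
move=> cA; rewrite -(setCK A); apply: measurableC.
by apply: open_measurable2; exact: closed_openC.
Qed.

Lemma lebesgue_bounded_itv (b0 b1 : bool) x0 x1 : x0 <= x1 ->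
  lebesgue_measure ([set` Interval (BSide b0 x0) (BSide b1 x1)] : set R)
    = (x1 - x0)%:E.
Proof.
move=> x01; rewrite lebesgue_measure_itv /= lte_fin.
case: ltP => [_|x10]; first by rewrite -EFinB.
by rewrite (_ : x1 - x0 = 0)//; lra.
Qed.

(** The product measure is by definition the integral of the lengths of the vertical sections,
    dominated here by [M] times the indicator of [[x0, x1]]. *)
Lemma mu2_le_sections (A : set (R * R)) (x0 x1 M : R) :
  measurable (A : set (measurableTypeR R * measurableTypeR R)) ->
  x0 <= x1 -> 0 <= M ->
  (forall x y, A (x, y) -> x0 <= x <= x1) ->
  (forall x, exists c, forall y, A (x, y) -> c <= y <= c + M) ->
  (mu2 R A <= (M * (x1 - x0))%:E)%E.
Proof.
move=> mA x01 M0 Ax Ay.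
have -> : mu2 R A = (\int[lebesgue_measure]_x lebesgue_measure (xsection A x))%E.
  by [].
have -> : (M * (x1 - x0))%:E =
    (\int[@lebesgue_measure R]_x (M%:E * (\1_(`[x0, x1]%classic : set R) x)%:E))%E.
  rewrite ge0_integralZl_EFin //; first last.
  - by apply/measurable_EFinP; exact: measurable_indic.
  by rewrite integral_indic// setIT EFinM; congr (_ * _)%E;
    exact/esym/lebesgue_bounded_itv.
apply: ge0_le_integral => //.
- exact: measurable_fun_xsection.
- apply/measurable_EFinP; apply: measurable_funM; first exact: measurable_cst.
  exact: measurable_indic.
move=> x _.
have [xin|xout] := boolP (x \in `[x0, x1]).
  rewrite indicE mem_set//= mule1.
  have [c cA] := Ay x.
  have : (lebesgue_measure (xsection A x) <= lebesgue_measure (`[c, (c + M)%R]%classic : set R))%E.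
    apply: le_measure; rewrite ?inE//=; first exact: measurable_xsection.
    by move=> y /xsectionP/cA; rewrite /= in_itv.
  move=> /le_trans; apply; rewrite lebesgue_bounded_itv ?lerDl// lee_fin; lra.
rewrite (_ : xsection A x = set0) ?measure0 ?mule_ge0 ?lee_fin//.
rewrite -subset0 => y /xsectionP/Ax xx; move: xout; rewrite in_itv /= xx//.
Qed.

Lemma mu2_ge_sections (A : set (R * R)) (x0 x1 M : R) :
  measurable (A : set (measurableTypeR R * measurableTypeR R)) ->
  x0 <= x1 -> 0 <= M ->
  (forall x, x0 < x < x1 -> exists c, forall y, c < y < c + M -> A (x, y)) ->
  ((M * (x1 - x0))%:E <= mu2 R A)%E.
Proof.
move=> mA x01 M0 Ay.
have -> : mu2 R A = (\int[lebesgue_measure]_x lebesgue_measure (xsection A x))%E.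
  by [].
have -> : (M * (x1 - x0))%:E =
    (\int[@lebesgue_measure R]_x (M%:E * (\1_(`]x0, x1[%classic : set R) x)%:E))%E.
  rewrite ge0_integralZl_EFin //; first last.
  - by apply/measurable_EFinP; exact: measurable_indic.
  by rewrite integral_indic// setIT EFinM; congr (_ * _)%E;
    exact/esym/lebesgue_bounded_itv.
apply: ge0_le_integral => //.
- by move=> x _; rewrite mule_ge0 ?lee_fin.
- apply/measurable_EFinP; apply: measurable_funM; first exact: measurable_cst.
  exact: measurable_indic.
- exact: measurable_fun_xsection.
move=> x _.
have [xin|xout] := boolP (x \in `]x0, x1[).
  rewrite indicE mem_set//= mule1.
  have [c cA] := Ay x ltac:(by move: xin; rewrite in_itv).
  have : (lebesgue_measure (`]c, (c + M)%R[%classic : set R) <= lebesgue_measure (xsection A x))%E.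
    apply: le_measure; rewrite ?inE//=; first exact: measurable_xsection.
    by move=> y; rewrite /= in_itv /= => /cA Axy; apply/xsectionP.
  by apply: le_trans; rewrite lebesgue_bounded_itv ?lerDl// lee_fin; lra.
by rewrite indicE memNset ?mule0 ?measure_ge0//=; exact/negP.
Qed.

(** A parallelogram given by two linear forms rather than by its vertices: the slabs swept by lines
    parallel to its sides then have the same shape. *)
Definition strip (al be ga de a a' b b' : R) : set (R * R) :=
  [set p | a <= al * p.1 + be * p.2 <= a' /\ b <= ga * p.1 + de * p.2 <= b'].

Lemma closed_strip al be ga de a a' b b' : closed (strip al be ga de a a' b b').
Proof.
have -> : strip al be ga de a a' b b' =
    ([set p | a <= al * p.1 + be * p.2] `&` [set p | - a' <= (- al) * p.1 + (- be) * p.2])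
 `&` ([set p | b <= ga * p.1 + de * p.2] `&` [set p | - b' <= (- ga) * p.1 + (- de) * p.2]).
  apply/seteqP; split => p /=.
    by case=> /andP[h1 h2] /andP[h3 h4]; repeat split; lra.
  by case=> -[h1 h2] [h3 h4]; split; apply/andP; split; lra.
by apply: closedI; apply: closedI; exact: closed_lin_le.
Qed.

(** The first form alone bounds the vertical sections by $(a'-a)/|be|$; Cramer's rule bounds the
    projection on the first axis by [L]. The estimate is not symmetric in the two forms. *)
Lemma mu2_strip_half al be ga de a a' b b' :
  al * de - be * ga != 0 -> be != 0 -> a <= a' -> b <= b' ->
  (mu2 R (strip al be ga de a a' b b') <=
   ((a' - a) / `|be| * ((`|de| * (a' - a) + `|be| * (b' - b)) / `|al * de - be * ga|))%:E)%E.
Proof.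
move=> D0 be0 aa' bb'; set D := al * de - be * ga.
have be1 : 0 < `|be| by rewrite normr_gt0.
have D1 : 0 < `|D| by rewrite normr_gt0.
pose L := (`|de| * (a' - a) + `|be| * (b' - b)) / `|D|.
have L0 : 0 <= L by rewrite divr_ge0// addr_ge0// mulr_ge0// subr_ge0.
pose xc := (de * ((a + a') / 2) - be * ((b + b') / 2)) / D.
have := @mu2_le_sections (strip al be ga de a a' b b') (xc - L / 2) (xc + L / 2)
  ((a' - a) / `|be|).
rewrite (_ : xc + L / 2 - (xc - L / 2) = L); last by lra.
apply.
- by apply: closed_measurable2; exact: closed_strip.
- lra.
- by rewrite divr_ge0// subr_ge0.
- move=> x y [/= /andP[h1 h2] /andP[h3 h4]].
  suff: `|x - xc| <= L / 2 by rewrite ler_norml => /andP[? ?]; apply/andP; split; lra.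
  have -> : x - xc = (de * (al * x + be * y - (a + a') / 2) - be * (ga * x + de * y - (b + b') / 2)) / D.
    by rewrite /xc /D; field.
  rewrite normrM normfV /L -mulrA [_^-1 * 2^-1]mulrC mulrA ler_pM2r ?invr_gt0//.
  apply: (le_trans (ler_normB _ _)); rewrite !normrM.
  have : `|al * x + be * y - (a + a') / 2| <= (a' - a) / 2.
    by rewrite ler_norml; apply/andP; split; lra.
  have : `|ga * x + de * y - (b + b') / 2| <= (b' - b) / 2.
    by rewrite ler_norml; apply/andP; split; lra.
  move=> /(ler_wpM2l (normr_ge0 be)) A1 /(ler_wpM2l (normr_ge0 de)) A2; lra.
- move=> x; exists (((a + a') / 2 - al * x) / be - (a' - a) / `|be| / 2) => y [/= /andP[h1 h2] _].
  rewrite -addrA (_ : - ((a' - a) / `|be| / 2) + (a' - a) / `|be| = (a' - a) / `|be| / 2); last by lra.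
  suff: `|y - ((a + a') / 2 - al * x) / be| <= (a' - a) / `|be| / 2.
    by rewrite ler_norml => /andP[? ?]; apply/andP; split; lra.
  have -> : y - ((a + a') / 2 - al * x) / be = (al * x + be * y - (a + a') / 2) / be.
    by field.
  rewrite normrM normfV -mulrA [_^-1 * 2^-1]mulrC mulrA ler_pM2r ?invr_gt0//.
  by rewrite ler_norml; apply/andP; split; lra.
Qed.

Lemma mu2_strip al be ga de a a' b b' :
  al * de - be * ga != 0 -> a <= a' -> b <= b' ->
  (mu2 R (strip al be ga de a a' b b') <=
   (2 * ((a' - a) * (b' - b)) / `|al * de - be * ga|)%:E)%E.
Proof.
wlog h : al be ga de a a' b b' / be != 0 /\ (a' - a) * `|de| <= (b' - b) * `|be|.
  move=> H D0 aa' bb'.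
  have u0 : 0 <= a' - a by rewrite subr_ge0.
  have v0 : 0 <= b' - b by rewrite subr_ge0.
  have [h|h] := pselect (be != 0 /\ (a' - a) * `|de| <= (b' - b) * `|be|).
    exact: H.
  have h' : de != 0 /\ (b' - b) * `|be| <= (a' - a) * `|de|.
    have [be0|be0] := eqVneq be 0.
      move: D0; rewrite be0 mul0r subr0 mulf_eq0 negb_or => /andP[_ de0].
      by split => //; rewrite normr0 mulr0 mulr_ge0.
    have lt : (b' - b) * `|be| < (a' - a) * `|de|.
      by rewrite ltNge; apply/negP => le; exact: h.
    split; last exact: ltW.
    by apply/eqP => de0; move: lt; rewrite de0 normr0 mulr0 ltNge mulr_ge0.
  have -> : strip al be ga de a a' b b' = strip ga de al be b b' a a'.
    by apply/seteqP; split => p [].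
  have -> : `|al * de - be * ga| = `|ga * be - de * al|.
    by rewrite -normrN; congr (`| _ |); ring.
  rewrite [(a' - a) * _]mulrC; apply: H => //.
  by apply: contraNneq D0 => e; apply/eqP; lra.
case: h => be0 h D0 aa' bb'.
apply: (le_trans (mu2_strip_half D0 be0 aa' bb')); rewrite lee_fin.
have be1 : 0 < `|be| by rewrite normr_gt0.
rewrite [leLHS]mulrA ler_pM2r ?invr_gt0 ?normr_gt0// mulrAC ler_pdivrMr//.
have u0 : 0 <= a' - a by rewrite subr_ge0.
by have := ler_wpM2l u0 h; lra.
Qed.

(** A quarter of the area of the parallelogram is enough: the sections over an interval of length
    $|e2.1|$, where [e2] is the vector with the larger first component, already have length at least
    $|crs\ e1\ e2|/|e2.1|$. *)
Lemma mu2_ge_pgram (A : set (R * R)) (o e1 e2 : R * R) :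
  measurable (A : set (measurableTypeR R * measurableTypeR R)) ->
  (forall s t, `|s| < 1 -> `|t| < 1 -> A (o + s *: e1 + t *: e2)) ->
  (`|crs e1 e2|%:E <= mu2 R A)%E.
Proof.
move=> mA; wlog le12 : e1 e2 / `|e1.1| <= `|e2.1|.
  move=> H hA; have [h|h] := lerP `|e1.1| `|e2.1|; first exact: H.
  have -> : `|crs e1 e2| = `|crs e2 e1|.
    by rewrite -normrN; congr (`| _ |); rewrite /crs; ring.
  apply: H; first exact: ltW.
  by move=> s t s1 t1; rewrite -addrA [X in o + X]addrC addrA; exact: hA.
move=> hA.
have [->|c0] := eqVneq (crs e1 e2) 0; first by rewrite normr0 measure_ge0.
have e20 : e2.1 != 0.
  apply: contraNneq c0 => e20; move: le12; rewrite e20 normr0 normr_le0 => /eqP e10.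
  by rewrite /crs e20 e10 !mul0r mulr0 subr0.
have e21 : 0 < `|e2.1| by rewrite normr_gt0.
pose k := crs e1 e2 / e2.1.
have k0 : k != 0 by rewrite mulf_neq0// invr_neq0.
have -> : `|crs e1 e2| = `|k| * (o.1 + `|e2.1| - o.1).
  by rewrite addrC addKr /k normrM normfV divfK// gt_eqF.
apply: mu2_ge_sections => //; first by rewrite lerDl.
move=> x /andP[x0 x1].
(* The unit interval for [s] is chosen so that [s * e1.1] is nonnegative. Then [t * e2.1] is a
   difference of two numbers in $[0,|e2.1|)$, which gives $|t|<1$. *)
pose s0 : R := if 0 <= e1.1 then 0 else -1.
have hs s : s0 < s < s0 + 1 -> `|s| < 1 /\ 0 <= s * e1.1 < `|e2.1|.
  rewrite /s0; case: ifPn => h /andP[s1 s2]; rewrite ltr_norml.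
    move: le12; rewrite (ger0_norm h) => le12.
    by split; [lra|apply/andP; split; [rewrite mulr_ge0//; lra|nra]].
  move: h; rewrite -ltNge => h.
  move: le12; rewrite (ltr0_norm h) => le12.
  by split; [lra|apply/andP; split; nra].
pose y0 := o.2 + (x - o.1) * e2.2 / e2.1.
exists (if 0 < k then y0 - k * (s0 + 1) else y0 - k * s0) => y hy.
pose s := (y0 - y) / k.
have {hy} /hs[s1 /andP[se0 se1]] : s0 < s < s0 + 1.
  move: hy; case: ifPn => hk /andP[y1 y2].
    move: y2; rewrite (gtr0_norm hk) => y2.
    by rewrite /s ltr_pdivlMr// ltr_pdivrMr//; apply/andP; split; lra.
  have {}hk : k < 0 by rewrite lt_neqAle k0 leNgt.
  move: y2; rewrite (ltr0_norm hk) => y2.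
  by rewrite /s ltr_ndivlMr// ltr_ndivrMr//; apply/andP; split; lra.
pose t := (x - o.1 - s * e1.1) / e2.1.
have t1 : `|t| < 1.
  by rewrite /t normrM normfV ltr_pdivrMr// mul1r ltr_norml; apply/andP; split; lra.
have := hA s t s1 t1; congr A.
rewrite [RHS]surjective_pairing; congr pair; rewrite /=.
  by rewrite /t -[_ *: e1.1]/(s * e1.1) -[_ *: e2.1]/((x - o.1 - s * e1.1) / e2.1 * e2.1) divfK//; ring.
rewrite -[_ *: e1.2]/(s * e1.2) -[_ *: e2.2]/(t * e2.2).
rewrite /t /s /y0 /k /crs; field.
by rewrite e20; exact: c0.
Qed.

Lemma area_ge0 (A : set (R * R)) : 0 <= area A.
Proof. exact/fine_ge0/measure_ge0. Qed.

(** The sets on which [area] is meaningful: it goes through [fine], which sends an infinite measure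
    to 0. *)
Definition fm (A : set (R * R)) : Prop :=
  measurable (A : set (measurableTypeR R * measurableTypeR R)) /\
  (mu2 R A < +oo)%E.

Lemma fm_area A : fm A -> mu2 R A = (area A)%:E.
Proof. by move=> [mA A1]; rewrite /area fineK// ge0_fin_numE. Qed.

Lemma fm_sub (A B : set (R * R)) : fm B ->
  measurable (A : set (measurableTypeR R * measurableTypeR R)) ->
  A `<=` B -> fm A.
Proof.
move=> [mB B1] mA AB; split => //; apply: le_lt_trans B1.
by apply: le_measure; rewrite ?inE.
Qed.

Lemma area_le (A B : set (R * R)) : fm B ->
  measurable (A : set (measurableTypeR R * measurableTypeR R)) ->
  A `<=` B -> area A <= area B.
Proof.
move=> fB mA AB; have fA := fm_sub fB mA AB.
rewrite -lee_fin -!fm_area//; case: fB => mB _.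
by apply: le_measure; rewrite ?inE.
Qed.

Lemma fm_setI (A B : set (R * R)) : fm A -> fm B -> fm (A `&` B).
Proof.
move=> fA [mB _]; apply: (fm_sub fA); last exact: subIsetl.
by apply: measurableI => //; case: fA.
Qed.

Lemma fm_setU (A B : set (R * R)) : fm A -> fm B -> fm (A `|` B).
Proof.
move=> [mA fA] [mB fB]; split; first exact: measurableU.
apply: (@le_lt_trans _ _ (mu2 R A + mu2 R B)%E); first exact: measureU2.
exact: lte_add_pinfty.
Qed.

Lemma area_setU_le (A B : set (R * R)) : fm A -> fm B ->
  area (A `|` B) <= area A + area B.
Proof.
move=> fA fB; rewrite -lee_fin EFinD -!fm_area//; last exact: fm_setU.
by case: fA fB => mA _ [mB _]; exact: measureU2.
Qed.

Lemma fm_strip al be ga de a a' b b' :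
  al * de - be * ga != 0 -> a <= a' -> b <= b' -> fm (strip al be ga de a a' b b').
Proof.
move=> D0 aa bb; split; first by apply: closed_measurable2; exact: closed_strip.
by apply: (le_lt_trans (mu2_strip D0 aa bb)); rewrite ltry.
Qed.

Lemma area_strip al be ga de a a' b b' :
  al * de - be * ga != 0 -> a <= a' -> b <= b' ->
  area (strip al be ga de a a' b b') <=
  2 * ((a' - a) * (b' - b)) / `|al * de - be * ga|.
Proof.
move=> D0 aa bb; rewrite -lee_fin -fm_area; first exact: mu2_strip.
exact: fm_strip.
Qed.

Lemma area_ge_pgram (A : set (R * R)) (o e1 e2 : R * R) : fm A ->
  (forall s t, `|s| < 1 -> `|t| < 1 -> A (o + s *: e1 + t *: e2)) ->
  `|crs e1 e2| <= area A.
Proof.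
move=> fA h; rewrite -lee_fin -fm_area//; apply: mu2_ge_pgram h.
by case: fA.
Qed.

Definition bd (A : set (R * R)) :=
  exists M : R, forall p : R * R, A p -> `|p.1| <= M /\ `|p.2| <= M.

Lemma bd_strip A : bd A -> exists2 M : R, 0 <= M & A `<=` strip 1 0 0 1 (- M) M (- M) M.
Proof.
move=> [M AM]; exists `|M| => // p /AM[h1 h2]; rewrite /strip /=.
rewrite !mul1r !mul0r addr0 add0r -!ler_norml.
by split; [apply: (le_trans h1)|apply: (le_trans h2)]; exact: ler_norm.
Qed.

Lemma bd_fm (A : set (R * R)) : bd A ->
  measurable (A : set (measurableTypeR R * measurableTypeR R)) -> fm A.
Proof.
move=> /bd_strip[M M0 AM] mA; apply: fm_sub AM => //.
by apply: fm_strip; rewrite ?mulr1 ?mul0r ?subr0 ?oner_neq0//; lra.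
Qed.

Lemma bd_sub A B : bd B -> A `<=` B -> bd A.
Proof. by move=> [M BM] AB; exists M => p /AB/BM. Qed.

Lemma bounded_bd (A : set (R * R)) : bounded_set A -> bd A.
Proof.
move=> [M [_ AM]]; exists (M + 1) => p Ap.
have /= := AM (M + 1) ltac:(by rewrite ltrDl) p Ap.
by rewrite prod_normE ge_max => /andP[].
Qed.

Notation null := ((mu2 R).-negligible).

(** The set lies in a strip of width zero for the given form, closed off by the orthogonal form
    [(- be, al)]. *)
Lemma line_null (A : set (R * R)) (al be c : R) : bd A ->
  (al != 0) || (be != 0) ->
  (forall p, A p -> al * p.1 + be * p.2 = c) -> null A.
Proof.
move=> [M AM] ab Ac.
pose N := (`|al| + `|be|) * `|M|.
have N0 : 0 <= N by rewrite mulr_ge0// addr_ge0.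
have D0 : al * al - be * (- be) != 0.
  rewrite mulrN opprK -!expr2 paddr_eq0 ?sqr_ge0// !sqrf_eq0 negb_and.
  by case/orP: ab => ->; rewrite ?orbT.
exists (strip al be (- be) al c c (- N) N); split.
- by apply: closed_measurable2; exact: closed_strip.
- apply/eqP; rewrite eq_le measure_ge0 andbT.
  apply: (le_trans (mu2_strip D0 _ _)) => //; first lra.
  by rewrite subrr mul0r mulr0 mul0r.
- move=> p Ap; split; first by rewrite Ac// lexx.
  have [h1 h2] := AM p Ap; rewrite -ler_norml.
  apply: (le_trans (ler_normD _ _)); rewrite !normrM normrN /N.
  rewrite mulrDl addrC; apply: lerD; apply: ler_wpM2l => //.
    by apply: (le_trans h2); exact: ler_norm.
  by apply: (le_trans h1); exact: ler_norm.
Qed.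

Lemma ball2 (p : R * R) (A : set (R * R)) : nbhs p A ->
  exists2 e : R, 0 < e & forall q, `|q.1 - p.1| < e -> `|q.2 - p.2| < e -> A q.
Proof.
move=> /nbhs_ballP[e /= e0 eA]; exists e => // q h1 h2.
by apply: eA; split; rewrite /ball /= distrC.
Qed.

Lemma open_area_gt0 (A : set (R * R)) : fm A -> open A -> A !=set0 -> 0 < area A.
Proof.
move=> fA oA [p Ap].
have /ball2[e e0 eA] : nbhs p A by exact: open_nbhs_nbhs.
apply: lt_le_trans (@area_ge_pgram A p (e, 0) (0, e) fA _).
  by rewrite /crs /= mul0r subr0 normr_gt0 mulf_neq0// gt_eqF.
move=> s t s1 t1; apply: eA => /=.
  rewrite -[_ *: _]/(s * e) -[t *: 0]/(t * 0) mulr0 addr0 addrC addKr normrM (gtr0_norm e0).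
  by rewrite -[ltRHS]mul1r ltr_pM2r.
rewrite -[_ *: e]/(t * e) -[s *: 0]/(s * 0) mulr0 addr0 addrC addKr normrM (gtr0_norm e0).
by rewrite -[ltRHS]mul1r ltr_pM2r.
Qed.

(** Integration of an almost everywhere inequality between simple functions. The geometric estimates
    below are put in this shape, so that they become inequalities between finite sums. *)
Lemma area_sum_le (I K : finType) (c : I -> R) (A : I -> set (R * R))
    (b : K -> R) (B : K -> set (R * R)) (N : set (R * R)) :
  (forall i, 0 <= c i) -> (forall k, 0 <= b k) ->
  (forall i, fm (A i)) -> (forall k, fm (B k)) -> null N ->
  (forall p, ~ N p -> \sum_i c i * \1_(A i) p <= \sum_k b k * \1_(B k) p) ->
  \sum_i c i * area (A i) <= \sum_k b k * area (B k).
Proof.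
move=> c0 b0 fA fB nN h.
have H (J : finType) (d : J -> R) (D : J -> set (R * R)) : (forall j, 0 <= d j) ->
    (forall j, fm (D j)) ->
    (\int[mu2 R]_p (\sum_j d j * \1_(D j) p)%:E)%E = (\sum_j d j * area (D j))%:E.
  move=> d0 fD.
  under eq_integral do rewrite -sumEFin.
  rewrite ge0_integral_sum//; first last.
  - by move=> j p _; rewrite lee_fin mulr_ge0.
  - move=> j; apply/measurable_EFinP; apply: measurable_funM; first exact: measurable_cst.
    by apply: measurable_indic; case: (fD j).
  rewrite -sumEFin; apply: eq_bigr => j _.
  under eq_integral do rewrite EFinM.
  have mD : measurable (D j : set (measurableTypeR R * measurableTypeR R)) by case: (fD j).
  rewrite ge0_integralZl_EFin //; last first.
    by apply/measurable_EFinP; exact: measurable_indic.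
  by rewrite integral_indic// setIT EFinM -fm_area.
rewrite -lee_fin -!H//.
have mH (J : finType) (d : J -> R) (D : J -> set (R * R)) : (forall j, fm (D j)) ->
    measurable_fun [set: measurableTypeR R * measurableTypeR R]
     (fun p => (\sum_j d j * \1_(D j) p)%:E).
  move=> fD; apply/measurable_EFinP; apply: measurable_sum => j.
  apply: measurable_funM; first exact: measurable_cst.
  by apply: measurable_indic; case: (fD j).
apply: ae_ge0_le_integral => //.
- by move=> p _; rewrite lee_fin sumr_ge0// => i _; rewrite mulr_ge0.
- exact: mH.
- by move=> p _; rewrite lee_fin sumr_ge0// => i _; rewrite mulr_ge0.
- exact: mH.
- apply: negligibleS nN => p /= hp; apply: contrapT => Np; apply: hp => _.
  by rewrite lee_fin; exact: h.
Qed.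

End Plane.
Notation null := ((mu2 _).-negligible).


(** * The total variation inequality *)

Section Graph.
Variables (R : realType) (I D : finType) (e1 e2 : D -> I) (g : I -> R).
Variable hit : pred D.

Definition adj (i j : I) : bool := [exists d, hit d &&
  ((e1 d == i) && (e2 d == j) || (e1 d == j) && (e2 d == i))].

(** On a path without repetition each edge pays once: the edge leaving [i] has [i] as an end, hence
    is absent from the sum attached to the tail. *)
Lemma path_osc (s : seq I) (i : I) : path adj i s -> uniq (i :: s) ->
  `|g i - g (last i s)| <=
  \sum_(d | [&& hit d, e1 d \in i :: s & e2 d \in i :: s]) `|g (e1 d) - g (e2 d)|.
Proof.
elim: s i => [|j s IH] i /=; first by rewrite subrr normr0 sumr_ge0.
case/andP => /existsP[d0 /andP[hd0 ed0]] ps /andP[inotin us].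
have gd0 : `|g i - g j| = `|g (e1 d0) - g (e2 d0)|.
  by case/orP: ed0 => /andP[/eqP-> /eqP->] //; rewrite distrC.
rewrite (bigD1 d0) /=; last first.
  by rewrite hd0; case/orP: ed0 => /andP[/eqP-> /eqP->]; rewrite !inE !eqxx ?orbT.
rewrite -gd0; have := IH j ps us => /= {}IH.
have -> : g i - g (last j s) = (g i - g j) + (g j - g (last j s)) by ring.
apply: (le_trans (ler_normD _ _)).
apply: lerD => //; apply: (le_trans IH).
rewrite big_mkcond [leRHS]big_mkcond; apply: ler_sum => d _.
case: ifPn => [/and3P[hd d1 d2]|_]; last by case: ifP.
rewrite hd (in_cons i) d1 orbT (in_cons i) d2 orbT /=; case: ifPn => //.
rewrite negbK => /eqP dd; subst d0; move: inotin.
by case/orP: ed0 => /andP[/eqP ? /eqP ?]; subst; rewrite ?d1 ?d2.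
Qed.

Lemma connect_osc (i j : I) : connect adj i j ->
  `|g i - g j| <= \sum_(d | hit d) `|g (e1 d) - g (e2 d)|.
Proof.
case/connectP => s ps ->; case: (shortenP ps) => s' ps' us' _.
apply: (le_trans (path_osc ps' us')).
rewrite big_mkcond [leRHS]big_mkcond; apply: ler_sum => d _.
by case: ifPn => [/and3P[-> _ _]|_]//; case: ifP.
Qed.

End Graph.

(** * Partitions with jumps carried by segments *)

Section JumpComplex.
Variable R : realType.
Implicit Types (Omega : set (R * R)).

(* A partition whose common boundaries are covered, off the finite set [X], by
   segments: a point of two closures [F i], [F j] lies on some [S d] with
   [{e1 d, e2 d} = {i, j}].  Segments with [e1 d = e2 d] are harmless. *)
Record jump_complex Omega (I D : finType) (F : I -> set (R * R))
    (e1 e2 : D -> I) (S : D -> (R * R) * (R * R)) (X : seq (R * R)) : Prop :=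
  JumpComplex {
  jc_open : forall i, open (F i);
  jc_sub : forall i, F i `<=` Omega;
  jc_disj : forall i j p, F i p -> F j p -> i = j;
  jc_cover : Omega `<=` \bigcup_i closure (F i);
  jc_null : null (Omega `\` \bigcup_i F i);
  jc_jump : forall z i j, Omega z -> z \notin X -> i != j ->
    closure (F i) z -> closure (F j) z ->
    exists d, segment (S d).1 (S d).2 z /\
      (e1 d = i /\ e2 d = j \/ e1 d = j /\ e2 d = i)
}.

(** Split the cells according to whether they are reachable from [i] through jumps met by [G]. The
    closures of the two classes cover [G], and a common point in [G] would provide a further jump;
    each class is thus relatively clopen in [G], and connectedness puts [q] in the first one. *)
Lemma connected_osc Omega (I D : finType) (F : I -> set (R * R)) e1 e2 S X
    (G : set (R * R)) (g : I -> R) p q i j :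
  @jump_complex Omega I D F e1 e2 S X ->
  connected G -> G `<=` Omega -> (forall z, G z -> z \notin X) ->
  G p -> G q -> F i p -> F j q ->
  `|g i - g j| <= \sum_(d | `[< exists z, G z /\ segment (S d).1 (S d).2 z >])
                     `|g (e1 d) - g (e2 d)|.
Proof.
move=> jc cG GO GX Gp Gq Fp Fq.
pose hit d := `[< exists z, G z /\ segment (S d).1 (S d).2 z >].
apply: connect_osc.
apply: contrapT => nconn.
pose U := \bigcup_(k in [set k | connect (adj e1 e2 hit) i k]) closure (F k).
pose W := \bigcup_(k in [set k | ~ connect (adj e1 e2 hit) i k]) closure (F k).
have cU : closed U.
  by apply: closed_bigcup => [|k _]; [exact: finite_finset|exact: closed_closure].
have cW : closed W.
  by apply: closed_bigcup => [|k _]; [exact: finite_finset|exact: closed_closure].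
have UW z : G z -> U z -> W z -> False.
  move=> Gz [k /= ik Fkz] [l /= il Flz].
  have kl : k != l by apply/eqP => kl; apply: il; rewrite -kl.
  have [d [Sd ed]] := jc_jump jc (GO _ Gz) (GX _ Gz) kl Fkz Flz.
  apply: il; apply: connect_trans ik _; apply: connect1; apply/existsP; exists d.
  apply/andP; split; first by apply/asboolP; exists z.
  by case: ed => -[-> ->]; rewrite !eqxx ?orbT.
have UoW z : G z -> U z \/ W z.
  move=> Gz; have [k _ Fkz] := jc_cover jc (GO _ Gz).
  have [h|h] := pselect (connect (adj e1 e2 hit) i k); first by left; exists k.
  by right; exists k.
have GU : G `&` U = G.
  apply: cG.
  - by exists p; split => //; exists i => //=; exact: subset_closure.
  - exists (~` W); first exact: closed_openC.
    apply/seteqP; split => z [Gz Uz]; split => //; first by move=> Wz; exact: UW Gz Uz Wz.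
    by case: (UoW _ Gz).
  - by exists U.
have [_ [k /= ik Fkq]] : (G `&` U) q by rewrite GU.
have [z [Fkz Fjz]] := Fkq (F j) (open_nbhs_nbhs (conj (jc_open jc (i := j)) Fq)).
by apply: nconn; rewrite -(jc_disj jc Fkz Fjz).
Qed.

Lemma null_seq (T : eqType) (s : seq T) (F : T -> set (R * R)) :
  (forall x, x \in s -> null (F x)) -> null [set p | exists2 x, x \in s & F x p].
Proof.
elim: s => [|x s IH] h.
  apply: (@negligibleS _ _ _ _ set0) => [p []//|]; exact: negligible_set0.
have h1 := h x (mem_head _ _).
have h2 := IH (fun y ys => h y ltac:(by rewrite inE ys orbT)).
apply: negligibleS (negligibleU h1 h2) => p [y /=].
by rewrite inE => /orP[/eqP->|ys] Fp; [left|right; exists y].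
Qed.

(* The sum depends on [p] only through the finite pattern of memberships, so
   its infimum off a null set is attained. *)
Lemma exists_min_sum (K : finType) (b : K -> R) (B : K -> set (R * R))
    (A N : set (R * R)) :
  (forall k, 0 <= b k) -> (forall k, fm (B k)) -> fm A -> 0 < area A -> null N ->
  exists q, [/\ A q, ~ N q &
    (\sum_k b k * \1_(B k) q) * area A <= \sum_k b k * area (B k)].
Proof.
move=> b0 fB fA A0 nN.
pose pat p : {ffun K -> bool} := [ffun k => p \in B k].
pose P : pred {ffun K -> bool} := fun v => `[< exists p, [/\ A p, ~ N p & v = pat p] >].
pose f (v : {ffun K -> bool}) : R := \sum_k b k * (v k)%:R.
have fE p : \sum_k b k * \1_(B k) p = f (pat p).
  by apply: eq_bigr => k _; rewrite indicE ffunE.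
have [p0 Ap0 Np0] : exists2 p, A p & ~ N p.
  apply: contrapT => h.
  have /negligibleP : null A.
    by apply: negligibleS nN => p Ap; apply: contrapT => Np; apply: h; exists p.
  case: (fA) => mA _ /(_ mA) muA.
  by move: A0; rewrite /area; move: muA => ->; rewrite ltxx.
have Pp0 : P (pat p0) by apply/asboolP; exists p0.
case: (@arg_minP _ R _ (pat p0) P f Pp0) => v /asboolP[q [Aq Nq vq]] vmin.
exists q; split => //; rewrite fE -vq.
have := @area_sum_le R 'I_1 K (fun=> f v) (fun=> A) b B N.
rewrite big_ord1; apply => //.
- by move=> _; apply: sumr_ge0 => k _; rewrite mulr_ge0.
move=> p Np; rewrite big_ord1 indicE; case: (boolP (p \in A)) => /= [pA|_].
  rewrite mulr1 fE; apply: vmin; apply/asboolP; exists p; split => //.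
  by rewrite inE in pA.
by rewrite mulr0; apply: sumr_ge0 => k _; rewrite mulr_ge0.
Qed.

Lemma segment_lin (al be : R) (x y z : R * R) (S := fun p : R * R => al * p.1 + be * p.2) :
  segment x y z -> Num.min (S x) (S y) <= S z <= Num.max (S x) (S y).
Proof.
case=> t /= /andP[t0 t1] <-; rewrite /S /=.
have -> : al * (x.1 + t * (y.1 - x.1)) + be * (x.2 + t * (y.2 - x.2)) =
  (1 - t) * (al * x.1 + be * x.2) + t * (al * y.1 + be * y.2) by ring.
move: (al * x.1 + _) (al * y.1 + _) => u v.
by case: (leP u v) => uv; apply/andP; split; nra.
Qed.

Lemma norm_fst_enorm (v : R * R) : `|v.1| <= enorm v.
Proof.
rewrite /enorm /dot -sqrtr_sqr ler_sqrt; first by rewrite expr2 lerDl -expr2 sqr_ge0.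
by rewrite addr_ge0// -expr2 sqr_ge0.
Qed.

Lemma norm_snd_enorm (v : R * R) : `|v.2| <= enorm v.
Proof.
rewrite /enorm /dot -sqrtr_sqr ler_sqrt; first by rewrite expr2 lerDr -expr2 sqr_ge0.
by rewrite addr_ge0// -expr2 sqr_ge0.
Qed.

Lemma enorm_ge0 (v : R * R) : 0 <= enorm v. Proof. exact: sqrtr_ge0. Qed.

Lemma segment_lin_width (al be : R) (x y : R * R) (S := fun p : R * R => al * p.1 + be * p.2) :
  Num.max (S x) (S y) - Num.min (S x) (S y) <= (`|al| + `|be|) * enorm (y - x).
Proof.
have -> : Num.max (S x) (S y) - Num.min (S x) (S y) = `|S y - S x|.
  case: (leP (S x) (S y)) => h; first by rewrite ger0_norm// subr_ge0.
  by rewrite distrC gtr0_norm// subr_gt0.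
have -> : S y - S x = al * (y - x).1 + be * (y - x).2 by rewrite /S /=; ring.
apply: (le_trans (ler_normD _ _)); rewrite !normrM mulrDl.
by apply: lerD; apply: ler_wpM2l => //; [exact: norm_fst_enorm|exact: norm_snd_enorm].
Qed.

Definition total_jump (I D : finType) (e1 e2 : D -> I) (S : D -> (R * R) * (R * R))
    (g : I -> R) : R :=
  \sum_d enorm ((S d).2 - (S d).1) * `|g (e1 d) - g (e2 d)|.

Definition ostrip (al be ga de a a' b b' : R) : set (R * R) :=
  [set p | a < al * p.1 + be * p.2 < a' /\ b < ga * p.1 + de * p.2 < b'].

Lemma open_ostrip al be ga de a a' b b' : open (ostrip al be ga de a a' b b').
Proof.
have -> : ostrip al be ga de a a' b b' =
    ([set p | a < al * p.1 + be * p.2] `&` [set p | - a' < (- al) * p.1 + (- be) * p.2])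
 `&` ([set p | b < ga * p.1 + de * p.2] `&` [set p | - b' < (- ga) * p.1 + (- de) * p.2]).
  apply/seteqP; split => p /=.
    by case=> /andP[h1 h2] /andP[h3 h4]; repeat split; lra.
  by case=> -[h1 h2] [h3 h4]; split; apply/andP; split; lra.
by apply: openI; apply: openI; exact: open_lin_lt.
Qed.

Lemma ostripC al be ga de a a' b b' :
  ostrip al be ga de a a' b b' = ostrip ga de al be b b' a a'.
Proof. by apply/seteqP; split => p []. Qed.

(** [J] inverts the pair of forms by Cramer's rule, so the set is empty or the continuous image of
    an interval. *)
Lemma connected_line al be ga de a a' b b' u : al * de - be * ga != 0 ->
  connected (ostrip al be ga de a a' b b' `&` [set p | ga * p.1 + de * p.2 = u]).
Proof.
move=> D0; set A := _ `&` _.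
pose J (s : R) : R * R := ((de * s - be * u) / (al * de - be * ga), (al * u - ga * s) / (al * de - be * ga)).
have [ub|ub] := boolP (b < u < b'); last first.
  rewrite (_ : A = set0); first exact: connected0.
  rewrite -subset0 => p [[_ h] /= hu]; by move: ub; rewrite -hu h.
have -> : A = [set J s | s in `]a, a'[%classic].
  apply/seteqP; split => [p [[h1 h2] /= hu]|p [s /= hs <-]].
    exists (al * p.1 + be * p.2); first by rewrite /= in_itv.
    rewrite [RHS]surjective_pairing /J -hu; congr pair; field; exact: D0.
  suff -> : A (J s) = (((a < s < a') /\ (b < u < b')) /\ u = u) :> Prop.
    by split => //; split => //; move: hs; rewrite in_itv.
  rewrite /A /ostrip /setI /= /J /=.
  have -> : al * ((de * s - be * u) / (al * de - be * ga)) + be * ((al * u - ga * s) / (al * de - be * ga)) = s.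
    by field.
  have -> : ga * ((de * s - be * u) / (al * de - be * ga)) + de * ((al * u - ga * s) / (al * de - be * ga)) = u.
    by field.
  by [].
apply: connected_continuous_connected.
  by apply/connected_intervalP; exact: interval_is_interval.
apply: continuous_subspaceT => s.
apply: (@cvg_pair _ _ _ (nbhs s) (nbhs (J s).1) (nbhs (J s).2)); rewrite /=.
- apply: cvgM; last exact: cvg_cst.
  by apply: cvgB; [apply: cvgM => //; exact: cvg_cst|exact: cvg_cst].
- apply: cvgM; last exact: cvg_cst.
  by apply: cvgB; [exact: cvg_cst|apply: cvgM => //; exact: cvg_cst].
Qed.


(** The constant [C] is quantified before the partition and may depend only on [Omega] and [A],
    whereas [t] may depend on everything. The right-hand side counts all the segments, also those
    away from [A], which makes gluing easy. *)
Definition good Omega (A : set (R * R)) : Prop :=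
  [/\ open A, A `<=` Omega & exists2 C : R, 0 <= C &
   forall (I D : finType) F e1 e2 S X, @jump_complex Omega I D F e1 e2 S X ->
   forall g : I -> R, exists t,
     \sum_i (g i - t) ^+ 2 * area (F i `&` A) <= C * total_jump e1 e2 S g ^+ 2].

Lemma osc_product_bound (x m a b : R) : 0 <= a -> 0 <= b -> 0 <= m ->
  `|x| <= a + m -> `|x| <= b + m ->
  x ^+ 2 <= a * b + m * a + m * b + m ^+ 2.
Proof.
move=> a0 b0 m0 h1 h2; rewrite -real_normK ?num_real// expr2.
apply: (@le_trans _ _ ((a + m) * (b + m))); first exact: ler_pM.
by rewrite (_ : (a + m) * (b + m) = a * b + m * a + m * b + m ^+ 2)//; ring.
Qed.

(** * The inequality on a parallelogram *)

Section Parallelogram.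
Variables (Omega : set (R * R)) (al be ga de a a' b b' : R).
Hypotheses (bO : bd Omega) (oO : open Omega).
Hypothesis D0 : al * de - be * ga != 0.
Hypotheses (aa' : a < a') (bb' : b < b').
Let P := ostrip al be ga de a a' b b'.
Let t1 (p : R * R) := al * p.1 + be * p.2.
Let t2 (p : R * R) := ga * p.1 + de * p.2.
Hypothesis PO : P `<=` Omega.

Let fmP : fm P.
Proof.
apply: bd_fm; first exact: bd_sub PO.
by apply: open_measurable2; exact: open_ostrip.
Qed.

Let areaP : 0 < area P.
Proof.
apply: open_area_gt0 => //; first exact: open_ostrip.
pose s := (a + a') / 2; pose t := (b + b') / 2.
exists ((de * s - be * t) / (al * de - be * ga), (al * t - ga * s) / (al * de - be * ga)).
rewrite /P /ostrip /=.
have -> : al * ((de * s - be * t) / (al * de - be * ga)) + be * ((al * t - ga * s) / (al * de - be * ga)) = s.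
  by field.
have -> : ga * ((de * s - be * t) / (al * de - be * ga)) + de * ((al * t - ga * s) / (al * de - be * ga)) = t.
  by field.
by move: aa' bb' => h1 h2; rewrite /s /t; split; apply/andP; split; lra.
Qed.

(** The points of [P] through which the line of constant [t1] meets the segment [s]. Summing the
    jumps against these indicators gives the variation seen along that line. *)
Let slab1 (s : (R * R) * (R * R)) : set (R * R) :=
  P `&` [set p | Num.min (t1 s.1) (t1 s.2) <= t1 p <= Num.max (t1 s.1) (t1 s.2)].
Let slab2 (s : (R * R) * (R * R)) : set (R * R) :=
  P `&` [set p | Num.min (t2 s.1) (t2 s.2) <= t2 p <= Num.max (t2 s.1) (t2 s.2)].

Let fm_slab (x y u v : R) : fm (P `&` [set p | u <= x * p.1 + y * p.2 <= v]).
Proof.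
apply: (fm_sub fmP); last exact: subIsetl.
apply: measurableI; first by case: fmP.
apply: closed_measurable2.
have -> : [set p : R * R | u <= x * p.1 + y * p.2 <= v] =
  [set p | u <= x * p.1 + y * p.2] `&` [set p | - v <= (- x) * p.1 + (- y) * p.2].
  apply/seteqP; split => p /=; first by case/andP => h1 h2; split; lra.
  by case=> h1 h2; apply/andP; split; lra.
by apply: closedI; exact: closed_lin_le.
Qed.

Let fm_slab1 s : fm (slab1 s).
Proof. exact: fm_slab. Qed.
Let fm_slab2 s : fm (slab2 s).
Proof. exact: fm_slab. Qed.

Let width1 : R := `|al| + `|be|.
Let width2 : R := `|ga| + `|de|.
(** One constant for three area bounds: two crossing slabs ([width1 * width2]) and a single slab of
    either family, which runs across the whole of [P]. The prefactor comes from [area_strip]. *)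
Let K0 : R := 2 / `|al * de - be * ga| *
  (width1 * width2 + (a' - a) * width2 + (b' - b) * width1).
Let len (s : (R * R) * (R * R)) := enorm (s.2 - s.1).

Let normD : 0 < `|al * de - be * ga|.
Proof. by rewrite normr_gt0. Qed.
Let w1_ge0 : 0 <= width1.
Proof. by rewrite addr_ge0. Qed.
Let w2_ge0 : 0 <= width2.
Proof. by rewrite addr_ge0. Qed.
Let len_ge0 s : 0 <= len s.
Proof. exact: enorm_ge0. Qed.

Let K0_ge0 : 0 <= K0.
Proof.
rewrite /K0 mulr_ge0// ?divr_ge0//.
by rewrite !addr_ge0// mulr_ge0// subr_ge0 ltW.
Qed.

Let minmax (x y : R) : Num.min x y <= Num.max x y.
Proof. by rewrite ge_min !le_max lexx. Qed.

Let area_bound (A : set (R * R)) u u' v v' w :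
  measurable (A : set (measurableTypeR R * measurableTypeR R)) ->
  A `<=` strip al be ga de u u' v v' -> u <= u' -> v <= v' ->
  (u' - u) * (v' - v) <= w ->
  area A <= 2 / `|al * de - be * ga| * w.
Proof.
move=> mA AS uu vv h; apply: (le_trans (area_le (fm_strip D0 uu vv) mA AS)).
apply: (le_trans (area_strip D0 uu vv)).
by rewrite mulrAC; apply: ler_wpM2l => //; rewrite divr_ge0.
Qed.

(** Slabs of different families cross in a parallelogram whose sides are proportional to the two
    lengths. This product structure, special to the plane, is what produces the square of the total
    variation. *)
Let area_slab12 s s' : area (slab1 s `&` slab2 s') <= K0 * (len s * len s').
Proof.
apply: (@le_trans _ _ (2 / `|al * de - be * ga| * ((width1 * len s) * (width2 * len s')))).
  apply: (@area_bound _ (Num.min (t1 s.1) (t1 s.2)) (Num.max (t1 s.1) (t1 s.2))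
     (Num.min (t2 s'.1) (t2 s'.2)) (Num.max (t2 s'.1) (t2 s'.2))) => //.
  - by case: (fm_setI (fm_slab1 s) (fm_slab2 s')).
  - by move=> p [[_ h1] [_ h2]].
  - by apply: ler_pM; rewrite ?subr_ge0//; exact: segment_lin_width.
rewrite /K0 -!mulrA; apply: ler_wpM2l => //; apply: ler_wpM2l; first by rewrite invr_ge0.
have -> : width1 * (len s * (width2 * len s')) = width1 * width2 * (len s * len s') by ring.
apply: ler_wpM2r; first exact: mulr_ge0.
by rewrite -addrA lerDl addr_ge0// mulr_ge0// subr_ge0 ltW.
Qed.

Let area_slab1 s : area (slab1 s) <= K0 * len s.
Proof.
apply: (@le_trans _ _ (2 / `|al * de - be * ga| * ((width1 * len s) * (b' - b)))).
  apply: (@area_bound _ (Num.min (t1 s.1) (t1 s.2)) (Num.max (t1 s.1) (t1 s.2)) b b') => //.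
  - by case: (fm_slab1 s).
  - by move=> p [[_ /andP[h1 h2]] h]; split => //; apply/andP; split; exact: ltW.
  - exact: ltW.
  - by apply: ler_wpM2r; [rewrite subr_ge0 ltW|exact: segment_lin_width].
rewrite /K0 -!mulrA; apply: ler_wpM2l => //; apply: ler_wpM2l; first by rewrite invr_ge0.
have -> : width1 * (len s * (b' - b)) = (b' - b) * width1 * len s by ring.
apply: ler_wpM2r => //.
by rewrite lerDr addr_ge0// mulr_ge0// subr_ge0 ltW.
Qed.

Let area_slab2 s : area (slab2 s) <= K0 * len s.
Proof.
apply: (@le_trans _ _ (2 / `|al * de - be * ga| * ((a' - a) * (width2 * len s)))).
  apply: (@area_bound _ a a' (Num.min (t2 s.1) (t2 s.2)) (Num.max (t2 s.1) (t2 s.2))) => //.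
  - by case: (fm_slab2 s).
  - by move=> p [[/andP[h1 h2] _] h]; split => //; apply/andP; split; exact: ltW.
  - exact: ltW.
  - by apply: ler_wpM2l; [rewrite subr_ge0 ltW|exact: segment_lin_width].
rewrite /K0 -!mulrA; apply: ler_wpM2l => //; apply: ler_wpM2l; first by rewrite invr_ge0.
have -> : (a' - a) * (width2 * len s) = (a' - a) * width2 * len s by ring.
apply: ler_wpM2r => //.
have : 0 <= width1 * width2 by exact: mulr_ge0.
have : 0 <= (b' - b) * width1 by rewrite mulr_ge0// subr_ge0 ltW.
lra.
Qed.

Lemma good_ostrip : good Omega P.
Proof.
split => //; first exact: open_ostrip.
(* [K0] comes from the crossing slabs. The minimal variation [m] is at most [2 * K0 * TV / area P],
   so each of the two cross terms costs one [Z] and [m ^+ 2] costs two, with [Z] equal to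
   [2 * K0 ^+ 2 * TV ^+ 2 / area P]. *)
exists (K0 + 8 * K0 ^+ 2 / area P).
  apply: addr_ge0 => //; apply: divr_ge0; last exact: area_ge0.
  by apply: mulr_ge0 => //; exact: sqr_ge0.
move=> I D F e1 e2 S X jc g.
pose j d : R := `|g (e1 d) - g (e2 d)|.
have j0 d : 0 <= j d by exact: normr_ge0.
pose sa p : R := \sum_d j d * \1_(slab2 (S d)) p.
pose sb p : R := \sum_d j d * \1_(slab1 (S d)) p.
have sa0 p : 0 <= sa p by apply: sumr_ge0 => d _; rewrite mulr_ge0.
have sb0 p : 0 <= sb p by apply: sumr_ge0 => d _; rewrite mulr_ge0.
(* Besides the points in no cell, those whose lines parallel to the sides run through an exceptional
   point of [X] are discarded: jumps are not described there. *)
pose N := (Omega `\` \bigcup_i F i) `|`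
  [set p | exists2 x, x \in X & P p /\ (t1 p = t1 x \/ t2 p = t2 x)].
have abn0 : (al != 0) || (be != 0).
  rewrite -negb_and; apply: contra D0 => /andP[/eqP-> /eqP->].
  by rewrite !mul0r subr0.
have gdn0 : (ga != 0) || (de != 0).
  rewrite -negb_and; apply: contra D0 => /andP[/eqP-> /eqP->].
  by rewrite !mulr0 subr0.
have bP : bd P by exact: bd_sub PO.
have nN : null N.
  apply: negligibleU; first exact: jc_null jc.
  apply: null_seq => x _.
  have h1 : null [set p | P p /\ t1 p = t1 x].
    apply: (@line_null _ _ al be (t1 x)) => //; last by move=> p [].
    by apply: (bd_sub bP) => p [].
  have h2 : null [set p | P p /\ t2 p = t2 x].
    apply: (@line_null _ _ ga de (t2 x)) => //; last by move=> p [].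
    by apply: (bd_sub bP) => p [].
  by apply: negligibleS (negligibleU h1 h2) => p [Pp [h|h]]; [left|right].
have cell_of p : P p -> ~ N p -> exists i, F i p.
  move=> Pp Np; apply: contrapT => h; apply: Np; left; split; first exact: PO.
  by case=> i _ Fp; apply: h; exists i.
have osc p q i k : P p -> ~ N p -> P q -> ~ N q -> F i p -> F k q ->
    `|g i - g k| <= sa p + sb q.
  move=> Pp Np Pq Nq Fp Fq.
  (* The line of constant [t2] through [p] and the line of constant [t1] through [q]; they meet
     inside [P], so their union is connected. *)
  pose G := (P `&` [set z | t2 z = t2 p]) `|` (P `&` [set z | t1 z = t1 q]).
  have cG : connected G.
    apply: connectedU.
    - pose s := t1 q; pose t := t2 p.
      exists ((de * s - be * t) / (al * de - be * ga), (al * t - ga * s) / (al * de - be * ga)).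
      rewrite /setI /P /ostrip /t1 /t2 /=.
      have -> : al * ((de * s - be * t) / (al * de - be * ga)) + be * ((al * t - ga * s) / (al * de - be * ga)) = s.
        by field.
      have -> : ga * ((de * s - be * t) / (al * de - be * ga)) + de * ((al * t - ga * s) / (al * de - be * ga)) = t.
        by field.
      by case: Pp Pq => _ pt [qs _].
    - exact: connected_line.
    - rewrite /P ostripC; apply: connected_line.
      by rewrite -oppr_eq0 (_ : - _ = al * de - be * ga)//; ring.
  have := connected_osc g jc cG _ _ _ _ Fp Fq.
  move=> /(_ _ _ _ _) H; apply: (le_trans (H _ _ _ _)).
  - by move=> z [[/PO]|[/PO]].
  - move=> z [[Pz /= hz]|[Pz /= hz]]; apply/negP => zX.
      by apply: Np; right; exists z => //; split => //; right.
    by apply: Nq; right; exists z => //; split => //; left.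
  - by left.
  - by right.
  rewrite big_mkcond /sa /sb -big_split /=; apply: ler_sum => d _.
  case: asboolP => [[z [Gz Sz]]|_]; last by rewrite addr_ge0// mulr_ge0.
  case: Gz => -[Pz /= hz].
    have -> : \1_(slab2 (S d)) p = 1 :> R.
      by rewrite indicE mem_set//; split => //=; rewrite -hz; exact: segment_lin.
    by rewrite mulr1 lerDl mulr_ge0.
  have -> : \1_(slab1 (S d)) q = 1 :> R.
    by rewrite indicE mem_set//; split => //=; rewrite -hz; exact: segment_lin.
  by rewrite mulr1 lerDr mulr_ge0.
pose TV := total_jump e1 e2 S g.
have TVE : TV = \sum_d len (S d) * j d by [].
have TV0 : 0 <= TV by rewrite TVE sumr_ge0// => d _; rewrite mulr_ge0.
have Isa : \sum_d j d * area (slab2 (S d)) <= K0 * TV.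
  rewrite TVE mulr_sumr; apply: ler_sum => d _.
  by rewrite mulrA [K0 * _ * _]mulrC; apply: ler_wpM2l => //; exact: area_slab2.
have Isb : \sum_d j d * area (slab1 (S d)) <= K0 * TV.
  rewrite TVE mulr_sumr; apply: ler_sum => d _.
  by rewrite mulrA [K0 * _ * _]mulrC; apply: ler_wpM2l => //; exact: area_slab1.
have [q [Pq Nq]] := @exists_min_sum (D + D)%type
  (fun k => match k with inl d => j d | inr d => j d end)
  (fun k => match k with inl d => slab2 (S d) | inr d => slab1 (S d) end) P N
  ltac:(by case) ltac:(by case) fmP areaP nN.
rewrite !big_sumType /= -/(sa q) -/(sb q) => hm.
pose m := sa q + sb q.
have m0 : 0 <= m by exact: addr_ge0.
have {hm} hm : m * area P <= 2 * K0 * TV.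
  apply: (le_trans hm).
  rewrite (_ : 2 * K0 * TV = K0 * TV + K0 * TV); last by ring.
  exact: lerD Isa Isb.
have [i0 Fq] := cell_of _ Pq Nq.
exists (g i0).
(* Exchanging the roles of [p] and [q] bounds the square by [(sb p + m) * (sa p + m)]. The four
   families indexed on the right are the terms of the expanded product. *)
have := @area_sum_le R I ((D * D) + (D + (D + 'I_1)))%type
  (fun i => (g i - g i0) ^+ 2) (fun i => F i `&` P)
  (fun k => match k with inl dd => j dd.1 * j dd.2 | inr (inl d) => m * j d
     | inr (inr (inl d)) => m * j d | inr (inr (inr _)) => m ^+ 2 end)
  (fun k => match k with inl dd => slab1 (S dd.1) `&` slab2 (S dd.2)
     | inr (inl d) => slab1 (S d)
     | inr (inr (inl d)) => slab2 (S d) | inr (inr (inr _)) => P end) N.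
have h1 : forall i, 0 <= (g i - g i0) ^+ 2 by move=> i; exact: sqr_ge0.
have h3 i : fm (F i `&` P).
  apply: (fm_sub fmP); last exact: subIsetr.
  by apply: open_measurable2; apply: openI; [exact: jc_open jc _|exact: open_ostrip].
move=> /(_ h1 _ h3 _ nN _) H.
apply: (le_trans (H _ _ _)) => {H}.
- by case=> [dd|[d|[d|_]]]; rewrite ?mulr_ge0 ?sqr_ge0.
- case=> [dd|[d|[d|_]]]; [exact: fm_setI|exact: fm_slab1|exact: fm_slab2|exact: fmP].
- move=> p Np; rewrite !big_sumType /= big_ord1.
  have -> : \sum_(dd : D * D) j dd.1 * j dd.2 * \1_(slab1 (S dd.1) `&` slab2 (S dd.2)) p = sb p * sa p.
    rewrite /sa /sb big_distrlr pair_big /=; apply: eq_bigr => dd _.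
    by rewrite indicI /=; ring.
  have -> : \sum_d m * j d * \1_(slab1 (S d)) p = m * sb p.
    by rewrite /sb mulr_sumr; apply: eq_bigr => d _; rewrite mulrA.
  have -> : \sum_d m * j d * \1_(slab2 (S d)) p = m * sa p.
    by rewrite /sa mulr_sumr; apply: eq_bigr => d _; rewrite mulrA.
  have [Pp|Pp] := pselect (P p); last first.
    rewrite big1; first by rewrite !addr_ge0// mulr_ge0// sqr_ge0.
    by move=> i _; rewrite indicE memNset ?mulr0// => -[].
  have [i Fp] := cell_of _ Pp Np.
  rewrite (bigD1 i)//= big1 ?addr0; last first.
    move=> k ki; rewrite indicE memNset ?mulr0// => -[Fk _].
    by move/eqP: ki; apply; exact: jc_disj jc _ _ _ Fk Fp.
  rewrite indicE mem_set// mulr1 indicE mem_set// mulr1 !addrA.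
  apply: osc_product_bound => //.
    rewrite distrC; apply: (le_trans (osc _ _ _ _ Pq Nq Pp Np Fq Fp)).
    by rewrite [leRHS]addrC lerD2r lerDl; exact: sb0.
  apply: (le_trans (osc _ _ _ _ Pp Np Pq Nq Fp Fq)).
  by rewrite lerD2l lerDr; exact: sa0.
rewrite !big_sumType /= big_ord1.
have J1 : \sum_(dd : D * D) j dd.1 * j dd.2 * area (slab1 (S dd.1) `&` slab2 (S dd.2)) <= K0 * TV ^+ 2.
  rewrite expr2 TVE big_distrlr pair_big /= mulr_sumr; apply: ler_sum => dd _.
  apply: (@le_trans _ _ (j dd.1 * j dd.2 * (K0 * (len (S dd.1) * len (S dd.2))))).
    by apply: ler_wpM2l; [exact: mulr_ge0|exact: area_slab12].
  by rewrite le_eqVlt; apply/orP; left; apply/eqP; ring.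
have factor (h : D -> R) : \sum_d m * j d * h d = m * \sum_d j d * h d.
  by rewrite mulr_sumr; apply: eq_bigr => d _; rewrite mulrA.
move: Isa Isb => /(ler_wpM2l m0) Isa /(ler_wpM2l m0) Isb.
have mle : m <= 2 * K0 * TV / area P by rewrite ler_pdivlMr.
have KT : 0 <= K0 * TV by exact: mulr_ge0.
have J2 := ler_wpM2r KT mle.
have J3 := ler_wpM2l m0 hm.
pose Z := 2 * K0 * TV / area P * (K0 * TV).
have -> : (K0 + 8 * K0 ^+ 2 / area P) * TV ^+ 2 = K0 * TV ^+ 2 + (Z + (Z + (Z + Z))).
  by rewrite /Z; ring.
apply: lerD; first exact: J1.
apply: lerD; first by rewrite (factor (fun d => area (slab1 (S d)))); exact: le_trans Isb J2.
apply: lerD; first by rewrite (factor (fun d => area (slab2 (S d)))); exact: le_trans Isa J2.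
rewrite expr2 -mulrA; apply: (le_trans J3).
rewrite (_ : m * (2 * K0 * TV) = m * (K0 * TV) + m * (K0 * TV)); last by ring.
exact: lerD.
Qed.

End Parallelogram.

End JumpComplex.

(** * Triangles in barycentric coordinates *)

Section Triangle.
Variable R : realType.
Implicit Types (a b c p q : R * R).

Definition bary1 a b c p : R := crs (p - a) (c - a) / crs (b - a) (c - a).
Definition bary2 a b c p : R := crs (b - a) (p - a) / crs (b - a) (c - a).

Lemma pairE (p q : R * R) : p.1 = q.1 -> p.2 = q.2 -> p = q.
Proof. by case: p q => [? ?] [? ?] /= -> ->. Qed.

Lemma scaleE (x y : R) : x *: (y : R^o) = x * y. Proof. by []. Qed.

Lemma bary_dec a b c p : crs (b - a) (c - a) != 0 ->
  p = a + bary1 a b c p *: (b - a) + bary2 a b c p *: (c - a).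
Proof.
rewrite /bary1 /bary2 /crs /= => D0; apply: pairE => /=.
- rewrite -[X in _ + X + _]/(_ * _) -[X in _ + _ + X]/(_ * _); field; exact: D0.
- rewrite -[X in _ + X + _]/(_ * _) -[X in _ + _ + X]/(_ * _); field; exact: D0.
Qed.

Lemma bary1_comb a b c (s t : R) : crs (b - a) (c - a) != 0 ->
  bary1 a b c (a + s *: (b - a) + t *: (c - a)) = s.
Proof.
rewrite /bary1 /crs /= => D0.
rewrite -![s *: _]/(s * _) -![t *: _]/(t * _); field; exact: D0.
Qed.

Lemma bary2_comb a b c (s t : R) : crs (b - a) (c - a) != 0 ->
  bary2 a b c (a + s *: (b - a) + t *: (c - a)) = t.
Proof.
rewrite /bary2 /crs /= => D0.
rewrite -![s *: _]/(s * _) -![t *: _]/(t * _); field; exact: D0.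
Qed.

Lemma triangleP a b c p : crs (b - a) (c - a) != 0 ->
  triangle a b c p <->
  [/\ 0 <= bary1 a b c p, 0 <= bary2 a b c p & bary1 a b c p + bary2 a b c p <= 1].
Proof.
move=> D0; split; last by move=> h; exists (bary1 a b c p, bary2 a b c p) => //=; exact/esym/bary_dec.
by case=> -[s t] /= h <-; rewrite bary1_comb// bary2_comb.
Qed.

Lemma bary1_lin a b c p : bary1 a b c p =
  (c - a).2 / crs (b - a) (c - a) * p.1 + - (c - a).1 / crs (b - a) (c - a) * p.2
  + - crs a (c - a) / crs (b - a) (c - a).
Proof. by rewrite /bary1; set D := crs (b - a) _; rewrite /crs /=; ring. Qed.

Lemma bary2_lin a b c p : bary2 a b c p =
  - (b - a).2 / crs (b - a) (c - a) * p.1 + (b - a).1 / crs (b - a) (c - a) * p.2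
  + crs a (b - a) / crs (b - a) (c - a).
Proof. by rewrite /bary2; set D := crs (b - a) (c - a); rewrite /crs /=; ring. Qed.

Lemma open_bary a b c (x y z : R) :
  open [set p | x * bary1 a b c p + y * bary2 a b c p + z > 0].
Proof.
have -> : [set p | x * bary1 a b c p + y * bary2 a b c p + z > 0] =
 [set p | - (z + x * (- crs a (c - a) / crs (b - a) (c - a)) + y * (crs a (b - a) / crs (b - a) (c - a))) <
   (x * ((c - a).2 / crs (b - a) (c - a)) + y * (- (b - a).2 / crs (b - a) (c - a))) * p.1 +
   (x * (- (c - a).1 / crs (b - a) (c - a)) + y * ((b - a).1 / crs (b - a) (c - a))) * p.2].
  by apply/seteqP; split => p /=; rewrite bary1_lin bary2_lin => h; lra.
exact: open_lin_lt.
Qed.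

Lemma open_bary_pos a b c :
  open [set p | [/\ 0 < bary1 a b c p, 0 < bary2 a b c p & bary1 a b c p + bary2 a b c p < 1]].
Proof.
have -> : [set p | [/\ 0 < bary1 a b c p, 0 < bary2 a b c p & bary1 a b c p + bary2 a b c p < 1]]
 = [set p | 1 * bary1 a b c p + 0 * bary2 a b c p + 0 > 0] `&`
  ([set p | 0 * bary1 a b c p + 1 * bary2 a b c p + 0 > 0] `&`
   [set p | (-1) * bary1 a b c p + (-1) * bary2 a b c p + 1 > 0]).
  by apply/seteqP; split => p /=; [case=> ? ? ?; split; [lra|split; lra]|
     case=> ? [? ?]; split; lra].
by apply: openI; [|apply: openI]; exact: open_bary.
Qed.

(** Around an interior point small moves along the sides at [a] stay in the triangle, which makes
    each of the three weak inequalities strict. *)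
Lemma interior_triangleP a b c p : crs (b - a) (c - a) != 0 ->
  (triangle a b c)° p <->
  [/\ 0 < bary1 a b c p, 0 < bary2 a b c p & bary1 a b c p + bary2 a b c p < 1].
Proof.
move=> D0; split; last first.
  move=> h; rewrite /interior; apply: (filterS (P := [set p | [/\ 0 < bary1 a b c p, 0 < bary2 a b c p & bary1 a b c p + bary2 a b c p < 1]])).
    by move=> q [h1 h2 h3]; apply/triangleP => //; split; exact: ltW.
  by apply: open_nbhs_nbhs; split => //; exact: open_bary_pos.
move=> /ball2[e e0 eT].
have small (v : R * R) : exists2 d : R, 0 < d & forall x : R, `|x| <= d -> triangle a b c (p + x *: v).
  exists (e / 2 / (1 + `|v.1| + `|v.2|)).
    by rewrite !divr_gt0// -addrA ltr_pwDl// addr_ge0.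
  have n0 : 0 < 1 + `|v.1| + `|v.2| by rewrite -addrA ltr_pwDl// addr_ge0.
  move=> x; rewrite ler_pdivlMr// => xd.
  have x0 : 0 <= `|x| by [].
  have p1 : 0 <= `|x| * `|v.1| by rewrite mulr_ge0.
  have p2 : 0 <= `|x| * `|v.2| by rewrite mulr_ge0.
  by apply: eT => /=; rewrite addrC addKr normrM; lra.
have pt (x u v : R) : p + x *: (u *: (b - a) + v *: (c - a)) =
    a + (bary1 a b c p + x * u) *: (b - a) + (bary2 a b c p + x * v) *: (c - a).
  rewrite {1}(bary_dec p D0); move: (bary1 a b c p) (bary2 a b c p) => s t.
  by apply: pairE => /=; rewrite ?scaleE; ring.
have tri (x u v : R) : triangle a b c (p + x *: (u *: (b - a) + v *: (c - a))) ->
    [/\ 0 <= bary1 a b c p + x * u, 0 <= bary2 a b c p + x * v &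
       bary1 a b c p + x * u + (bary2 a b c p + x * v) <= 1].
  by move=> /(triangleP _ D0); rewrite pt bary1_comb// bary2_comb.
have [d1 d10 /(_ (- d1))] := small (1 *: (b - a) + 0 *: (c - a)).
rewrite normrN (gtr0_norm d10) lexx => /(_ isT)/tri[h1 _ _].
have [d2 d20 /(_ (- d2))] := small (0 *: (b - a) + 1 *: (c - a)).
rewrite normrN (gtr0_norm d20) lexx => /(_ isT)/tri[_ h2 _].
have [d3 d30 /(_ d3)] := small (1 *: (b - a) + 0 *: (c - a)).
rewrite (gtr0_norm d30) lexx => /(_ isT)/tri[_ _ h3].
by split; lra.
Qed.

(** Obtained as the image of a compact simplex, so that degenerate triangles are covered as well:
    one half of a boundary diamond is of this kind. *)
Lemma closed_triangle a b c : closed (triangle a b c).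
Proof.
apply: compact_closed; first exact: norm_hausdorff.
pose A := [set st : R * R | [/\ 0 <= st.1, 0 <= st.2 & st.1 + st.2 <= 1]].
have cA : compact A.
  apply: (@subclosed_compact _ A ((`[0, 1]%classic : set R) `*` (`[0, 1]%classic : set R))).
  - have -> : A = [set p | 0 <= 1 * p.1 + 0 * p.2] `&` ([set p | 0 <= 0 * p.1 + 1 * p.2] `&`
       [set p | -1 <= (-1) * p.1 + (-1) * p.2]).
      by apply/seteqP; split => p /=; [case=> ? ? ?; split; [lra|split; lra]|
        case=> ? [? ?]; split; lra].
    by apply: closedI; [|apply: closedI]; exact: closed_lin_le.
  - by apply: compact_setX; exact: segment_compact.
  - by move=> p [h1 h2 h3]; split => /=; rewrite in_itv /=; apply/andP; split; lra.
rewrite /triangle -/A; apply: continuous_compact => //.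
apply: continuous_subspaceT => p.
apply: cvgD; [apply: cvgD; first exact: cvg_cst|].
  by apply: cvgZr_tmp; exact: cvg_fst.
by apply: cvgZr_tmp; exact: cvg_snd.
Qed.

(** A point of the triangle becomes interior when moved slightly toward the centroid, whose
    coordinates are all [3^-1]. *)
Lemma triangle_closure a b c : crs (b - a) (c - a) != 0 ->
  closure (triangle a b c)° = triangle a b c.
Proof.
move=> D0; apply/seteqP; split.
  move=> p h; rewrite (iffLR (closure_id _) (@closed_triangle a b c)).
  by apply: closureS h; exact: interior_subset.
move=> p /(triangleP _ D0)[h1 h2 h3] B /ball2[e e0 eB].
pose w : R * R := (3^-1 - bary1 a b c p) *: (b - a) + (3^-1 - bary2 a b c p) *: (c - a).
have n0 : 0 < 1 + `|w.1| + `|w.2| by rewrite -addrA ltr_pwDl// addr_ge0.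
pose x := Num.min 1 (e / 2 / (1 + `|w.1| + `|w.2|)).
have x0 : 0 < x by rewrite lt_min ltr01 /= !divr_gt0.
have x1 : x <= 1 by rewrite ge_min lexx.
have xe : x * (1 + `|w.1| + `|w.2|) <= e / 2 by rewrite -ler_pdivlMr// ge_min lexx orbT.
have p1 : 0 <= x * `|w.1| by rewrite mulr_ge0// ltW.
have p2 : 0 <= x * `|w.2| by rewrite mulr_ge0// ltW.
exists (p + x *: w); split; last first.
  by apply: eB => /=; rewrite addrC addKr normrM (gtr0_norm x0); lra.
have -> : p + x *: w = a + (bary1 a b c p + x * (3^-1 - bary1 a b c p)) *: (b - a)
   + (bary2 a b c p + x * (3^-1 - bary2 a b c p)) *: (c - a).
  rewrite {1}(bary_dec p D0) /w; move: (bary1 a b c p) (bary2 a b c p) => s t.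
  by apply: pairE => /=; rewrite ?scaleE; ring.
apply/interior_triangleP => //; rewrite bary1_comb// bary2_comb//.
by split; nra.
Qed.

Lemma triangle_rot a b c : triangle a b c = triangle b c a.
Proof.
by apply/seteqP; split => p [[s t] /= [h1 h2 h3] <-];
  [exists (t, 1 - s - t)|exists (1 - s - t, s)]; rewrite /=; (try by split; lra);
  apply: pairE => /=; rewrite ?scaleE; ring.
Qed.

Lemma triangle_swap a b c : triangle a b c = triangle a c b.
Proof.
by apply/seteqP; split => p [[s t] /= [h1 h2 h3] <-];
  exists (t, s); rewrite /=; (try by split; lra);
  apply: pairE => /=; rewrite ?scaleE; ring.
Qed.

Lemma degenerate_line a b c : crs (b - a) (c - a) = 0 ->
  exists x y : R, (x != 0) || (y != 0) /\
    forall p, triangle a b c p -> x * p.1 + y * p.2 = x * a.1 + y * a.2.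
Proof.
move=> D0.
suff [v v0 [vb vc]] : exists2 v : R * R, (v.1 != 0) || (v.2 != 0) &
    v.1 * (b - a).1 + v.2 * (b - a).2 = 0 /\ v.1 * (c - a).1 + v.2 * (c - a).2 = 0.
  exists v.1, v.2; split => // p [[s t] _ <-] /=.
  rewrite !scaleE; move: vb vc => /= vb vc.
  have -> : v.1 * (a.1 + s * (b.1 - a.1) + t * (c.1 - a.1)) + v.2 * (a.2 + s * (b.2 - a.2) + t * (c.2 - a.2))
    = v.1 * a.1 + v.2 * a.2 + s * (v.1 * (b.1 - a.1) + v.2 * (b.2 - a.2)) + t * (v.1 * (c.1 - a.1) + v.2 * (c.2 - a.2)) by ring.
  by rewrite vb vc !mulr0 !addr0.
move: D0; rewrite /crs => D0.
have [nb|] := boolP (((b - a).1 != 0) || ((b - a).2 != 0)).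
  exists (- (b - a).2, (b - a).1); first by rewrite /= oppr_eq0 orbC.
  by split => /=; move: D0 => /=; lra.
rewrite negb_or !negbK => /andP[/eqP b1 /eqP b2].
have [nc|] := boolP (((c - a).1 != 0) || ((c - a).2 != 0)).
  exists (- (c - a).2, (c - a).1); first by rewrite /= oppr_eq0 orbC.
  by rewrite b1 b2; split => /=; lra.
rewrite negb_or !negbK => /andP[/eqP c1 /eqP c2].
by exists (1, 0); rewrite ?oner_neq0// b1 b2 c1 c2 /=; split; lra.
Qed.

Lemma degenerate_interior a b c : crs (b - a) (c - a) = 0 -> (triangle a b c)° = set0.
Proof.
move=> /degenerate_line[x [y [xy h]]]; rewrite -subset0 => p /ball2[e e0 eT].
have hp : x * p.1 + y * p.2 = x * a.1 + y * a.2 by apply/h/eT; rewrite subrr normr0.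
have e2 : `|e / 2| < e by rewrite gtr0_norm; lra.
case/orP: xy => /eqP; apply.
- have /h /= := eT (p.1 + e / 2, p.2) ltac:(by rewrite /= addrC addKr) ltac:(by rewrite /= subrr normr0).
  rewrite -hp => E; have /eqP : x * (e / 2) = 0 by lra.
  by rewrite mulf_eq0 => /orP[/eqP//|/eqP]; lra.
- have /h /= := eT (p.1, p.2 + e / 2) ltac:(by rewrite /= subrr normr0) ltac:(by rewrite /= addrC addKr).
  rewrite -hp => E; have /eqP : y * (e / 2) = 0 by lra.
  by rewrite mulf_eq0 => /orP[/eqP//|/eqP]; lra.
Qed.

Lemma nondegenerate_triangle a b c : (triangle a b c)° !=set0 -> crs (b - a) (c - a) != 0.
Proof. by move=> [p pT]; apply/eqP => /degenerate_interior E; rewrite E in pT. Qed.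

Lemma bd_triangle a b c : bd (triangle a b c).
Proof.
exists (`|a.1| + `|(b - a).1| + `|(c - a).1| + (`|a.2| + `|(b - a).2| + `|(c - a).2|)).
have n v : 0 <= `|v : R| by [].
have H (x y z s t : R) : 0 <= s -> 0 <= t -> s + t <= 1 ->
    `|x + s * y + t * z| <= `|x| + `|y| + `|z|.
  move=> s0 t0 st; apply: (le_trans (ler_normD _ _)); apply: lerD.
    apply: (le_trans (ler_normD _ _)); rewrite lerD2l normrM (ger0_norm s0).
    by rewrite ler_piMl//; lra.
  by rewrite normrM (ger0_norm t0) ler_piMl//; lra.
move=> p [[s t] /= [h1 h2 h3] <-] /=.
split; rewrite !scaleE; apply: (le_trans (H _ _ _ _ _ h1 h2 h3)).
  by rewrite lerDl !addr_ge0.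
by rewrite lerDr !addr_ge0.
Qed.

Lemma fm_triangle a b c : fm (triangle a b c).
Proof.
apply: bd_fm; first exact: bd_triangle.
by apply: closed_measurable2; exact: closed_triangle.
Qed.

(** The triangle lies in the parallelogram where both coordinates are in $[0,1]$; the factor 2 is
    that of [area_strip]. *)
Lemma area_triangle_le a b c : area (triangle a b c) <= 2 * `|crs (b - a) (c - a)|.
Proof.
have [D0|D0] := eqVneq (crs (b - a) (c - a)) 0.
  rewrite D0 normr0 mulr0.
  have [x [y [xy h]]] := degenerate_line D0.
  have /negligibleP : null (triangle a b c) by exact: line_null (@bd_triangle a b c) xy h.
  by case: (fm_triangle a b c) => mT _ /(_ mT); rewrite /area => ->.
set D := crs (b - a) (c - a) in D0 *.
pose al := (c - a).2 / D; pose be := - (c - a).1 / D; pose k := - crs a (c - a) / D.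
pose ga := - (b - a).2 / D; pose de := (b - a).1 / D; pose l := crs a (b - a) / D.
have dE : al * de - be * ga = D^-1.
  rewrite /al /be /ga /de.
  have -> : (c - a).2 / D * ((b - a).1 / D) - - (c - a).1 / D * (- (b - a).2 / D) =
    crs (b - a) (c - a) / (D * D) by rewrite invfM /crs; ring.
  by rewrite -/D; field.
have d0 : al * de - be * ga != 0 by rewrite dE invr_eq0.
have l01 z : - z <= 1 - z :> R by lra.
have /area_le := fm_strip d0 (l01 k) (l01 l).
move=> /(_ (triangle a b c)) H.
apply: (le_trans (H _ _)).
- by case: (fm_triangle a b c).
- move=> p /(triangleP _ D0)[]; rewrite bary1_lin bary2_lin -/D -/al -/be -/k -/ga -/de -/l => h1 h2 h3.
  by split; apply/andP; split; lra.
apply: (le_trans (area_strip d0 (l01 k) (l01 l))).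
have e z : 1 - z - - z = 1 :> R by lra.
by rewrite !e dE normfV invrK mulr1 mulr1.
Qed.

Lemma fm_interior_triangle a b c : fm (triangle a b c)°.
Proof.
apply: (fm_sub (fm_triangle a b c)); last exact: interior_subset.
by apply: open_measurable2; exact: open_interior.
Qed.

(** The parallelogram centered at coordinates $(1/4,1/4)$ with half-sides $1/4$ is inscribed;
    scaling both vectors by $1/4$ gives the 16. *)
Lemma area_triangle_ge a b c : `|crs (b - a) (c - a)| <= 16 * area (triangle a b c)°.
Proof.
have [->|D0] := eqVneq (crs (b - a) (c - a)) 0.
  by rewrite normr0 mulr_ge0// area_ge0.
have := @area_ge_pgram R (triangle a b c)° (a + 4^-1 *: (b - a) + 4^-1 *: (c - a))
  (4^-1 *: (b - a)) (4^-1 *: (c - a)) (fm_interior_triangle a b c).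
have -> : crs (4^-1 *: (b - a)) (4^-1 *: (c - a)) = 16^-1 * crs (b - a) (c - a).
  by rewrite /crs /= !scaleE; field.
rewrite normrM gtr0_norm ?invr_gt0// => H.
suff : 16^-1 * `|crs (b - a) (c - a)| <= area (triangle a b c)° by lra.
apply: H => s t; rewrite !ltr_norml => /andP[s1 s2] /andP[t1 t2].
have -> : a + 4^-1 *: (b - a) + 4^-1 *: (c - a) + s *: (4^-1 *: (b - a)) + t *: (4^-1 *: (c - a))
  = a + ((1 + s) / 4) *: (b - a) + ((1 + t) / 4) *: (c - a).
  by apply: pairE => /=; rewrite ?scaleE; field.
by apply/interior_triangleP => //; rewrite bary1_comb// bary2_comb//; split; lra.
Qed.

End Triangle.

(** * Gluing, from parallelograms to polygonal domains *)

Section Domain.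
Variable R : realType.
Variable Omega : set (R * R).
Hypotheses (bO : bd Omega) (oO : open Omega).

Lemma fm_open (A : set (R * R)) : open A -> A `<=` Omega -> fm A.
Proof.
by move=> oA AO; apply: bd_fm; [exact: bd_sub AO|exact: open_measurable2].
Qed.

Lemma jump_complex_area (I D : finType) F e1 e2 S X (A : set (R * R)) :
  @jump_complex R Omega I D F e1 e2 S X -> open A -> A `<=` Omega ->
  \sum_i area (F i `&` A) = area A.
Proof.
move=> jc oA AO.
have fA : fm A by exact: fm_open.
have fF i : fm (F i `&` A).
  apply: (fm_sub fA); last exact: subIsetr.
  by apply: open_measurable2; apply: openI => //; exact: jc_open jc _.
have E (p : R * R) : ~ (Omega `\` \bigcup_i F i) p ->
    \sum_i 1 * \1_(F i `&` A) p = \sum_(k < 1) 1 * \1_A p :> R.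
  move=> Np; rewrite big_ord1; have [Ap|Ap] := pselect (A p); last first.
    rewrite indicE memNset// mulr0 big1// => i _.
    by rewrite indicE memNset ?mulr0// => -[].
  have [i Fp] : exists i, F i p.
    apply: contrapT => h; apply: Np; split; first exact: AO.
    by case=> i _ Fp; apply: h; exists i.
  rewrite (bigD1 i)//= big1 ?addr0; last first.
    move=> k ki; rewrite indicE memNset ?mulr0// => -[Fk _].
    by move/eqP: ki; apply; exact: jc_disj jc _ _ _ Fk Fp.
  by rewrite indicE mem_set// indicE mem_set.
have mul1 (J : finType) (G : J -> set (R * R)) : \sum_i area (G i) = \sum_i 1 * area (G i).
  by apply: eq_bigr => i _; rewrite mul1r.
apply/eqP; rewrite eq_le; apply/andP; split.
  have := @area_sum_le R I 'I_1 (fun=> 1) (fun i => F i `&` A) (fun=> 1) (fun=> A)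
    _ (fun=> ler01) (fun=> ler01) fF (fun=> fA) (jc_null jc).
  by rewrite -!mul1 big_ord1; apply => p /E ->.
have := @area_sum_le R 'I_1 I (fun=> 1) (fun=> A) (fun=> 1) (fun i => F i `&` A)
    _ (fun=> ler01) (fun=> ler01) (fun=> fA) fF (jc_null jc).
by rewrite -!mul1 big_ord1; apply => p /E ->.
Qed.

(** The overlap is open and nonempty, hence of positive area. There both constants approximate [g],
    which bounds [tA - tB] and allows [tA] to serve on [B] too. *)
Lemma good_setU (A B : set (R * R)) :
  good Omega A -> good Omega B -> A `&` B !=set0 -> good Omega (A `|` B).
Proof.
move=> [oA AO [CA CA0 hA]] [oB BO [CB CB0 hB]] AB0.
have oAB : open (A `&` B) by exact: openI.
have ABO : A `&` B `<=` Omega by move=> p [/AO].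
have aAB : 0 < area (A `&` B) by apply: open_area_gt0 => //; exact: fm_open.
split; [exact: openU|by move=> p [/AO|/BO]|].
(* [CA] is spent on [A]. On [B], replacing [tB] by [tA] doubles [CB] and adds twice
   [(tA - tB) ^+ 2 * area B], where [(tA - tB) ^+ 2] is at most
   [2 * (CA + CB) * TV2 / area (A]&[B)]. *)
exists (CA + 2 * CB + 4 * (CA + CB) * area B / area (A `&` B)).
  apply: addr_ge0; first by apply: addr_ge0 => //; exact: mulr_ge0.
  apply: divr_ge0; last exact: area_ge0.
  apply: mulr_ge0; last exact: area_ge0.
  by apply: mulr_ge0 => //; exact: addr_ge0.
move=> I D F e1 e2 S X jc g.
have [tA {}hA] := hA _ _ _ _ _ _ _ jc g.
have [tB {}hB] := hB _ _ _ _ _ _ _ jc g.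
set TV2 := total_jump e1 e2 S g ^+ 2 in hA hB *.
have TV0 : 0 <= TV2 by exact: sqr_ge0.
have fF (G : set (R * R)) i : open G -> G `<=` Omega -> fm (F i `&` G).
  move=> oG GO; apply: fm_open; last by move=> p [_ /GO].
  by apply: openI => //; exact: jc_open jc _.
have sq (x y z : R) : (x - y) ^+ 2 <= 2 * (x - z) ^+ 2 + 2 * (y - z) ^+ 2.
  by rewrite -subr_ge0 (_ : _ - _ = (x + y - 2 * z) ^+ 2) ?sqr_ge0//; ring.
have ar1 (x y u v w : R) : x <= u * w -> y <= v * w -> 2 * (x + y) <= 2 * (u + v) * w.
  by move=> *; lra.
have ar2 (k x y a a1 a2 : R) : k * a <= (2 * x + 2 * y) * a -> x * a <= x * a1 ->
    y * a <= y * a2 -> k * a <= 2 * (x * a1 + y * a2).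
  by move=> *; lra.
have ar3 (x1 x2 x3 x4 u v z w : R) : x1 <= u * w -> x2 <= 2 * x3 + 2 * x4 ->
    x3 <= v * w -> x4 <= z -> x1 + x2 <= u * w + 2 * (v * w) + 2 * z.
  by move=> *; lra.
clearbody TV2.
have s1 : \sum_i (g i - tA) ^+ 2 * area (F i `&` (A `|` B)) <=
    \sum_i (g i - tA) ^+ 2 * area (F i `&` A) + \sum_i (g i - tA) ^+ 2 * area (F i `&` B).
  rewrite -big_split /=; apply: ler_sum => i _; rewrite -mulrDr.
  apply: ler_wpM2l; first exact: sqr_ge0.
  by rewrite setIUr; apply: area_setU_le; exact: fF.
have s2 : \sum_i (g i - tA) ^+ 2 * area (F i `&` B) <=
    2 * \sum_i (g i - tB) ^+ 2 * area (F i `&` B) + 2 * (tA - tB) ^+ 2 * area B.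
  rewrite -(jump_complex_area jc oB BO) !mulr_sumr -big_split /=; apply: ler_sum => i _.
  by have := ler_wpM2r (area_ge0 (F i `&` B)) (sq (g i) tA tB); move: (area _) (g i) => ? ?; lra.
have s3 : (tA - tB) ^+ 2 * area (A `&` B) <= 2 * (CA + CB) * TV2.
  rewrite -(jump_complex_area jc oAB ABO) mulr_sumr.
  apply: (@le_trans _ _ (2 * (\sum_i (g i - tA) ^+ 2 * area (F i `&` A)
                   + \sum_i (g i - tB) ^+ 2 * area (F i `&` B)))); last exact: ar1.
  rewrite -big_split /= mulr_sumr; apply: ler_sum => i _.
  have h1 : area (F i `&` (A `&` B)) <= area (F i `&` A).
    apply: area_le; [exact: fF| |by move=> p [? []]].
    by case: (fF _ i oAB ABO).
  have h2 : area (F i `&` (A `&` B)) <= area (F i `&` B).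
    apply: area_le; [exact: fF| |by move=> p [? []]].
    by case: (fF _ i oAB ABO).
  have := ler_wpM2r (area_ge0 (F i `&` (A `&` B))) (sq tA tB (g i)).
  rewrite -[(tA - g i) ^+ 2]sqrrN -[(tB - g i) ^+ 2]sqrrN !opprB => h0.
  by apply: (ar2 _ _ _ _ _ _ h0); apply: ler_wpM2l => //; exact: sqr_ge0.
exists tA; apply: (le_trans s1).
have s4 : (tA - tB) ^+ 2 * area B <= 2 * (CA + CB) * TV2 * area B / area (A `&` B).
  rewrite ler_pdivlMr// mulrAC; apply: ler_wpM2r => //; exact: area_ge0.
have -> : (CA + 2 * CB + 4 * (CA + CB) * area B / area (A `&` B)) * TV2 =
  CA * TV2 + 2 * (CB * TV2) + 2 * (2 * (CA + CB) * TV2 * area B / area (A `&` B)) by ring.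
rewrite -mulrA in s2.
exact: ar3 hA s2 hB s4.
Qed.

Lemma good_square (x : R * R) : Omega x -> exists2 A, good Omega A & A x.
Proof.
move=> Ox; have /ball2[e e0 eO] : nbhs x Omega by exact: open_nbhs_nbhs.
exists (ostrip 1 0 0 1 (x.1 - e) (x.1 + e) (x.2 - e) (x.2 + e)).
  apply: good_ostrip => //; rewrite ?mulr1 ?mul0r ?subr0 ?oner_neq0//; try lra.
  move=> p [/=]; rewrite !mul1r !mul0r addr0 add0r => h1 h2.
  by apply: eO; rewrite ltr_norml; lra.
by split; rewrite !mul1r !mul0r ?addr0 ?add0r; apply/andP; split; lra.
Qed.

(** The union of the good sets through [x] is open, and closed in [Omega]: near a limit point a
    small good square overlaps one of them and can be glued to it. *)
Lemma good_link (x y : R * R) : connected Omega -> Omega x -> Omega y ->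
  exists A, [/\ good Omega A, A x & A y].
Proof.
move=> cO Ox Oy.
pose U := \bigcup_(A in [set A | good Omega A /\ A x]) A.
have oU : open U by apply: bigcup_open => A [[]].
have OU : Omega `&` U = Omega.
  apply: cO.
  - have [A gA Ax] := good_square Ox; exists x; split => //; by exists A.
  - by exists U.
  exists (closure U); first exact: closed_closure.
  apply/seteqP; split => z [Oz Uz]; split => //; first exact: subset_closure.
  have [B gB Bz] := good_square Oz.
  have oB : open B by case: gB.
  have [w [[A [gA Ax] Aw] Bw]] := Uz B (open_nbhs_nbhs (conj oB Bz)).
  exists (A `|` B); last by right.
  by split; [apply: (good_setU gA gB); exists w|left].
have [_ [A [gA Ax] Ay]] : (Omega `&` U) y by rewrite OU.
by exists A.
Qed.

Lemma good_affine (al be k ga de l : R) : al * de - be * ga != 0 ->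
  [set p : R * R | 0 < al * p.1 + be * p.2 + k < 2^-1 /\ 0 < ga * p.1 + de * p.2 + l < 2^-1] `<=` Omega ->
  good Omega [set p | 0 < al * p.1 + be * p.2 + k < 2^-1 /\ 0 < ga * p.1 + de * p.2 + l < 2^-1].
Proof.
move=> D0.
have -> : [set p : R * R | 0 < al * p.1 + be * p.2 + k < 2^-1 /\ 0 < ga * p.1 + de * p.2 + l < 2^-1]
  = ostrip al be ga de (- k) (2^-1 - k) (- l) (2^-1 - l).
  by apply/seteqP; split => p [/andP[h1 h2] /andP[h3 h4]]; split; apply/andP; split; lra.
by move=> PO; apply: good_ostrip => //; lra.
Qed.

(** The parallelogram at each corner is where the coordinates of the two other vertices lie between
    0 and $1/2$. All three contain the centroid, and they miss only points of six lines, since at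
    most one coordinate can exceed $1/2$. *)
Lemma good_triangle (a b c : R * R) : crs (b - a) (c - a) != 0 ->
  (triangle a b c)° `<=` Omega ->
  exists A, [/\ good Omega A, A !=set0 & null (triangle a b c `\` A)].
Proof.
move=> D0 TO.
pose L1 := bary1 a b c; pose L2 := bary2 a b c.
set D := crs (b - a) (c - a) in D0.
pose al := (c - a).2 / D; pose be := - (c - a).1 / D; pose k := - crs a (c - a) / D.
pose ga := - (b - a).2 / D; pose de := (b - a).1 / D; pose l := crs a (b - a) / D.
have L1E p : L1 p = al * p.1 + be * p.2 + k by rewrite /L1 bary1_lin.
have L2E p : L2 p = ga * p.1 + de * p.2 + l by rewrite /L2 bary2_lin.
have dE : al * de - be * ga = D^-1.
  have -> : al * de - be * ga = crs (b - a) (c - a) / (D * D).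
    by rewrite /al /be /ga /de invfM /crs; ring.
  by rewrite -/D; field.
have d0 : al * de - be * ga != 0 by rewrite dE invr_eq0.
pose Pa := [set p | 0 < L1 p < 2^-1 /\ 0 < L2 p < 2^-1].
pose Pb := [set p | 0 < 1 - L1 p - L2 p < 2^-1 /\ 0 < L2 p < 2^-1].
pose Pc := [set p | 0 < L1 p < 2^-1 /\ 0 < 1 - L1 p - L2 p < 2^-1].
have L3E p : 1 - L1 p - L2 p = (- al - ga) * p.1 + (- be - de) * p.2 + (1 - k - l).
  by rewrite L1E L2E; ring.
have sub (P : set (R * R)) : (forall p, P p -> [/\ 0 < L1 p, 0 < L2 p & L1 p + L2 p < 1]) -> P `<=` Omega.
  by move=> h p /h hp; apply: TO; apply/interior_triangleP.
have aff (P : set (R * R)) x y z x' y' z' : x * y' - y * x' != 0 ->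
    P = [set p | 0 < x * p.1 + y * p.2 + z < 2^-1 /\ 0 < x' * p.1 + y' * p.2 + z' < 2^-1] ->
    P `<=` Omega -> good Omega P.
  by move=> n0 ->; exact: good_affine.
have ga_ : good Omega Pa.
  apply: (aff _ al be k ga de l) => //.
    by apply/seteqP; split => p; rewrite /Pa /= L1E L2E.
  by apply: sub => p [/andP[? ?] /andP[? ?]]; split; lra.
have gb_ : good Omega Pb.
  apply: (aff _ (- al - ga) (- be - de) (1 - k - l) ga de l).
  - by rewrite (_ : _ - _ = - (al * de - be * ga)) ?oppr_eq0//; ring.
  - by apply/seteqP; split => p; rewrite /Pb /= L3E L2E.
  by apply: sub => p [/andP[? ?] /andP[? ?]]; split; lra.
have gc_ : good Omega Pc.
  apply: (aff _ al be k (- al - ga) (- be - de) (1 - k - l)).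
  - by rewrite (_ : _ - _ = - (al * de - be * ga)) ?oppr_eq0//; ring.
  - by apply/seteqP; split => p; rewrite /Pc /= L3E L1E.
  by apply: sub => p [/andP[? ?] /andP[? ?]]; split; lra.
pose o := a + 3^-1 *: (b - a) + 3^-1 *: (c - a).
have [oL1 oL2] : L1 o = 3^-1 /\ L2 o = 3^-1 by rewrite /L1 /L2 bary1_comb// bary2_comb.
have oa : Pa o by rewrite /Pa /= oL1 oL2; split; apply/andP; split; lra.
have ob : Pb o by rewrite /Pb /= oL1 oL2; split; apply/andP; split; lra.
have oc : Pc o by rewrite /Pc /= oL1 oL2; split; apply/andP; split; lra.
exists (Pa `|` Pb `|` Pc); split.
- apply: (good_setU (good_setU ga_ gb_ _) gc_); first by exists o.
  by exists o; split => //; left.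
- by exists o; left; left.
have nl x y z u : (x != 0) || (y != 0) -> null (triangle a b c `&` [set p | x * p.1 + y * p.2 + z = u]).
  move=> xy; apply: (@line_null _ _ x y (u - z)) => //.
    by apply: (bd_sub (@bd_triangle _ a b c)) => p [].
  by move=> p [_ /= <-]; ring.
have ab0 : (al != 0) || (be != 0).
  rewrite -negb_and; apply: contra d0 => /andP[/eqP-> /eqP->].
  by rewrite !mul0r subr0.
have gd0 : (ga != 0) || (de != 0).
  rewrite -negb_and; apply: contra d0 => /andP[/eqP-> /eqP->].
  by rewrite !mulr0 subr0.
have e0 : (- al - ga != 0) || (- be - de != 0).
  rewrite -negb_and; apply: contra d0 => /andP[/eqP h1 /eqP h2].
  have -> : ga = - al by lra.
  have -> : de = - be by lra.
  by apply/eqP; ring.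
(* The six lines on which a barycentric coordinate equals 0 or $1/2$. *)
have := negligibleU (nl _ _ k 0 ab0) (nl _ _ k 2^-1 ab0).
move=> /negligibleU/(_ (negligibleU (nl _ _ l 0 gd0) (nl _ _ l 2^-1 gd0))).
move=> /negligibleU/(_ (negligibleU (nl _ _ (1 - k - l) 0 e0) (nl _ _ (1 - k - l) 2^-1 e0))).
apply: negligibleS => p [Tp NP].
move: (Tp) => /triangleP-/(_ D0)[]; rewrite -/L1 -/L2 => h1 h2 h3.
apply: contrapT => H.
have n1 : L1 p != 0 by apply/eqP => e; apply: H; left; left; left; split => //=; rewrite -L1E.
have n2 : L1 p != 2^-1 by apply/eqP => e; apply: H; left; left; right; split => //=; rewrite -L1E.
have n3 : L2 p != 0 by apply/eqP => e; apply: H; left; right; left; split => //=; rewrite -L2E.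
have n4 : L2 p != 2^-1 by apply/eqP => e; apply: H; left; right; right; split => //=; rewrite -L2E.
have n5 : 1 - L1 p - L2 p != 0 by apply/eqP => e; apply: H; right; left; split => //=; rewrite -L3E.
have n6 : 1 - L1 p - L2 p != 2^-1 by apply/eqP => e; apply: H; right; right; split => //=; rewrite -L3E.
have q1 : 0 < L1 p by rewrite lt_neqAle eq_sym n1.
have q2 : 0 < L2 p by rewrite lt_neqAle eq_sym n3.
have q3 : 0 < 1 - L1 p - L2 p by rewrite lt_neqAle eq_sym n5 /=; lra.
apply: NP; case: (ltrgtP (L1 p) 2^-1) => [r1|r1|r1]; last by rewrite r1 eqxx in n2.
  case: (ltrgtP (L2 p) 2^-1) => [r2|r2|r2]; last by rewrite r2 eqxx in n4.
    by left; left; split; apply/andP; split.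
  by right; split; apply/andP; split => //; lra.
by left; right; split; apply/andP; split => //; lra.
Qed.

End Domain.

(** One gluing for each triangle of the polygon, hence finitely many and independent of any mesh.
    Triangles need not overlap, so each is tied to the base point [x0] by [good_link]; degenerate
    ones are null and add nothing. *)
Lemma bv_inequality (R : realType) (Omega : set (R * R)) :
  polygonal_domain Omega -> Omega !=set0 ->
  exists2 C : R, 0 <= C &
   forall (I D : finType) F e1 e2 S X, @jump_complex R Omega I D F e1 e2 S X ->
   forall g : I -> R, exists t,
     \sum_i (g i - t) ^+ 2 * area (F i) <= C * total_jump e1 e2 S g ^+ 2.
Proof.
move=> [[ts Ots] cO oO /bounded_bd bO] [x0 Ox0].
have cover (s : seq ((R * R) * (R * R) * (R * R))) : {subset s <= ts} ->
    exists A, [/\ good Omega A, A x0 &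
      null (\bigcup_(t in [set` s]) triangle t.1.1 t.1.2 t.2 `\` A)].
  elim: s => [|[[a b] c] s IH] sub.
    have [A gA Ax] := good_square bO oO Ox0; exists A; split => //.
    by apply: (@negligibleS _ _ _ _ set0) => [p [[]]//|]; exact: negligible_set0.
  have [|A [gA Ax nA]] := IH; first by move=> t ts'; apply: sub; rewrite inE ts' orbT.
  have [D0|D0] := eqVneq (crs (b - a) (c - a)) 0.
    exists A; split => //.
    have [x [y [xy h]]] := degenerate_line D0.
    have nT := line_null (@bd_triangle _ a b c) xy h.
    apply: negligibleS (negligibleU nT nA) => p [[t /=]].
    by rewrite inE => /orP[/eqP->|ts'] Tp Ap; [left|right; split => //; exists t].
  have TO : (triangle a b c)° `<=` Omega.
    rewrite Ots; apply: interiorS => p Tp; exists (a, b, c) => //=.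
    by apply: sub; rewrite inE eqxx.
  have [B [gB [y By] nB]] := good_triangle bO D0 TO.
  have Oy : Omega y by case: gB => _ + _; apply.
  have [L [gL Lx Ly]] := good_link bO oO cO Ox0 Oy.
  exists (A `|` L `|` B); split.
  - apply: (good_setU bO (good_setU bO gA gL _) gB); first by exists x0.
    by exists y; split => //; right.
  - by left; left.
  apply: negligibleS (negligibleU nA nB) => p [[t /=]].
  rewrite inE => /orP[/eqP->|ts'] Tp Ap; [right; split => //|left; split; first by exists t].
    by move=> Bp; apply: Ap; right.
  by move=> ?; apply: Ap; left; left.
have [A [[oA AO [C C0 hC]] _ nA]] := cover ts (fun _ => id).
exists C => // I D F e1 e2 S X jc g.
have [t ht] := hC _ _ _ _ _ _ _ jc g; exists t; apply: le_trans ht.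
have fF i : fm (F i) by apply: fm_open bO _ _ _; [exact: jc_open jc _|exact: jc_sub jc _].
apply: (@area_sum_le _ _ _ _ _ _ _ (Omega `\` A)).
- by move=> i; exact: sqr_ge0.
- by move=> i; exact: sqr_ge0.
- by [].
- move=> i; apply: (fm_sub (fF i)); last exact: subIsetl.
  by apply: open_measurable2; apply: openI => //; exact: jc_open jc _.
- apply: negligibleS nA => p [Op Ap]; split => //.
  by rewrite Ots in Op; exact: interior_subset Op.
move=> p Np; apply: ler_sum => i _; apply: ler_wpM2l; first exact: sqr_ge0.
rewrite !indicE; have [Fp|Fp] := pselect (F i p); last by rewrite memNset//.
rewrite !mem_set//; split => //; apply: contrapT => Ap; apply: Np; split => //.
exact: jc_sub jc _ _ Fp.
Qed.

(** * Topology of the mesh *)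

Section Quad.
Variable R : realType.
Implicit Types (a b c x y z p : R * R).

Lemma base_line x b c z : crs (x - b) (c - b) != 0 -> crs (z - b) (c - b) = 0 ->
  triangle x b c z -> segment b c z.
Proof.
move=> x0 z0 [[s t] /= [h1 h2 h3] zE].
have : (1 - s - t) * crs (x - b) (c - b) = 0.
  by rewrite -[RHS]z0 -zE /crs /= !scaleE; ring.
move/eqP; rewrite mulf_eq0 (negPf x0) orbF => /eqP st.
exists t; first by apply/andP; split => //=; lra.
rewrite -zE (_ : s = 1 - t); last by lra.
by apply: pairE => /=; rewrite !scaleE; ring.
Qed.

(** The signed distance of [z] to the base is a nonnegative multiple of that of [x] and of that of
    [y]; these have opposite signs, so it vanishes. *)
Lemma opposite_cap b c x y z : crs (x - b) (c - b) * crs (y - b) (c - b) < 0 ->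
  triangle x b c z -> triangle y b c z -> segment b c z.
Proof.
move=> xy Tx Ty.
have x0 : crs (x - b) (c - b) != 0 by apply: contraTneq xy => ->; rewrite mul0r ltxx.
apply: (base_line x0 _ Tx).
have H w : triangle w b c z -> exists2 l : R, 0 <= l & crs (z - b) (c - b) = l * crs (w - b) (c - b).
  case=> -[s t] /= [h1 h2 h3] zE; exists (1 - s - t); first by lra.
  by rewrite -zE /crs /= !scaleE; ring.
have [l l0 E1] := H _ Tx; have [m m0 E2] := H _ Ty.
move: xy E1 E2; move: (crs (x - b) _) (crs (y - b) _) (crs (z - b) _) => u v w uv E1 E2.
have : w ^+ 2 <= 0 by rewrite expr2 {1}E1 E2; have := mulr_ge0 l0 m0; nra.
by rewrite le_eqVlt ltNge sqr_ge0 orbF sqrf_eq0 => /eqP.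
Qed.

(** The open cone of apex [x] over the base: a neighbourhood of the open base in which belonging to
    the triangle is decided by the sign of [bary2]. *)
Let base_nbhs b c x := [set p | 1 * bary1 b c x p + 0 * bary2 b c x p + 0 > 0] `&`
   [set p | (-1) * bary1 b c x p + (-1) * bary2 b c x p + 1 > 0].

Let open_base_nbhs b c x : open (base_nbhs b c x).
Proof. by apply: openI; exact: open_bary. Qed.

Let base_nbhs_base b c x (t : R) : crs (c - b) (x - b) != 0 -> 0 < t < 1 ->
  base_nbhs b c x (b + t *: (c - b)).
Proof.
move=> D0 /andP[t0 t1].
have -> : b + t *: (c - b) = b + t *: (c - b) + 0 *: (x - b) by rewrite scale0r addr0.
by split; rewrite /= bary1_comb// bary2_comb//; lra.
Qed.

Let base_nbhs_tri b c x p : crs (c - b) (x - b) != 0 -> base_nbhs b c x p ->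
  0 <= bary2 b c x p -> triangle x b c p.
Proof.
move=> D0 [/= h1 h2] h3; rewrite triangle_rot; apply/triangleP => //.
by split => //; lra.
Qed.

Let base_nbhs_int b c x p : crs (c - b) (x - b) != 0 -> base_nbhs b c x p ->
  0 < bary2 b c x p -> (triangle x b c)° p.
Proof.
move=> D0 [/= h1 h2] h3; rewrite triangle_rot; apply/interior_triangleP => //.
by split => //; lra.
Qed.

Lemma crsN (v w : R * R) : crs v w = - crs w v.
Proof. rewrite /crs; ring. Qed.

(** A point just off the midpoint of the base, in the direction of [x], lies in both interiors. *)
Lemma same_side_meet b c x y : 0 < crs (x - b) (c - b) * crs (y - b) (c - b) ->
  (triangle x b c)° `&` (triangle y b c)° !=set0.
Proof.
rewrite [crs (x - b) _]crsN [crs (y - b) _]crsN mulrNN => xy.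
have x0 : crs (c - b) (x - b) != 0 by apply: contraTneq xy => ->; rewrite mul0r ltxx.
have y0 : crs (c - b) (y - b) != 0 by apply: contraTneq xy => ->; rewrite mulr0 ltxx.
have h2 : 0 < (2^-1 : R) < 1 by apply/andP; split; lra.
pose m := b + 2^-1 *: (c - b).
have : nbhs m (base_nbhs b c x `&` base_nbhs b c y).
  apply: open_nbhs_nbhs; split; first by apply: openI; exact: open_base_nbhs.
  by split; exact: base_nbhs_base.
move=> /ball2[e e0 eW].
have n0 : 0 < 1 + `|(x - m).1| + `|(x - m).2| by rewrite -addrA ltr_pwDl// addr_ge0.
pose d := e / 2 / (1 + `|(x - m).1| + `|(x - m).2|).
have d0 : 0 < d by rewrite !divr_gt0.
have dE : d * (1 + `|(x - m).1| + `|(x - m).2|) = e / 2 by rewrite /d divfK// gt_eqF.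
have p1 : 0 <= d * `|(x - m).1| by rewrite mulr_ge0// ltW.
have p2 : 0 <= d * `|(x - m).2| by rewrite mulr_ge0// ltW.
have [Wx Wy] := eW (m + d *: (x - m)) ltac:(by rewrite /= addrC addKr normrM (gtr0_norm d0) -/(x - m); lra)
   ltac:(by rewrite /= addrC addKr normrM (gtr0_norm d0) -/(x - m); lra).
exists (m + d *: (x - m)).
have E : crs (c - b) (m + d *: (x - m) - b) = d * crs (c - b) (x - b).
  by rewrite /m /crs /= !scaleE; ring.
split; apply: base_nbhs_int => //; rewrite /bary2 E.
  by rewrite mulfK.
move: (crs _ (x - b)) (crs _ (y - b)) x0 y0 xy => u v u0 v0 uv.
rewrite -mulrA mulr_gt0// (_ : u / v = u * v / v ^+ 2); last by field.
by rewrite divr_gt0// exprn_even_gt0.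
Qed.

Lemma base_interior b c x y (t : R) : crs (x - b) (c - b) * crs (y - b) (c - b) < 0 ->
  0 < t < 1 -> (triangle x b c `|` triangle y b c)° (b + t *: (c - b)).
Proof.
rewrite [crs (x - b) _]crsN [crs (y - b) _]crsN mulrNN => xy t01.
have x0 : crs (c - b) (x - b) != 0 by apply: contraTneq xy => ->; rewrite mul0r ltxx.
have y0 : crs (c - b) (y - b) != 0 by apply: contraTneq xy => ->; rewrite mulr0 ltxx.
have : nbhs (b + t *: (c - b)) (base_nbhs b c x `&` base_nbhs b c y).
  apply: open_nbhs_nbhs; split; first by apply: openI; exact: open_base_nbhs.
  by split; exact: base_nbhs_base.
apply: filterS => p [Wx Wy].
have [h|h] := lerP 0 (bary2 b c x p); first by left; exact: base_nbhs_tri.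
right; apply: base_nbhs_tri => //; move: h; rewrite /bary2.
move: (crs (c - b) (p - b)) (crs (c - b) (x - b)) (crs (c - b) (y - b)) x0 y0 xy => w u v u0 v0 uv h.
have : 0 < (w / u) * (u / v).
  have : u / v < 0 by rewrite -(pmulr_llt0 _ (_ : 0 < v ^+ 2)) ?expr2 ?mulrA ?divfK// -expr2 exprn_even_gt0.
  by rewrite nmulr_rgt0.
by rewrite mulrA divfK// => /ltW.
Qed.

Lemma quad_cover_half a b x y (th q : R) : 0 < th < 1 -> 0 <= q <= 1 ->
  a + th *: (b - a) = x + q *: (y - x) ->
  forall s t : R, 0 <= s -> 0 <= t -> s + t <= 1 -> t * (1 - th) <= s * th ->
  triangle a x y (x + s *: (a - x) + t *: (b - x)).
Proof.
move=> /andP[th0 th1] /andP[q0 q1] E s t s0 t0 st h.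
exists (1 - s - t + t / th * (1 - q), t / th * q) => /=.
  have tt : 0 <= t / th by rewrite divr_ge0// ltW.
  have tE : t / th * th = t by rewrite divfK// gt_eqF.
  split; [nra|nra|].
  suff : t / th <= s + t by lra.
  by rewrite ler_pdivrMr//; lra.
have E1 : b.1 = (x.1 + q * (y.1 - x.1) - (1 - th) * a.1) / th.
  have := congr1 fst E; rewrite /= !scaleE => E1.
  apply: (@mulIf _ th); first by rewrite gt_eqF.
  by rewrite divfK ?gt_eqF//; lra.
have E2 : b.2 = (x.2 + q * (y.2 - x.2) - (1 - th) * a.2) / th.
  have := congr1 snd E; rewrite /= !scaleE => E2.
  apply: (@mulIf _ th); first by rewrite gt_eqF.
  by rewrite divfK ?gt_eqF//; lra.
by apply: pairE => /=; rewrite !scaleE ?E1 ?E2; field; rewrite gt_eqF.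
Qed.

Lemma quad_cover a b x y (th q : R) : 0 < th < 1 -> 0 <= q <= 1 ->
  a + th *: (b - a) = x + q *: (y - x) ->
  triangle x a b `<=` triangle a x y `|` triangle b x y.
Proof.
move=> th01 q01 E p [[s t] /= [s0 t0 st] <-].
have [h|/ltW h] := lerP (t * (1 - th)) (s * th).
  by left; exact: quad_cover_half E _ _ _ _ _ _.
right; rewrite -addrA [X in x + X]addrC addrA.
have th01' : 0 < 1 - th < 1 by move/andP: th01 => [? ?]; apply/andP; split; lra.
have E' : b + (1 - th) *: (a - b) = x + q *: (y - x).
  by rewrite -E; apply: pairE => /=; rewrite !scaleE; ring.
by apply: (quad_cover_half th01' q01 E') => //; lra.
Qed.

Lemma parallel_scale (v e : R * R) : crs v e = 0 -> e != 0 -> exists th : R, v = th *: e.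
Proof.
move=> ve e0.
have d0 : e.1 ^+ 2 + e.2 ^+ 2 != 0.
  apply: contra e0; rewrite paddr_eq0 ?sqr_ge0// !sqrf_eq0 => /andP[/eqP e1 /eqP e2].
  by apply/eqP/pairE.
exists ((v.1 * e.1 + v.2 * e.2) / (e.1 ^+ 2 + e.2 ^+ 2)).
move: ve; rewrite /crs => ve.
apply: pairE => /=; rewrite !scaleE.
  apply: (@mulIf _ (e.1 ^+ 2 + e.2 ^+ 2)) => //; rewrite mulrAC divfK//.
  have : e.2 * (v.1 * e.2 - v.2 * e.1) = 0 by rewrite ve mulr0.
  by move=> h; apply/eqP; rewrite -subr_eq0 -h; apply/eqP; ring.
apply: (@mulIf _ (e.1 ^+ 2 + e.2 ^+ 2)) => //; rewrite mulrAC divfK//.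
have : e.1 * (v.1 * e.2 - v.2 * e.1) = 0 by rewrite ve mulr0.
by move=> h; apply/eqP; rewrite -subr_eq0 -oppr0 -h; apply/eqP; ring.
Qed.

End Quad.

(** Were [th] negative, the point halfway between [a] and the crossing would be interior to [a x y]
    and on the line [(a, b)], but behind [a]. The inclusion would force it onto the segment
    [[a, b]]. *)
Lemma cross_param_gt0 (R : realType) (a b x y : R * R) (th q : R) : 0 < q < 1 ->
  a + th *: (b - a) = x + q *: (y - x) ->
  (triangle a x y)° !=set0 ->
  (triangle a x y)° `<=` triangle x a b `|` triangle y a b ->
  crs (x - a) (b - a) != 0 -> crs (y - a) (b - a) != 0 -> 0 < th.
Proof.
move=> /andP[q0 q1] E /nondegenerate_triangle D0 sub x0 y0.
have E1 := congr1 fst E; rewrite /= !scaleE in E1.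
have E2 := congr1 snd E; rewrite /= !scaleE in E2.
have th0 : th != 0.
  apply: contra D0 => /eqP th0; apply/eqP; move: E1 E2; rewrite th0 !mul0r !addr0 /crs /= => -> ->.
  by ring.
rewrite lt_neqAle eq_sym th0 /= leNgt; apply/negP => thn.
have ab0 : b - a != 0.
  by apply: contra x0 => /eqP->; rewrite /crs /= !mulr0 subrr.
pose z := a + ((1 - q) / 2) *: (x - a) + (q / 2) *: (y - a).
have zE : z = a + (th / 2) *: (b - a).
  apply: pairE; rewrite /z /= !scaleE.
    have -> : th / 2 * (b.1 - a.1) = (a.1 + th * (b.1 - a.1) - a.1) / 2 by field.
    by rewrite E1; field.
  have -> : th / 2 * (b.2 - a.2) = (a.2 + th * (b.2 - a.2) - a.2) / 2 by field.
  by rewrite E2; field.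
have zl : crs (z - a) (b - a) = 0 by rewrite zE /crs /= !scaleE; ring.
have : segment a b z.
  have [|h|h] := sub z.
  - by apply/interior_triangleP => //; rewrite bary1_comb// bary2_comb//; split; lra.
  - exact: base_line x0 zl h.
  - exact: base_line y0 zl h.
case=> t /= /andP[t0 _]; rewrite zE => /addrI/eqP.
by rewrite -subr_eq0 -scalerBl scaler_eq0 (negPf ab0) orbF => /eqP; lra.
Qed.

(** * Diamonds and primal cells *)

Section MeshTopology.
Variables (R : realType) (Omega : set (R * R)) (T : mesh R).
Hypotheses (oO : open Omega) (M : ddfv_mesh Omega T).
Implicit Types (d : diam T) (K L : primal T) (s : vertex T) (z p : R * R).

Definition tri_K K d := triangle (pcenter K) (xKs d) (xLs d).
Definition tri_s s d := triangle (vert s) (xK d) (xL d).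

Lemma cell_disj K L p : cell K p -> cell L p -> K = L.
Proof.
move=> Kp Lp; case: (primal_partition M) => _ _ tr _.
by apply: tr => //; exists p.
Qed.

Lemma diam_disj d d' p : diamond d p -> diamond d' p -> d = d'.
Proof.
move=> Kp Lp; case: (diamond_partition M) => _ _ tr _.
by apply: tr => //; exists p.
Qed.

Lemma cell_open K : open (cell K).
Proof. by case: (primal_partition M) => /(_ K)[]. Qed.

Lemma cell_sub K : cell K `<=` Omega.
Proof. by case: (primal_partition M). Qed.

Lemma diam_open d : open (diamond d).
Proof. exact: open_interior. Qed.

Lemma diam_sub d : diamond d `<=` Omega.
Proof. by case: (diamond_partition M). Qed.

Lemma edgeP K d : edge_of K d -> dK d = K \/ dL d = inl K.
Proof. by case/orP => /eqP; [left|right]. Qed.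

Lemma vertexP s d : has_vertex s d -> dKs d = s \/ dLs d = s.
Proof. by case/orP => /eqP; [left|right]. Qed.

Lemma cap_K K d : edge_of K d -> diamond d `&` cell K = (tri_K K d)° /\ (tri_K K d)° !=set0.
Proof.
rewrite /tri_K => /edgeP[<-|dL].
  by case: (diamond_cap_K M d); rewrite /xK => -> ?.
by case: (diamond_cap_L M dL); rewrite /xL dL /= => -> ?.
Qed.

Lemma cap_s s d : has_vertex s d ->
  diamond d `&` dual_cell s = (tri_s s d)° /\ (tri_s s d)° !=set0.
Proof.
rewrite /tri_s => /vertexP[<-|<-].
  by case: (diamond_cap_Ks M d); rewrite /xKs => -> ?.
by case: (diamond_cap_Ls M d); rewrite /xLs => -> ?.
Qed.

Lemma tri_K_crs K d : edge_of K d -> crs (xKs d - pcenter K) (xLs d - pcenter K) != 0.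
Proof. by move=> /cap_K[_ h]; exact: nondegenerate_triangle h. Qed.

Lemma tri_s_crs s d : has_vertex s d -> crs (xK d - vert s) (xL d - vert s) != 0.
Proof. by move=> /cap_s[_ h]; exact: nondegenerate_triangle h. Qed.

Lemma tri_K_closure K d : edge_of K d -> closure (tri_K K d)° = tri_K K d.
Proof. by move=> /tri_K_crs; exact: triangle_closure. Qed.

Lemma tri_s_closure s d : has_vertex s d -> closure (tri_s s d)° = tri_s s d.
Proof. by move=> /tri_s_crs; exact: triangle_closure. Qed.

(** An open diamond meeting the closed triangle also meets its interior, which is part of
    [diamond d]; diamonds are disjoint. *)
Lemma tri_K_diam K d d' p : edge_of K d -> diamond d' p -> tri_K K d p -> d = d'.
Proof.
move=> Kd dp; rewrite -(tri_K_closure Kd) => /(_ _ (open_nbhs_nbhs (conj (@diam_open d') dp))).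
by case=> q []; rewrite -(cap_K Kd).1 => -[dq _] dq'; exact: diam_disj dq dq'.
Qed.

Lemma tri_s_diam s d d' p : has_vertex s d -> diamond d' p -> tri_s s d p -> d = d'.
Proof.
move=> Kd dp; rewrite -(tri_s_closure Kd) => /(_ _ (open_nbhs_nbhs (conj (@diam_open d') dp))).
by case=> q []; rewrite -(cap_s Kd).1 => -[dq _] dq'; exact: diam_disj dq dq'.
Qed.

Lemma tri_K_cell K d : edge_of K d -> tri_K K d `<=` closure (cell K).
Proof.
move=> Kd; rewrite -(tri_K_closure Kd) -(cap_K Kd).1.
by apply: closureS; exact: subIsetr.
Qed.

Lemma edge_K d : edge_of (dK d) d. Proof. by rewrite /edge_of eqxx. Qed.

Lemma edge_L d L : dL d = inl L -> edge_of L d.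
Proof. by move=> dL; rewrite /edge_of dL eqxx orbT. Qed.

Lemma vertex_Ks d : has_vertex (dKs d) d. Proof. by rewrite /has_vertex eqxx. Qed.
Lemma vertex_Ls d : has_vertex (dLs d) d. Proof. by rewrite /has_vertex eqxx orbT. Qed.

Lemma crsvv (v : R * R) : crs v v = 0.
Proof. rewrite /crs; ring. Qed.

Lemma xL_xK d : xL d != xK d.
Proof.
apply/eqP => E; have := tri_s_crs (vertex_Ks d).
by rewrite E crsvv eqxx.
Qed.

Lemma dL_dK d L : dL d = inl L -> L != dK d.
Proof. by move=> dL; apply: contra (xL_xK d) => /eqP E; rewrite /xL /xK dL /= E. Qed.

Lemma xL_boundary d b : dL d = inr b -> xL d = midpoint (xKs d) (xLs d).
Proof.
by move=> dL; rewrite /xL dL /= (boundary_sigma M dL).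
Qed.

Lemma sigma_boundary d b : dL d = inr b -> sigma d `<=` ~` Omega.
Proof.
move=> dL z sz; have : frontier Omega z.
  by rewrite (boundary_edges M); exists b => //; rewrite /bseg (boundary_sigma M dL).
by case=> _; rewrite (iffLR (interior_id _) oO).
Qed.

(** With both centers on the same side of [sigma] the two open half-diamonds would meet, although
    they lie in disjoint cells. *)
Lemma opposite_sides d L : dL d = inl L ->
  crs (xK d - xKs d) (xLs d - xKs d) * crs (xL d - xKs d) (xLs d - xKs d) < 0.
Proof.
move=> dL.
have E : xL d = pcenter L by rewrite /xL dL.
have n x b c : crs (b - x) (c - x) != 0 -> crs (x - b) (c - b) != 0 :> R.
  by rewrite (_ : crs (x - b) _ = - crs (b - x) (c - x)) ?oppr_eq0// /crs /=; ring.
have nK := n _ _ _ (tri_K_crs (edge_K d)).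
have nL := n _ _ _ (tri_K_crs (edge_L dL)).
rewrite lt_neqAle mulf_neq0 ?E//= leNgt; apply/negP => /same_side_meet[p [Kp Lp]].
have /eqP[] := dL_dK dL.
have : (diamond d `&` cell (dK d)) p by rewrite (cap_K (edge_K d)).1.
have : (diamond d `&` cell L) p by rewrite (cap_K (edge_L dL)).1.
by move=> [_ h1] [_ h2]; exact: cell_disj h1 h2.
Qed.

Lemma diam_tri d : diamond d `<=` triangle (xK d) (xKs d) (xLs d) `|` triangle (xL d) (xKs d) (xLs d).
Proof. exact: interior_subset. Qed.

Lemma xKs_neq_xLs d : xLs d != xKs d.
Proof.
apply/eqP => E; have := tri_K_crs (edge_K d).
by rewrite E /crs; apply/negP; rewrite negbK mulrC subrr.
Qed.

(** The two centers are on opposite sides of [sigma], which gives [q]. That the crossing is between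
    the two vertices follows from [cross_param_gt0] at each of them, the open dual triangles being
    contained in the diamond. On the boundary [xL] is the midpoint of [sigma], so [th] is $1/2$ and
    [q] is 1. *)
Lemma diamond_cross d : exists th q : R,
  [/\ 0 < th < 1, 0 < q <= 1, xKs d + th *: (xLs d - xKs d) = xK d + q *: (xL d - xK d),
      crs (xLs d - xKs d) (xL d - xK d) != 0 & forall L, dL d = inl L -> q < 1].
Proof.
case dLE : (dL d) => [L|b]; last first.
  have E := xL_boundary dLE.
  exists 2^-1, 1; split => //.
  - by apply/andP; split; lra.
  - by rewrite ltr01 lexx.
  - by rewrite E /midpoint; apply: pairE => /=; rewrite !scaleE; field.
  - have := tri_K_crs (edge_K d).
    rewrite -/(xK d) E /midpoint; apply: contra => /eqP h; apply/eqP.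
    by rewrite -oppr0 -h /crs /= !scaleE; field.
have opp := opposite_sides dLE.
set e := xLs d - xKs d in opp *; set k := crs (xK d - xKs d) e in opp; set l := crs (xL d - xKs d) e in opp.
have kl0 : k - l != 0.
  apply/eqP => h; move: opp; have -> : k = l by lra.
  by rewrite -expr2 ltNge sqr_ge0.
have e0 : e != 0 by rewrite subr_eq0 xKs_neq_xLs.
pose q := k / (k - l).
have q01 : 0 < q < 1.
  have kl2 : 0 < (k - l) ^+ 2 by rewrite exprn_even_gt0.
  have qE : q = k * (k - l) / (k - l) ^+ 2 by rewrite /q; field.
  rewrite qE divr_gt0//=; last by have := sqr_ge0 k; nra.
  by rewrite ltr_pdivrMr// mul1r; have := sqr_ge0 l; nra.
have [th thE] : exists th : R, xK d + q *: (xL d - xK d) - xKs d = th *: e.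
  apply: parallel_scale => //.
  have -> : crs (xK d + q *: (xL d - xK d) - xKs d) e = k - q * (k - l).
    by rewrite /k /l /crs /= !scaleE; ring.
  by rewrite /q divfK// subrr.
have cE : xKs d + th *: e = xK d + q *: (xL d - xK d) by rewrite -thE addrC subrK.
have k0 : k != 0 by apply: contraTneq opp => ->; rewrite mul0r ltxx.
have l0 : l != 0 by apply: contraTneq opp => ->; rewrite mulr0 ltxx.
have sub s : has_vertex s d -> (triangle (vert s) (xK d) (xL d))° `<=`
    triangle (xK d) (xKs d) (xLs d) `|` triangle (xL d) (xKs d) (xLs d).
  by move=> sd; rewrite -(cap_s sd).1 => p [/diam_tri].
have th0 : 0 < th.
  apply: (@cross_param_gt0 _ (xKs d) (xLs d) (xK d) (xL d) th q) => //.
    by case: (cap_s (vertex_Ks d)).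
  exact: sub (vertex_Ks d).
have th1 : 0 < 1 - th.
  have flip x : crs (x - xLs d) (xKs d - xLs d) = - crs (x - xKs d) e.
    by rewrite /e /crs /=; ring.
  apply: (@cross_param_gt0 _ (xLs d) (xKs d) (xK d) (xL d) (1 - th) q) => //.
  - by rewrite -cE /e; apply: pairE => /=; rewrite !scaleE; ring.
  - by case: (cap_s (vertex_Ls d)).
  - rewrite [triangle _ (xLs d) _]triangle_swap [triangle (xL d) (xLs d) _]triangle_swap.
    exact: sub (vertex_Ls d).
  - by rewrite flip oppr_eq0.
  - by rewrite flip oppr_eq0.
have /andP[q0 q1] := q01.
exists th, q; split => //.
- by apply/andP; split; lra.
- by rewrite q0 ltW.
- rewrite (_ : crs e _ = k - l)//.
  by rewrite /k /l /crs /=; ring.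
Qed.

(** Since the diagonals cross, cutting the quadrilateral along either one gives the same set. The
    diamond, defined by its cut along [sigma], can thus be studied from the dual side. *)
Lemma tri_union d : triangle (xK d) (xKs d) (xLs d) `|` triangle (xL d) (xKs d) (xLs d)
  = triangle (xKs d) (xK d) (xL d) `|` triangle (xLs d) (xK d) (xL d).
Proof.
have [th [q [th01 /andP[q0 q1] E _ _]]] := diamond_cross d.
have q01 : 0 <= q <= 1 by rewrite q1 ltW.
have th01' : 0 <= th <= 1 by case/andP: th01 => *; apply/andP; split; exact: ltW.
have E' : xKs d + th *: (xLs d - xKs d) = xL d + (1 - q) *: (xK d - xL d).
  by rewrite E; apply: pairE => /=; rewrite !scaleE; ring.
have q01' : 0 <= 1 - q <= 1 by apply/andP; split; lra.
apply/seteqP; split.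
  move=> p [h|h]; first exact: (quad_cover th01 q01 E).
  by have := quad_cover th01 q01' E' h; rewrite [triangle (xKs d) _ _]triangle_swap [triangle (xLs d) _ _]triangle_swap.
have [qlt|/eqP qeq] : 0 < q < 1 \/ q == 1.
- by rewrite q0 /=; case: ltrgtP q1 => // _ _; [left|right].
- move=> p [h|h]; first exact: (quad_cover qlt th01' (esym E)).
  have E2 : xK d + q *: (xL d - xK d) = xLs d + (1 - th) *: (xKs d - xLs d).
    by rewrite -E; apply: pairE => /=; rewrite !scaleE; ring.
  have th2 : 0 <= 1 - th <= 1 by move/andP: th01' => [? ?]; apply/andP; split; lra.
  by have := quad_cover qlt th2 E2 h; rewrite [triangle (xK d) _ _]triangle_swap [triangle (xL d) _ _]triangle_swap.
(* degenerate second triangle: [xL] lies on the edge *)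
have EL : xL d = xKs d + th *: (xLs d - xKs d).
  by rewrite E qeq; apply: pairE => /=; rewrite !scaleE; ring.
move/andP: th01' => [t0 t1].
move=> p [[[s t] /= [h1 h2 h3] <-]|[[s t] /= [h1 h2 h3] <-]]; left.
- exists (1 - s - t + t * (1 - th), t * th); first by rewrite /=; split; nra.
  by rewrite EL; apply: pairE => /=; rewrite !scaleE; ring.
- exists (t * (1 - th), 1 - s - t + t * th); first by rewrite /=; split; nra.
  by rewrite EL; apply: pairE => /=; rewrite !scaleE; ring.
Qed.

Lemma diam_tri_s d : diamond d `<=` tri_s (dKs d) d `|` tri_s (dLs d) d.
Proof. by move=> p /diam_tri; rewrite tri_union. Qed.

Lemma opposite_vertices d :
  crs (xKs d - xK d) (xL d - xK d) * crs (xLs d - xK d) (xL d - xK d) < 0.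
Proof.
have [th [q [/andP[th0 th1] _ E D0 _]]] := diamond_cross d.
have E1 := congr1 fst E; rewrite /= !scaleE in E1.
have E2 := congr1 snd E; rewrite /= !scaleE in E2.
set D := crs (xLs d - xKs d) (xL d - xK d) in D0.
have e1 : crs (xKs d - xK d) (xL d - xK d) = - th * D.
  have -> : xKs d = xK d + q *: (xL d - xK d) - th *: (xLs d - xKs d).
    by rewrite -E; apply: pairE => /=; rewrite !scaleE; ring.
  by rewrite /D /crs /= !scaleE; ring.
have e2 : crs (xLs d - xK d) (xL d - xK d) = (1 - th) * D.
  have -> : crs (xLs d - xK d) (xL d - xK d) = crs (xKs d - xK d) (xL d - xK d) + D.
    by rewrite /D /crs /=; ring.
  by rewrite e1; ring.
have : 0 < D ^+ 2 by rewrite exprn_even_gt0.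
move=> D2; have : 0 < th * (1 - th) * D ^+ 2 by apply: mulr_gt0 => //; apply: mulr_gt0 => //; lra.
by rewrite e1 e2; lra.
Qed.

Lemma sigma_diamond d L (t : R) : dL d = inl L -> 0 < t < 1 ->
  diamond d (xKs d + t *: (xLs d - xKs d)).
Proof. by move=> dL t01; apply: base_interior t01; exact: opposite_sides dL. Qed.

Lemma sigmas_diamond d (t : R) : 0 < t < 1 ->
  diamond d (xK d + t *: (xL d - xK d)).
Proof.
move=> t01; rewrite /diamond tri_union; apply: base_interior t01.
exact: opposite_vertices.
Qed.

Lemma segment_inner (a b z : R * R) : segment a b z -> z != a -> z != b ->
  exists2 t : R, 0 < t < 1 & z = a + t *: (b - a).
Proof.
case=> t /= /andP[t0 t1] <- za zb; exists t => //; rewrite !lt_neqAle t0 t1 !andbT.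
apply/andP; split; [apply: contra za|apply: contra zb] => /eqP.
  by move=> <-; apply/eqP; apply: pairE => /=; rewrite !scaleE; ring.
by move=> ->; apply/eqP; apply: pairE => /=; rewrite !scaleE; ring.
Qed.

Lemma cover_tri z : Omega z -> exists d K, edge_of K d /\ tri_K K d z.
Proof.
case: (diamond_partition M) => _ _ _ cov /cov[d _ dz].
have : (triangle (xK d) (xKs d) (xLs d) `|` triangle (xL d) (xKs d) (xLs d)) z.
  rewrite (iffLR (closure_id _) (closedU (@closed_triangle _ _ _ _) (@closed_triangle _ _ _ _))).
  by apply: closureS dz; exact: diam_tri.
case=> Tz; first by exists d, (dK d); split => //; exact: edge_K.
case dLE : (dL d) => [L|b].
  by exists d, L; split; [exact: edge_L|rewrite /tri_K; move: Tz; rewrite /xL dLE].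
exists d, (dK d); split; first exact: edge_K.
have EL := xL_boundary dLE; rewrite /midpoint in EL.
case: Tz => -[s t] /= [h1 h2 h3] <-.
(* The second triangle of a boundary diamond is flat: the weight of the midpoint is shared equally
   between the two ends of the edge. *)
exists (s + (1 - s - t) / 2, t + (1 - s - t) / 2); first by rewrite /=; split; lra.
by rewrite EL -/(xK d); apply: pairE => /=; rewrite !scaleE; field.
Qed.

Lemma cover_tri_s z : Omega z -> exists d s, has_vertex s d /\ tri_s s d z.
Proof.
case: (diamond_partition M) => _ _ _ cov /cov[d _ dz].
have : (tri_s (dKs d) d `|` tri_s (dLs d) d) z.
  rewrite (iffLR (closure_id _) (closedU (@closed_triangle _ _ _ _) (@closed_triangle _ _ _ _))).
  by apply: closureS dz; exact: diam_tri_s.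
by case=> Tz; [exists d, (dKs d)|exists d, (dLs d)]; split => //; rewrite ?vertex_Ks ?vertex_Ls.
Qed.

Lemma cell_tri K z : cell K z -> exists2 d, edge_of K d & tri_K K d z.
Proof.
move=> Kz; have [d [L [Ld Lz]]] := cover_tri (cell_sub Kz).
exists d; first suff -> : K = L by [].
  have [p [Lp Kp]] := tri_K_cell Ld Lz (open_nbhs_nbhs (conj (@cell_open K) Kz)).
  exact: cell_disj Kp Lp.
have [p [Lp Kp]] := tri_K_cell Ld Lz (open_nbhs_nbhs (conj (@cell_open K) Kz)).
by rewrite (cell_disj Kp Lp).
Qed.

Lemma diam_cell K d p : diamond d p -> cell K p -> edge_of K d.
Proof.
move=> dp Kp; have [d' Kd' Tp] := cell_tri Kp.
by rewrite -(tri_K_diam Kd' dp Tp).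
Qed.

Lemma closure_cell_diam K d z : diamond d z -> closure (cell K) z -> edge_of K d.
Proof.
move=> dz /(_ _ (open_nbhs_nbhs (conj (@diam_open d) dz)))[p [Kp dp]].
exact: diam_cell dp Kp.
Qed.

Lemma frontier_sigma K z : closure (cell K) z -> ~ cell K z ->
  exists2 d, edge_of K d & sigma d z.
Proof.
move=> cz Kz; have : frontier (cell K) z.
  by split => //; rewrite (iffLR (interior_id _) (@cell_open K)).
by rewrite (cell_frontier M) => -[d Kd dz]; exists d.
Qed.

Lemma edge_pair K L d : K != L -> edge_of K d -> edge_of L d ->
  (dK d = K /\ dL d = inl L) \/ (dK d = L /\ dL d = inl K).
Proof.
move=> /eqP KL /edgeP[hK|hK] /edgeP[hL|hL].
- by case: KL; rewrite -hK.
- by left.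
- by right.
- by move: hL; rewrite hK => -[].
Qed.

(** Cells being open and disjoint, [z] is on the frontier of [K], hence on an edge. That edge is not
    a boundary one, as [z] is in [Omega], and [z] is not one of its ends; so [z] is inside the
    diamond, which meets only its own two cells. *)
Lemma primal_jump z K L : Omega z -> (forall s, z != vert s) -> K != L ->
  closure (cell K) z -> closure (cell L) z ->
  exists d, [/\ sigma d z, diamond d z &
    (dK d = K /\ dL d = inl L) \/ (dK d = L /\ dL d = inl K)].
Proof.
move=> Oz zv KL cK cL.
have nK : ~ cell K z.
  move=> Kz; have [p [Lp Kp]] := cL _ (open_nbhs_nbhs (conj (@cell_open K) Kz)).
  by move/eqP: KL; apply; exact: cell_disj Kp Lp.
have [d Kd sz] := frontier_sigma cK nK.
case dLE : (dL d) => [N|b]; last by have := sigma_boundary dLE sz.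
have [t t01 zE] := segment_inner sz (zv _) (zv _).
have dz : diamond d z by rewrite zE; exact: sigma_diamond dLE t01.
exists d; split => //; apply: edge_pair => //; exact: closure_cell_diam dz _.
Qed.

End MeshTopology.

Section TriangleNull.
Variable R : realType.
Implicit Types (a b c z p w : R * R).

Lemma segment_null a b : null (segment a b).
Proof.
have [|x [y [xy h]]] := @degenerate_line R a b b; first exact: crsvv.
apply: negligibleS (line_null (@bd_triangle R a b b) xy h) => z [t /= /andP[t0 t1] <-].
exists (t, 0) => /=; first by split => //; lra.
by rewrite scale0r addr0.
Qed.

Lemma triangle_boundary_null a b c : crs (b - a) (c - a) != 0 ->
  null (triangle a b c `\` (triangle a b c)°).
Proof.
move=> D0.
apply: negligibleS (negligibleU (negligibleU (segment_null a b) (segment_null a c)) (segment_null b c)).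
move=> z [/(triangleP _ D0)[h1 h2 h3] ni].
have zE := bary_dec z D0.
have [b10|n1] := eqVneq (bary1 a b c z) 0.
  left; right; exists (bary2 a b c z); first by apply/andP; split => //; lra.
  by rewrite [RHS]zE b10 scale0r addr0.
have [b20|n2] := eqVneq (bary2 a b c z) 0.
  left; left; exists (bary1 a b c z); first by apply/andP; split => //; lra.
  by rewrite [RHS]zE b20 scale0r addr0.
have [e|n3] := eqVneq (bary1 a b c z + bary2 a b c z) 1.
  right; exists (bary2 a b c z); first by apply/andP; split => //; lra.
  rewrite [RHS]zE (_ : bary1 a b c z = 1 - bary2 a b c z); last by lra.
  by apply: pairE => /=; rewrite !scaleE; ring.
case: ni; apply/interior_triangleP => //; split; rewrite lt_neqAle.
- by rewrite eq_sym n1.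
- by rewrite eq_sym n2.
- by rewrite n3.
Qed.

Lemma tri_apex_scale a b c z (l : R) : triangle a b c z -> 0 <= l <= 1 ->
  triangle a b c (a + l *: (z - a)).
Proof.
move=> [[s t] /= [h1 h2 h3] <-] /andP[l0 l1].
exists (l * s, l * t); first by rewrite /=; split; nra.
by apply: pairE => /=; rewrite !scaleE; ring.
Qed.

(** Each [v i] excludes at most one parameter; the value taken is halfway between the largest
    excluded one and 1. *)
Lemma avoid_points (I : finType) (v : I -> R * R) a w (k : R) : w != 0 -> k < 1 ->
  exists2 k' : R, k < k' < 1 & forall i, a + k' *: w != v i.
Proof.
move=> w0 k1.
have inj (x y : R) : a + x *: w = a + y *: w -> x = y.
  move=> /addrI/eqP; rewrite -subr_eq0 -scalerBl scaler_eq0 (negPf w0) orbF.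
  by rewrite subr_eq0 => /eqP.
have /choice[l lP] : forall i, exists l : R, l < 1 /\ forall k', k < k' < 1 -> a + k' *: w = v i -> k' = l.
  move=> i; have [[l [/andP[l0 l1] e]]|h] := pselect (exists l, k < l < 1 /\ a + l *: w = v i).
    by exists l; split => // k' _ e'; apply: inj; rewrite e'.
  by exists k; split => // k' h1 h2; case: h; exists k'.
pose m := \big[Num.max/k]_i l i.
have m1 : m < 1 by apply: bigmax_lt => // i _; case: (lP i).
have km : k <= m by exact: bigmax_ge_id.
exists ((m + 1) / 2); first by apply/andP; split; lra.
move=> i; apply/eqP => /(proj2 (lP i)) h.
have lm : l i <= m by exact: le_bigmax.
have : (m + 1) / 2 = l i by apply: h; apply/andP; split; lra.
lra.
Qed.

End TriangleNull.

(** * The primal and dual meshes as jump complexes *)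

Section MeshComplex.
Variables (R : realType) (Omega : set (R * R)) (T : mesh R).
Hypotheses (oO : open Omega) (pO : polygonal Omega) (M : ddfv_mesh Omega T).
Implicit Types (d : diam T) (K L : primal T) (s : vertex T) (z p : R * R).

Lemma tri_K_other K d s : has_vertex s d ->
  exists c, tri_K K d = triangle (pcenter K) (vert s) c.
Proof.
move=> /vertexP[<-|<-]; first by exists (xLs d).
by exists (xKs d); rewrite /tri_K triangle_swap.
Qed.

Lemma tri_K_ray K d s (k : R) : has_vertex s d -> 0 <= k <= 1 ->
  tri_K K d (pcenter K + k *: (vert s - pcenter K)).
Proof.
move=> /(tri_K_other K)[c ->] /andP[k0 k1].
by exists (k, 0); rewrite /= ?scale0r ?addr0//; split => //; lra.
Qed.

Lemma sigma_apex K d p (l : R) : edge_of K d -> sigma d p -> p != xKs d -> p != xLs d ->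
  0 < l < 1 -> (tri_K K d)° (pcenter K + l *: (p - pcenter K)).
Proof.
move=> Kd sp p1 p2 /andP[l0 l1].
have [t /andP[t0 t1] pE] := segment_inner sp p1 p2.
have -> : pcenter K + l *: (p - pcenter K) = pcenter K
   + (l * (1 - t)) *: (xKs d - pcenter K) + (l * t) *: (xLs d - pcenter K).
  by rewrite pE; apply: pairE => /=; rewrite !scaleE; ring.
have D0 := tri_K_crs M Kd.
apply/interior_triangleP => //; rewrite bary1_comb// bary2_comb//.
by split; nra.
Qed.

(* A vertex [s] of [K] cannot lie in the interior of a segment joining the
   center to another vertex [s']: just beyond [s], on the side of an edge at
   [s], there would be points of [K] in no triangle based at the center. *)
Lemma no_hanging K d d' s s' (k : R) : edge_of K d -> has_vertex s d ->
  edge_of K d' -> has_vertex s' d' -> 0 < k < 1 ->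
  vert s = pcenter K + k *: (vert s' - pcenter K) -> False.
Proof.
move=> Kd sd Kd' sd' /andP[k0 k1] sE.
set a := pcenter K in sE.
have w0 : vert s' - a != 0.
  apply/eqP => e; have [c cE] := tri_K_other K sd'.
  have : (tri_K K d')° !=set0 by case: (cap_K M Kd').
  rewrite cE -/a => /nondegenerate_triangle; rewrite e /crs /= !mul0r subrr eqxx//.
have [k' /andP[kk' k'1] kv] := avoid_points (@vert R T) a w0 k1.
set p := a + k' *: (vert s' - a) in kv.
have Tp (l : R) : 0 <= l <= 1 -> tri_K K d' (a + l *: (p - a)).
  move=> l01; apply: tri_apex_scale l01; apply: tri_K_ray sd' _.
  by apply/andP; split; lra.
have cp : closure (cell K) p.
  apply: (tri_K_cell M Kd'); rewrite (_ : p = a + 1 *: (p - a)); first by apply: Tp; rewrite ler01 lexx.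
  by rewrite scale1r addrC subrK.
(* If [p] were on an edge of [K], the point halfway to the center would be interior to the triangle
   of that edge and also belong to that of [d']. The edge would then be [sigma d'], but [p] is
   strictly between the center and the vertex [s'], off the line of that edge. *)
have Kp : cell K p.
  apply: contrapT => nKp; have [d3 Kd3 sp] := frontier_sigma M cp nKp.
  have half : 0 < (2^-1 : R) < 1 by apply/andP; split; lra.
  have := sigma_apex Kd3 sp (kv _) (kv _) half.
  rewrite -(cap_K M Kd3).1 => -[d3q _].
  have dd := tri_K_diam M Kd' d3q (Tp 2^-1 ltac:(apply/andP; split; lra)).
  subst d3; case: sp => t _ pE.
  have z1 : crs (p - xKs d') (xLs d' - xKs d') = 0.
    by rewrite -pE /crs /= !scaleE; ring.
  have z2 : crs (p - xKs d') (xLs d' - xKs d') = (1 - k') * crs (a - xKs d') (xLs d' - xKs d').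
    by case/vertexP: sd' => sE'; rewrite /p -sE' /xKs /xLs /crs /= !scaleE; ring.
  have := tri_K_crs M Kd'.
  have -> : crs (xKs d' - pcenter K) (xLs d' - pcenter K) = - crs (a - xKs d') (xLs d' - xKs d').
    by rewrite /a /crs /=; ring.
  rewrite oppr_eq0; apply/negP; rewrite negbK.
  move: z2; rewrite z1 => /esym/eqP; rewrite mulf_eq0 => /orP[/eqP|//]; lra.
have [c cE] := tri_K_other K sd; rewrite -/a in cE.
have D0 : crs (vert s - a) (c - a) != 0.
  by apply: nondegenerate_triangle; rewrite -cE; case: (cap_K M Kd).
have /ball2[e e0 eK] : nbhs p (cell K) by apply: open_nbhs_nbhs; split => //; exact: cell_open M _.
have n0 : 0 < 1 + `|(c - a).1| + `|(c - a).2| by rewrite -addrA ltr_pwDl// addr_ge0.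
pose ep := e / 2 / (1 + `|(c - a).1| + `|(c - a).2|).
have ep0 : 0 < ep by rewrite !divr_gt0.
have epE : ep * (1 + `|(c - a).1| + `|(c - a).2|) = e / 2 by rewrite /ep divfK// gt_eqF.
have p1 : 0 <= ep * `|(c - a).1| by rewrite mulr_ge0// ltW.
have p2 : 0 <= ep * `|(c - a).2| by rewrite mulr_ge0// ltW.
(* A point of [K] slightly off the ray, on the side of the edge [d] at [s]. *)
pose q := p + ep *: (c - a).
have Kq : cell K q.
  by apply: eK; rewrite /q /= addrC addKr normrM (gtr0_norm ep0) -/(c - a); lra.
have [d5 Kd5 Tq] := cell_tri M Kq.
pose x := k' / k.
have x1 : 1 < x by rewrite /x ltr_pdivlMr// mul1r.
have qE (l : R) : a + l *: (q - a) = a + (l * x) *: (vert s - a) + (l * ep) *: (c - a).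
  by rewrite /q /p sE /x; apply: pairE => /=; rewrite !scaleE; field; rewrite gt_eqF.
(* Pulled toward the center by the factor [l], the point [q] has coordinates of sum $1/2$ in the
   triangle of [d], so only that triangle can contain it. But the coordinates of [q] itself have sum
   [x + ep], which exceeds 1. *)
pose l := (2 * (x + ep))^-1.
have l0 : 0 < l by rewrite invr_gt0 mulr_gt0// addr_gt0//; lra.
have lE : l * x + l * ep = 2^-1 by rewrite /l; field; rewrite gt_eqF// addr_gt0//; lra.
have l1 : l <= 1 by nra.
have dd : d5 = d.
  apply: (tri_K_diam M Kd5 (p := a + l *: (q - a))); last first.
    by apply: tri_apex_scale Tq _; rewrite l1 ltW.
  suff : (diamond d `&` cell K) (a + l *: (q - a)) by case.
  rewrite (cap_K M Kd).1 cE qE; apply/interior_triangleP => //.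
  rewrite bary1_comb// bary2_comb// lE; split; [|exact: mulr_gt0|lra].
  by rewrite mulr_gt0//; lra.
move: Tq; rewrite dd cE => /(triangleP _ D0)[_ _].
have := qE 1; rewrite scale1r addrC subrK !mul1r => ->.
by rewrite bary1_comb// bary2_comb//; lra.
Qed.

Lemma dual_open s : open (dual_cell s). Proof. exact: open_interior. Qed.

Lemma closure_dual_tri s z : closure (dual_cell s) z -> exists2 d, has_vertex s d & tri_s s d z.
Proof.
set U := \bigcup_(d in [set d | has_vertex s d]) tri_s s d.
have cU : closed U.
  by apply: closed_bigcup => [|d _]; [exact: finite_finset|exact: closed_triangle].
move=> cz; have : U z.
  by rewrite (iffLR (closure_id _) cU); apply: closureS cz; exact: interior_subset.
by case=> d sd Tz; exists d.
Qed.

Lemma diam_dual d s z : diamond d z -> closure (dual_cell s) z -> has_vertex s d /\ tri_s s d z.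
Proof.
move=> dz /closure_dual_tri[d' sd' Tz].
by rewrite -(tri_s_diam M sd' dz Tz).
Qed.

Lemma tri_s_dual s d : has_vertex s d -> tri_s s d `<=` closure (dual_cell s).
Proof.
move=> sd; rewrite -(tri_s_closure M sd) -(cap_s M sd).1.
by apply: closureS; exact: subIsetr.
Qed.

Lemma tri_s_sub s d : has_vertex s d -> tri_s s d `<=` closure Omega.
Proof.
move=> sd; rewrite -(tri_s_closure M sd) -(cap_s M sd).1.
by apply: closureS => p [/(diam_sub M)].
Qed.

(** The triangles of a dual cell are in the closure of [Omega]. A polygonal set is the interior of a
    closed set, so it contains the interior of its own closure. *)
Lemma dual_sub s : dual_cell s `<=` Omega.
Proof.
case: pO => ts Ots; rewrite [X in _ `<=` X]Ots; apply: interiorS.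
set U := \bigcup_(t in [set` ts]) triangle t.1.1 t.1.2 t.2.
have cU : closed U.
  by apply: closed_bigcup => [|t _]; [exact: finite_seq|exact: closed_triangle].
move=> p [d /= sd Tp]; rewrite (iffLR (closure_id _) cU).
apply: closureS (tri_s_sub sd Tp).
by rewrite [X in X `<=` _]Ots; exact: interior_subset.
Qed.

Lemma vertex_pair s s' d : s != s' -> has_vertex s d -> has_vertex s' d ->
  (dKs d = s /\ dLs d = s') \/ (dKs d = s' /\ dLs d = s).
Proof.
move=> /eqP ss /vertexP[h|h] /vertexP[h'|h']; [|by left|by right|].
- by case: ss; rewrite -h.
- by case: ss; rewrite -h.
Qed.

Lemma tri_s_cap s s' d z : s != s' -> has_vertex s d -> has_vertex s' d ->
  tri_s s d z -> tri_s s' d z -> segment (xK d) (xL d) z.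
Proof.
move=> ss sd sd' Ts Ts'.
have opp := opposite_vertices M d.
have [[e1 e2]|[e1 e2]] := vertex_pair ss sd sd'; subst s s'.
  exact: opposite_cap opp Ts Ts'.
exact: opposite_cap opp Ts' Ts.
Qed.

(** A common point can be moved into the interior of a triangle [tri_s s d], hence into one diamond.
    There the two dual cells share only points of the diagonal [sigma*], which is a side of that
    triangle. *)
Lemma dual_disj s s' p : dual_cell s p -> dual_cell s' p -> s = s'.
Proof.
move=> sp sp'; apply/eqP; apply: contrapT => /negP ss.
have [d sd Tp] := closure_dual_tri (subset_closure sp).
have : closure (tri_s s d)° p by rewrite (tri_s_closure M sd).
move=> /(_ (dual_cell s `&` dual_cell s')) [].
  by apply: open_nbhs_nbhs; split => //; apply: openI; exact: dual_open.
move=> q [Tq [sq sq']].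
have dq : diamond d q by move: Tq; rewrite -(cap_s M sd).1 => -[].
have [_ Tq1] := diam_dual dq (subset_closure sq).
have [sd' Tq2] := diam_dual dq (subset_closure sq').
have [t _ qE] := tri_s_cap ss sd sd' Tq1 Tq2.
have D0 := tri_s_crs M sd.
move: Tq => /(interior_triangleP _ D0)[_ _].
have -> : q = vert s + (1 - t) *: (xK d - vert s) + t *: (xL d - vert s).
  by rewrite -qE; apply: pairE => /=; rewrite !scaleE; ring.
by rewrite bary1_comb// bary2_comb//; lra.
Qed.

(** Away from vertices and centers, the base [sigma*] is inside the open diamond up to its possible
    end on the boundary, and a side running to a boundary midpoint lies outside [Omega]. Only the
    sides joining the vertex to a cell center remain. *)
Lemma tri_s_side s d z : has_vertex s d -> tri_s s d z -> ~ diamond d z -> Omega z ->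
  (forall s, z != vert s) -> (forall K, z != pcenter K) ->
  exists K (m : R), [/\ edge_of K d, 0 < m < 1 & z = pcenter K + m *: (vert s - pcenter K)].
Proof.
move=> sd Tz nd Oz zv zc.
have D0 := tri_s_crs M sd.
have [h1 h2 h3] := iffLR (triangleP _ D0) Tz.
have zE := bary_dec z D0.
set b1 := bary1 _ _ _ _ in h1 h3 zE; set b2 := bary2 _ _ _ _ in h2 h3 zE.
have zs : z != vert s by [].
have bsum : b1 + b2 < 1.
  rewrite lt_neqAle h3 andbT; apply/eqP => e.
  have sg : segment (xK d) (xL d) z.
    exists b2; first by apply/andP; split => //; lra.
    rewrite [RHS]zE (_ : b1 = 1 - b2); last by lra.
    by apply: pairE => /=; rewrite !scaleE; ring.
  have zL : z != xL d.
    case dLE : (dL d) => [L|b]; first by rewrite /xL dLE; exact: zc.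
    apply/eqP => zL; apply: (sigma_boundary oO M dLE) Oz.
    exists 2^-1; first by apply/andP; split; lra.
    by rewrite zL (xL_boundary M dLE) /midpoint; apply: pairE => /=; rewrite !scaleE; field.
  have [t t01 tE] := segment_inner sg (zc _) zL.
  have := @sigmas_diamond _ _ _ M d t t01.
  by rewrite -tE.
have [b10|n1] := eqVneq b1 0; last first.
  have [b20|n2] := eqVneq b2 0; last first.
    case: nd; suff : (diamond d `&` dual_cell s) z by case.
    rewrite (cap_s M sd).1; apply/interior_triangleP => //.
    by split => //; rewrite lt_neqAle eq_sym ?n1 ?n2.
  exists (dK d), (1 - b1); split.
  - exact: edge_K.
  - have : 0 < b1 by rewrite lt_neqAle eq_sym n1.
    by rewrite b20 addr0 in bsum => ?; apply/andP; split; lra.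
  - by rewrite {1}zE b20 scale0r addr0 -/(xK d); apply: pairE => /=; rewrite !scaleE; ring.
have zE2 : z = vert s + b2 *: (xL d - vert s) by rewrite {1}zE b10 scale0r addr0.
case dLE : (dL d) => [L|b]; last first.
  exfalso; apply: (sigma_boundary oO M dLE) Oz.
  rewrite zE2 (xL_boundary M dLE) /midpoint.
  case/vertexP: sd => <-.
    exists (b2 / 2); first by rewrite b10 in bsum; apply/andP; split; lra.
    by rewrite -/(xKs d); apply: pairE => /=; rewrite !scaleE; field.
  exists (1 - b2 / 2); first by rewrite b10 in bsum; apply/andP; split; lra.
  by rewrite -/(xLs d); apply: pairE => /=; rewrite !scaleE; field.
exists L, (1 - b2); split.
- exact: edge_L.
- have : b2 != 0 by apply: contra zs => /eqP e; rewrite zE2 e scale0r addr0.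
  move=> n2; have : 0 < b2 by rewrite lt_neqAle eq_sym n2.
  by rewrite b10 in bsum => ?; apply/andP; split; lra.
- by rewrite {1}zE2 /xL dLE /=; apply: pairE => /=; rewrite !scaleE; ring.
Qed.

(** Inside a diamond the answer is [tri_s_cap]. Elsewhere [z] would be on two segments joining a
    center to a vertex: distinct cells would put it on an interior edge, hence inside a diamond, and
    a common cell would align two of its vertices with the center, against [no_hanging]. *)
Lemma dual_jump z s s' : Omega z -> (forall s, z != vert s) -> (forall K, z != pcenter K) ->
  s != s' -> closure (dual_cell s) z -> closure (dual_cell s') z ->
  exists d, segment (xK d) (xL d) z /\
    ((dKs d = s /\ dLs d = s') \/ (dKs d = s' /\ dLs d = s)).
Proof.
move=> Oz zv zc ss cs cs'.
have [[d dz]|nd] := pselect (exists d, diamond d z).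
  have [sd Ts] := diam_dual dz cs; have [sd' Ts'] := diam_dual dz cs'.
  by exists d; split; [exact: tri_s_cap ss sd sd' Ts Ts'|exact: vertex_pair].
exfalso.
have [d1 sd1 T1] := closure_dual_tri cs; have [d2 sd2 T2] := closure_dual_tri cs'.
have [K1 [m1 [Kd1 m101 E1]]] := tri_s_side sd1 T1 (fun h => nd (ex_intro (fun d => diamond d z) _ h)) Oz zv zc.
have [K2 [m2 [Kd2 m201 E2]]] := tri_s_side sd2 T2 (fun h => nd (ex_intro (fun d => diamond d z) _ h)) Oz zv zc.
have cl K d x (m : R) : edge_of K d -> has_vertex x d -> 0 < m < 1 ->
    z = pcenter K + m *: (vert x - pcenter K) -> closure (cell K) z.
  move=> Kd xd /andP[m0 m1'] ->; apply: (tri_K_cell M Kd); apply: tri_K_ray => //.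
  by apply/andP; split; exact: ltW.
have [KK|KK] := eqVneq K1 K2; last first.
  have [d [_ dz _]] := primal_jump oO M Oz zv KK (cl _ _ _ _ Kd1 sd1 m101 E1) (cl _ _ _ _ Kd2 sd2 m201 E2).
  by apply: nd; exists d.
subst K2; set a := pcenter K1 in E1 E2.
have /andP[m10 m11] := m101; have /andP[m20 m21] := m201.
have E : m1 *: (vert s - a) = m2 *: (vert s' - a) by apply: (addrI a); rewrite -E1 -E2.
have Ef := congr1 fst E; have Es := congr1 snd E; rewrite /= !scaleE in Ef Es.
have ratio (x y : R) u v : 0 < x -> x *: (u - a) = y *: (v - a) -> u = a + (y / x) *: (v - a).
  move=> x0 e; rewrite mulrC -scalerA -e scalerA mulVf ?gt_eqF// scale1r addrC subrK//.
case: (ltrgtP m1 m2) => mm.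
- apply: (@no_hanging K1 d2 d1 s' s (m1 / m2)) => //.
    by rewrite divr_gt0//= ltr_pdivrMr// mul1r.
  exact: ratio.
- apply: (@no_hanging K1 d1 d2 s s' (m2 / m1)) => //.
    by rewrite divr_gt0//= ltr_pdivrMr// mul1r.
  exact: ratio.
- move/eqP: ss; apply; apply: (vert_inj M).
  by rewrite (ratio _ _ _ _ m10 E) mm divff ?gt_eqF// scale1r addrC subrK.
Qed.

(* A boundary diamond has a single interior cell, taken twice: zero jump. *)
Definition primal_right d : primal T := if dL d is inl L then L else dK d.

Lemma primal_complex :
  jump_complex Omega (@cell R T) (@dK R T) primal_right
    (fun d => (xKs d, xLs d)) [seq vert s | s <- enum (vertex T)].
Proof.
split.
- exact: cell_open M.
- exact: cell_sub M.
- by move=> i j p h1 h2; exact: (cell_disj M h1 h2).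
- by case: (primal_partition M).
- apply: (negligibleS _ (@null_seq R _ (enum (diam T)) (@sigma R T) (fun d _ => segment_null _ _))).
  case: (primal_partition M) => _ _ _ cov z [Oz nz].
  have [K _ cK] := cov _ Oz.
  have [|d _ dz] := frontier_sigma M cK; first by move=> Kz; apply: nz; exists K.
  by exists d => //; rewrite mem_enum.
- move=> z K L Oz zX KL cK cL.
  have zv s : z != vert s.
    apply: contra zX => /eqP ->; apply: map_f; exact: mem_enum.
  have [d [sz _ h]] := primal_jump oO M Oz zv KL cK cL.
  exists d; split => //; rewrite /primal_right.
  by case: h => -[h1 h2]; [left|right]; rewrite h2.
Qed.

(** Cell centers join the exceptional points, since many dual cells meet there. That the dual cells
    partition [Omega] up to a null set is deduced from the diamonds. *)
Lemma dual_complex :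
  jump_complex Omega (@dual_cell R T) (@dKs R T) (@dLs R T)
    (fun d => (xK d, xL d))
    ([seq vert s | s <- enum (vertex T)] ++ [seq pcenter K | K <- enum (primal T)]).
Proof.
split.
- exact: dual_open.
- exact: dual_sub.
- by move=> i j p; exact: dual_disj.
- move=> z Oz; have [d [s [sd Tz]]] := cover_tri_s M Oz.
  by exists s => //; exact: tri_s_dual sd _ Tz.
- apply: (negligibleS _ (@null_seq R _ (enum (diam T)) (fun d =>
    (tri_s (dKs d) d `\` (tri_s (dKs d) d)°) `|` (tri_s (dLs d) d `\` (tri_s (dLs d) d)°)) _)); last first.
    move=> d _; apply: negligibleU; apply: triangle_boundary_null; apply: (tri_s_crs M).
      exact: vertex_Ks.
    exact: vertex_Ls.
  move=> z [Oz nz]; have [d [s [sd Tz]]] := cover_tri_s M Oz.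
  have ni : ~ (tri_s s d)° z.
    by rewrite -(cap_s M sd).1 => -[_ sz]; apply: nz; exists s.
  exists d; first by rewrite mem_enum.
  by case/vertexP: sd => e; subst s; [left|right].
- move=> z s s' Oz; rewrite mem_cat negb_or => /andP[zX zY] ss cs cs'.
  apply: dual_jump => //.
    by move=> x; apply: contra zX => /eqP ->; apply: map_f; exact: mem_enum.
  by move=> x; apply: contra zY => /eqP ->; apply: map_f; exact: mem_enum.
Qed.

End MeshComplex.

(** * Mesh weights and coercivity *)

Section Integrals.
Variable R : realType.
Implicit Types (D : set (R * R)) (f g : R * R -> R).

Lemma integrable_measurable D f : (mu2 R).-integrable D (EFin \o f) ->
  measurable_fun (D : set (measurableTypeR R * measurableTypeR R)) f.
Proof. by move=> /integrableP[/measurable_EFinP]. Qed.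

Lemma ae_imp (P Q : R * R -> Prop) : {ae mu2 R, forall x, P x} ->
  (forall x, P x -> Q x) -> {ae mu2 R, forall x, Q x}.
Proof. by move=> h PQ; apply: negligibleS h => x /= nQ /PQ. Qed.

Lemma ae_Rintegral_ge0 D f : fm D -> (mu2 R).-integrable D (EFin \o f) ->
  {ae mu2 R, forall x, D x -> 0 <= f x} -> 0 <= \int[mu2 R]_(x in D) f x.
Proof.
move=> [mD _] If ae0.
have mf := integrable_measurable If.
have -> : \int[mu2 R]_(x in D) f x = \int[mu2 R]_(x in D) `|f x|.
  rewrite /Rintegral; congr fine; apply: ae_eq_integral => //.
  - by apply/measurable_EFinP.
  - by apply/measurable_EFinP; exact: measurableT_comp.
  - by apply: (ae_imp ae0) => x /= h Dx; rewrite ger0_norm// h.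
by apply: Rintegral_ge0 => x _.
Qed.

Lemma ae_eq_Rintegral D f g : fm D -> (mu2 R).-integrable D (EFin \o f) ->
  (mu2 R).-integrable D (EFin \o g) ->
  {ae mu2 R, forall x, D x -> f x = g x} ->
  \int[mu2 R]_(x in D) f x = \int[mu2 R]_(x in D) g x.
Proof.
move=> [mD _] If Ig h; rewrite /Rintegral; congr fine; apply: ae_eq_integral => //.
- by apply/measurable_EFinP; exact: integrable_measurable.
- by apply/measurable_EFinP; exact: integrable_measurable.
- by apply: (ae_imp h) => x /= hx Dx; rewrite hx.
Qed.

Lemma ess_bounded_integrable D E f : fm D -> measurable (E : set (measurableTypeR R * measurableTypeR R)) ->
  D `<=` E -> ess_bounded E f -> (mu2 R).-integrable D (EFin \o f).
Proof.
move=> [mD D1] mE DE [mf [C fC]].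
have mfD : measurable_fun (D : set (measurableTypeR R * measurableTypeR R)) f.
  exact: measurable_funS mE DE mf.
apply/integrableP; split; first by apply/measurable_EFinP.
apply: (@le_lt_trans _ _ (\int[mu2 R]_(x in D) `|C|%:E)%E).
  apply: ae_ge0_le_integral => //.
  - by apply/measurable_EFinP; exact: measurableT_comp.
  - by apply: (ae_imp fC) => x /= h /DE/h; rewrite lee_fin => /le_trans; apply; exact: ler_norm.
by rewrite integral_cst// lte_mul_pinfty// ?lee_fin//.
Qed.

Lemma square_integrable_integrable D f : fm D -> square_integrable D f ->
  (mu2 R).-integrable D (EFin \o f).
Proof.
move=> [mD D1] [mf If].
have I1 : (mu2 R).-integrable D (EFin \o (cst 1 : R * R -> R)).
  apply: measurable_bounded_integrable => //.
  exists 1; split => // x x1 p _ /=; rewrite normr1; exact: ltW.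
have : (mu2 R).-integrable D (fun x => ((cst 1 x)%:E + (f x ^+ 2)%:E)%E) by exact: integrableD.
apply: le_integrable => //; first exact/measurable_EFinP.
move=> x _ /=; rewrite lee_fin [leRHS]ger0_norm; last by rewrite addr_ge0// sqr_ge0.
have := sqr_ge0 (`|f x| - 1); rewrite sqrrB real_normK ?num_real//.
by have := normr_ge0 (f x); lra.
Qed.

(** Used for the initial datum on both meshes: the cell averages add up to the full integral because
    the cells fill [Omega] up to a null set. *)
Lemma jump_complex_mass (Omega : set (R * R)) (I D : finType) F e1 e2 S X f :
  bd Omega -> open Omega -> @jump_complex R Omega I D F e1 e2 S X ->
  (mu2 R).-integrable Omega (EFin \o f) ->
  \sum_i area (F i) * ((area (F i))^-1 * \int[mu2 R]_(x in F i) f x) =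
  \int[mu2 R]_(x in Omega) f x.
Proof.
move=> bO oO jc If.
have mO : measurable (Omega : set (measurableTypeR R * measurableTypeR R)).
  exact: open_measurable2.
have mF i : measurable (F i : set (measurableTypeR R * measurableTypeR R)).
  by apply: open_measurable2; exact: jc_open jc _.
have fF i : fm (F i) by apply: (fm_open bO); [exact: jc_open jc _|exact: jc_sub jc _].
have IF i : (mu2 R).-integrable (F i) (EFin \o f).
  by apply: (integrableS mO) => //; exact: jc_sub jc _.
have -> : \sum_i area (F i) * ((area (F i))^-1 * \int[mu2 R]_(x in F i) f x) =
    \sum_i \int[mu2 R]_(x in F i) f x.
  apply: eq_bigr => i _; have [A0|A0] := eqVneq (area (F i)) 0; last by rewrite mulVKf.
  rewrite A0 mul0r /Rintegral.
  have muF : mu2 R (F i) = 0 by rewrite fm_area// A0.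
  have := negligible_integral (mF i) (mF i) (IF i) muF.
  by rewrite setDv integral_set0 => ->.
have mU : measurable (\bigcup_i F i : set (measurableTypeR R * measurableTypeR R)).
  by apply: open_measurable2; apply: bigcup_open => i _; exact: jc_open jc _.
have UE : \big[setU/set0]_(i <- index_enum I) F i = \bigcup_i F i.
  by rewrite -bigcup_seq; apply: eq_bigcupl; split => i // _ /=; rewrite mem_index_enum.
have UO : \bigcup_i F i `<=` Omega by move=> p [i _]; apply: (jc_sub jc).
rewrite /Rintegral sum_fine; last by move=> i _; apply: integrable_fin_num.
congr fine.
rewrite -(@integral_bigsetU_EFin _ _ _ (mu2 R) I F f (index_enum I)) ?index_enum_uniq//; first last.
- rewrite UE; apply: measurable_funS mO UO _; apply/measurable_EFinP.
  exact: integrable_measurable.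
- by move=> i j _ _ [p [Fi Fj]]; exact: jc_disj jc _ _ _ Fi Fj.
rewrite UE.
have mN : measurable (Omega `\` \bigcup_i F i : set (measurableTypeR R * measurableTypeR R)).
  exact: measurableD.
rewrite (negligible_integral mN mO If); first by rewrite setDD setIidr.
by apply: (iffLR (negligibleP _ mN)); exact: jc_null jc.
Qed.

End Integrals.

(** * Lengths, areas and coercivity on diamonds *)

Section DiamondArea.
Variables (R : realType) (Omega : set (R * R)) (T : mesh R).
Hypotheses (oO : open Omega) (bO : bd Omega) (M : ddfv_mesh Omega T).
Implicit Types (d : diam T).

(** Up to sign, the product of the diagonals and of the sine of their angle, that is, twice the
    geometric area of the diamond. *)
Definition diag_crs d : R := crs (xLs d - xKs d) (xL d - xK d).

Lemma diag_crs_neq0 d : diag_crs d != 0.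
Proof. by have [? [? []]] := diamond_cross M d. Qed.

Lemma fm_diamond d : fm (diamond d).
Proof. by apply: (fm_open bO); [exact: diam_open|exact: diam_sub M d]. Qed.

Lemma vertex_crs d : exists2 th : R, 0 < th < 1 &
  `|crs (xK d - xKs d) (xL d - xKs d)| = th * `|diag_crs d| /\
  `|crs (xK d - xLs d) (xL d - xLs d)| = (1 - th) * `|diag_crs d|.
Proof.
have [th [q [/andP[th0 th1] _ E _ _]]] := diamond_cross M d.
have KE : xKs d = xK d + q *: (xL d - xK d) - th *: (xLs d - xKs d).
  by rewrite -E; apply: pairE => /=; rewrite !scaleE; ring.
exists th; first by rewrite th0.
have e1 : crs (xK d - xKs d) (xL d - xKs d) = th * diag_crs d.
  rewrite {1 2}KE; rewrite /diag_crs /crs /= !scaleE; ring.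
have e2 : crs (xK d - xLs d) (xL d - xLs d) = - ((1 - th) * diag_crs d).
  have -> : crs (xK d - xLs d) (xL d - xLs d) = crs (xK d - xKs d) (xL d - xKs d) - diag_crs d.
    by rewrite /diag_crs /crs /=; ring.
  by rewrite e1; ring.
have th1' : 0 < 1 - th by rewrite subr_gt0.
by rewrite e1 e2 normrN !normrM (gtr0_norm th0) (gtr0_norm th1').
Qed.

Lemma area_diamond_le d : area (diamond d) <= 2 * `|diag_crs d|.
Proof.
have [th _ [e1 e2]] := vertex_crs d.
apply: (@le_trans _ _ (area (tri_s (dKs d) d `|` tri_s (dLs d) d))).
  apply: area_le; [|by case: (fm_diamond d)|exact: diam_tri_s M d].
  by apply: fm_setU; exact: fm_triangle.
apply: (le_trans (area_setU_le _ _)); try exact: fm_triangle.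
have h1 := area_triangle_le (xKs d) (xK d) (xL d).
have h2 := area_triangle_le (xLs d) (xK d) (xL d).
apply: (le_trans (lerD h1 h2)).
by rewrite e1 e2 -mulrDr -mulrDl [th + _]addrC subrK mul1r.
Qed.

(** The cross products of the two dual triangles add up to that of the diagonals, and each is at
    most 16 times the area of the diamond. *)
Lemma diag_crs_le d : `|diag_crs d| <= 32 * area (diamond d).
Proof.
have [th _ [e1 e2]] := vertex_crs d.
have sub s : has_vertex s d -> area (tri_s s d)° <= area (diamond d).
  move=> sd; rewrite -(cap_s M sd).1; apply: area_le; [exact: fm_diamond| |exact: subIsetl].
  by apply: open_measurable2; apply: openI; exact: open_interior.
have h1 := area_triangle_ge (xKs d) (xK d) (xL d).
have h2 := area_triangle_ge (xLs d) (xK d) (xL d).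
have h3 : area (triangle (xKs d) (xK d) (xL d))° <= area (diamond d) := sub _ (vertex_Ks d).
have h4 : area (triangle (xLs d) (xK d) (xL d))° <= area (diamond d) := sub _ (vertex_Ls d).
move: h1 h2 h3 h4; rewrite e1 e2; move: (area (diamond d)) (area _) (area _) `|_| => m a b D.
lra.
Qed.

Lemma enorm_sqr (v : R * R) : enorm v ^+ 2 = v.1 ^+ 2 + v.2 ^+ 2.
Proof. by rewrite /enorm sqr_sqrtr /dot -!expr2// addr_ge0// sqr_ge0. Qed.

Lemma enorm_gt0 (v : R * R) : v != 0 -> 0 < enorm v.
Proof.
move=> v0; rewrite /enorm sqrtr_gt0 /dot -!expr2 lt_neqAle addr_ge0 ?sqr_ge0// andbT eq_sym.
apply: contra v0; rewrite paddr_eq0 ?sqr_ge0// !sqrf_eq0 => /andP[/eqP e1 /eqP e2].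
by apply/eqP/pairE.
Qed.

Lemma m_sigma_gt0 d : 0 < m_sigma d.
Proof. by apply: enorm_gt0; rewrite subr_eq0; exact: xKs_neq_xLs M d. Qed.

Lemma m_sigmas_gt0 d : 0 < m_sigmas d.
Proof. by apply: enorm_gt0; rewrite subr_eq0; exact: xL_xK M d. Qed.

Lemma dot_crs (v w : R * R) : dot v w ^+ 2 + crs v w ^+ 2 = enorm v ^+ 2 * enorm w ^+ 2.
Proof. by rewrite !enorm_sqr /dot /crs; ring. Qed.

(** The cosine is a normalised dot product, so Lagrange's identity makes the sine a normalised cross
    product. *)
Lemma sin_alpha d : sin (alphaD d) = `|diag_crs d| / (m_sigma d * m_sigmas d).
Proof.
have s0 := m_sigma_gt0 d; have t0 := m_sigmas_gt0 d.
rewrite /alphaD /line_angle -/(m_sigma d) -/(m_sigmas d).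
set x := `|_| / _.
have P0 : 0 < m_sigmas d * m_sigma d by exact: mulr_gt0.
have x2 : x ^+ 2 = 1 - (`|diag_crs d| / (m_sigma d * m_sigmas d)) ^+ 2.
  have := dot_crs (xL d - xK d) (xLs d - xKs d); rewrite -/(m_sigma d) -/(m_sigmas d).
  have -> : crs (xL d - xK d) (xLs d - xKs d) ^+ 2 = diag_crs d ^+ 2.
    by rewrite /diag_crs crsN sqrrN.
  move=> h; rewrite /x !expr_div_n !real_normK ?num_real//.
  have -> : dot (xL d - xK d) (xLs d - xKs d) ^+ 2 = (m_sigmas d * m_sigma d) ^+ 2 - diag_crs d ^+ 2.
    by rewrite exprMn -h; ring.
  by field; rewrite !gt_eqF.
have x0 : 0 <= x by rewrite divr_ge0// ltW.
have q0 : 0 <= `|diag_crs d| / (m_sigma d * m_sigmas d) by rewrite divr_ge0// mulr_ge0 ?ltW.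
have x1 : x <= 1.
  rewrite -(@ler_pXn2r _ 2%N) ?nnegrE// x2 expr1n.
  by have := sqr_ge0 (`|diag_crs d| / (m_sigma d * m_sigmas d)); lra.
rewrite sin_acos; last by apply/andP; split => //; lra.
by rewrite x2 opprB addrC subrK sqrtr_sqr ger0_norm.
Qed.

Variable Theta : R.
Hypotheses (reg : mesh_regularity T Theta) (Theta1 : 1 <= Theta).

Lemma diag_lengths d : m_sigma d ^+ 2 + m_sigmas d ^+ 2 <= 2 * Theta * `|diag_crs d|.
Proof.
have s0 := m_sigma_gt0 d; have t0 := m_sigmas_gt0 d.
have D0 : 0 < `|diag_crs d| by rewrite normr_gt0; exact: diag_crs_neq0.
have [+ _ _] := reg d; rewrite sin_alpha.
have -> : 1 / (2 * (`|diag_crs d| / (m_sigma d * m_sigmas d))) *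
   (m_sigma d / m_sigmas d + m_sigmas d / m_sigma d) =
   (m_sigma d ^+ 2 + m_sigmas d ^+ 2) / (2 * `|diag_crs d|).
  by field; rewrite !gt_eqF.
by rewrite ler_pdivrMr; [move=> h; lra|exact: mulr_gt0].
Qed.

Let cap_fm (A : set (R * R)) d : open A -> fm (diamond d `&` A).
Proof.
move=> oA; apply: (fm_sub (fm_diamond d)); last exact: subIsetl.
by apply: open_measurable2; apply: openI => //; exact: diam_open.
Qed.

(** One factor [Theta] is already in the length bound, a second one passes from the diamond to its
    part in the cell; 64 is twice the 32 of [diag_crs_le]. *)
Let len_cap d (A : set (R * R)) (l : R) : l <= 2 * Theta * `|diag_crs d| ->
  area (diamond d) <= Theta * area (diamond d `&` A) ->
  l <= 64 * Theta ^+ 2 * area (diamond d `&` A).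
Proof.
move=> h1 h2; have h3 := diag_crs_le d.
have T0 : 0 <= Theta by exact: le_trans ler01 Theta1.
have := ler_wpM2l T0 h2; have := ler_wpM2l T0 h3; rewrite expr2.
by move: h1; move: (area (diamond d)) (area _) `|_| => a b c; lra.
Qed.

Lemma m_sigma_cap d K : edge_of K d ->
  m_sigma d ^+ 2 <= 64 * Theta ^+ 2 * area (diamond d `&` cell K).
Proof.
move=> Kd; have [_ + _] := reg d; move=> /(_ K) rg.
apply: len_cap; first by have := diag_lengths d; have := sqr_ge0 (m_sigmas d); move: (_ ^+ 2) (_ ^+ 2) `|_| => a b c; lra.
apply: rg; have [cE ne] := cap_K M Kd; rewrite -cE in ne; apply: open_area_gt0 ne.
  by apply: cap_fm; exact: cell_open M K.
by apply: openI; [exact: diam_open|exact: cell_open M K].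
Qed.

Lemma m_sigmas_cap d s : has_vertex s d ->
  m_sigmas d ^+ 2 <= 64 * Theta ^+ 2 * area (diamond d `&` dual_cell s).
Proof.
move=> sd; have [_ _ +] := reg d; move=> /(_ s) rg.
apply: len_cap; first by have := diag_lengths d; have := sqr_ge0 (m_sigma d); move: (_ ^+ 2) (_ ^+ 2) `|_| => a b c; lra.
apply: rg; have [cE ne] := cap_s M sd; rewrite -cE in ne; apply: open_area_gt0 ne.
  by apply: cap_fm; exact: dual_open.
by apply: openI; [exact: diam_open|exact: dual_open].
Qed.

Lemma sum_area_cap (A : set (R * R)) : open A -> A `<=` Omega ->
  \sum_(d : diam T) area (diamond d `&` A) <= area A.
Proof.
move=> oA AO.
have := @area_sum_le R (diam T) 'I_1 (fun=> 1) (fun d => diamond d `&` A) (fun=> 1) (fun=> A)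
  set0 (fun=> ler01) (fun=> ler01) (fun d => cap_fm d oA) (fun=> fm_open bO oA AO)
  (negligible_set0 _).
rewrite big_ord1 mul1r; under eq_bigr do rewrite mul1r.
apply => p _; rewrite big_ord1 mul1r.
have [[d dp]|nd] := pselect (exists d, (diamond d `&` A) p); last first.
  by rewrite big1// => d _; rewrite indicE memNset ?mulr0// => dp; apply: nd; exists d.
rewrite (bigD1 d)//= big1 ?addr0; last first.
  move=> d' dd; rewrite indicE memNset ?mulr0// => -[dp' _].
  by move/eqP: dd; apply; apply: (diam_disj M dp'); case: dp.
by rewrite !indicE mem_set// mem_set ?mul1r//; case: dp.
Qed.

Lemma sum_cap_weight (I : finType) (F : I -> set (R * R)) (e : diam T -> I) (w : I -> R) :
  (forall i, open (F i)) -> (forall i, F i `<=` Omega) -> (forall i, 0 <= w i) ->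
  \sum_d area (diamond d `&` F (e d)) * w (e d) <= \sum_i area (F i) * w i.
Proof.
move=> oF FO w0.
apply: (@le_trans _ _ (\sum_d \sum_i area (diamond d `&` F i) * w i)).
  apply: ler_sum => d _; rewrite (bigD1 (e d))//= lerDl.
  by apply: sumr_ge0 => i _; rewrite mulr_ge0// area_ge0.
rewrite exchange_big /=; apply: ler_sum => i _; rewrite -mulr_suml.
by apply: ler_wpM2r => //; exact: sum_area_cap.
Qed.

Lemma max_le_sum (l a1 a2 w1 w2 c : R) : 0 <= l -> 0 <= w1 -> 0 <= w2 ->
  l <= c * a1 -> l <= c * a2 -> l * Num.max w1 w2 <= c * (a1 * w1 + a2 * w2).
Proof.
move=> l0 w10 w20 h1 h2.
have := ler_wpM2r w10 h1; have := ler_wpM2r w20 h2.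
have := mulr_ge0 l0 w10; have := mulr_ge0 l0 w20.
by case: (leP w1 w2) => _; lra.
Qed.

(** This supplies the weight hypothesis of [discrete_log_sobolev]. The maximum is bounded by the sum
    over the two ends, each contributing 64. A boundary diamond counts its interior cell twice. *)
Lemma primal_weight (w : primal T -> R) : (forall K, 0 <= w K) ->
  \sum_d m_sigma d ^+ 2 * Num.max (w (dK d)) (w (primal_right d)) <=
  128 * Theta ^+ 2 * \sum_K area (cell K) * w K.
Proof.
move=> w0.
have rE d : edge_of (primal_right d) d.
  by rewrite /primal_right; case dLE : (dL d) => [L|b]; [exact: edge_L|exact: edge_K].
apply: (@le_trans _ _ (\sum_d 64 * Theta ^+ 2 * (area (diamond d `&` cell (dK d)) * w (dK d)
    + area (diamond d `&` cell (primal_right d)) * w (primal_right d)))).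
  apply: ler_sum => d _; apply: max_le_sum => //; first exact: sqr_ge0.
    by apply: m_sigma_cap; exact: edge_K.
  exact: m_sigma_cap.
rewrite -mulr_sumr big_split /=.
have h e := @sum_cap_weight _ (@cell R T) e w (@cell_open _ _ _ M) (@cell_sub _ _ _ M) w0.
have T0 : 0 <= 64 * Theta ^+ 2 by rewrite mulr_ge0// sqr_ge0.
have := lerD (h (@dK R T)) (h (@primal_right R T)) => /(ler_wpM2l T0) /le_trans; apply.
by rewrite le_eqVlt; apply/orP; left; apply/eqP; ring.
Qed.

Hypothesis pO : polygonal Omega.

Lemma dual_weight (w : vertex T -> R) : (forall s, 0 <= w s) ->
  \sum_d m_sigmas d ^+ 2 * Num.max (w (dKs d)) (w (dLs d)) <=
  128 * Theta ^+ 2 * \sum_s area (dual_cell s) * w s.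
Proof.
move=> w0.
apply: (@le_trans _ _ (\sum_d 64 * Theta ^+ 2 * (area (diamond d `&` dual_cell (dKs d)) * w (dKs d)
    + area (diamond d `&` dual_cell (dLs d)) * w (dLs d)))).
  apply: ler_sum => d _; apply: max_le_sum => //; first exact: sqr_ge0.
    by apply: m_sigmas_cap; exact: vertex_Ks.
  by apply: m_sigmas_cap; exact: vertex_Ls.
rewrite -mulr_sumr big_split /=.
have h e := @sum_cap_weight _ (@dual_cell R T) e w (@dual_open _ T) (dual_sub pO M) w0.
have T0 : 0 <= 64 * Theta ^+ 2 by rewrite mulr_ge0// sqr_ge0.
have := lerD (h (@dKs R T)) (h (@dLs R T)) => /(ler_wpM2l T0) /le_trans; apply.
by rewrite le_eqVlt; apply/orP; left; apply/eqP; ring.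
Qed.

Variables (Lambda : R * R -> 'M[R]_2) (lm lM : R).
Hypotheses (ani : anisotropy_tensor Omega lm lM Lambda) (lm0 : 0 < lm).

Let Lambda_integrable d i j : (mu2 R).-integrable (diamond d) (EFin \o (fun x => Lambda x i j)).
Proof.
case: ani => eb _ _; apply: (ess_bounded_integrable (E := Omega)) (eb i j).
- exact: fm_diamond.
- exact: open_measurable2.
- exact: diam_sub M d.
Qed.

Let area_diamond_gt0 d : 0 < area (diamond d).
Proof.
have D0 : 0 < `|diag_crs d| by rewrite normr_gt0; exact: diag_crs_neq0.
have := diag_crs_le d; move: D0; move: (area _) `|_| => a b; lra.
Qed.

Lemma LambdaD_sym d : LambdaD Lambda d 0 1 = LambdaD Lambda d 1 0.
Proof.
rewrite !mxE; congr (_ * _); apply: ae_eq_Rintegral => //; first exact: fm_diamond.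
case: ani => _ sym _; apply: (ae_imp sym) => x /= h Dx.
by have /matrixP/(_ 1 0) := h (diam_sub M Dx); rewrite mxE.
Qed.

(** The pointwise ellipticity is integrated over the diamond; [q'] spells the quadratic form out
    entry by entry so that linearity of the integral applies. *)
Lemma LambdaD_coercive d (v : R * R) :
  lm * (v.1 ^+ 2 + v.2 ^+ 2) <= dot (mxapp (LambdaD Lambda d) v) v.
Proof.
have Ic c i j : (mu2 R).-integrable (diamond d) (EFin \o (fun x => c * Lambda x i j)).
  have /= := integrableZl _ c (Lambda_integrable d i j).
  by move=> H; apply: H; case: (fm_diamond d).
have [mD D1] := fm_diamond d.
have Icst c : (mu2 R).-integrable (diamond d) (EFin \o (cst c : R * R -> R)).
  apply: measurable_bounded_integrable => //.
  exists `|c|; split => // x x1 p _ /=; exact: ltW.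
have ID (f g : R * R -> R) : (mu2 R).-integrable (diamond d) (EFin \o f) ->
    (mu2 R).-integrable (diamond d) (EFin \o g) ->
    (mu2 R).-integrable (diamond d) (EFin \o (fun x => f x + g x)).
  by move=> If Ig; have := integrableD mD If Ig.
pose q x := dot (mxapp (Lambda x) v) v - lm * (v.1 ^+ 2 + v.2 ^+ 2).
pose q' x := v.1 ^+ 2 * Lambda x 0 0 + (v.1 * v.2 * Lambda x 0 1 +
   (v.1 * v.2 * Lambda x 1 0 + (v.2 ^+ 2 * Lambda x 1 1 + cst (- (lm * (v.1 ^+ 2 + v.2 ^+ 2))) x))).
have qq x : q x = q' x by rewrite /q /q' /dot /mxapp /=; ring.
have I4 := ID _ _ (Ic (v.2 ^+ 2) 1 1) (Icst (- (lm * (v.1 ^+ 2 + v.2 ^+ 2)))).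
have I3 := ID _ _ (Ic (v.1 * v.2) 1 0) I4.
have I2 := ID _ _ (Ic (v.1 * v.2) 0 1) I3.
have I1 := ID _ _ (Ic (v.1 ^+ 2) 0 0) I2.
have Iq : (mu2 R).-integrable (diamond d) (EFin \o q').
  exact: I1.
have q0 : 0 <= \int[mu2 R]_(x in diamond d) q' x.
  apply: ae_Rintegral_ge0 => //.
  case: ani => _ _ ell; apply: (ae_imp ell) => x /= h Dx.
  rewrite -qq /q subr_ge0 -enorm_sqr.
  by have /andP[] := h (diam_sub M Dx) v.
have qE : \int[mu2 R]_(x in diamond d) q' x = area (diamond d) *
    (dot (mxapp (LambdaD Lambda d) v) v - lm * (v.1 ^+ 2 + v.2 ^+ 2)).
  rewrite /q' (RintegralD mD (Ic _ _ _) I2) (RintegralD mD (Ic _ _ _) I3).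
  rewrite (RintegralD mD (Ic _ _ _) I4) (RintegralD mD (Ic _ _ _) (Icst _)).
  rewrite !(RintegralZl _ mD (Lambda_integrable d _ _)).
  rewrite /cst Rintegral_cst// -/(area (diamond d)) /dot /mxapp /= !mxE.
  have := area_diamond_gt0 d; move: (area (diamond d)) => a a0.
  by field; rewrite gt_eqF.
by move: q0; rewrite qE pmulr_rge0 ?area_diamond_gt0// subr_ge0.
Qed.

(** Times the length, the normal is the edge vector turned by a right angle, up to a sign of which
    only the square enters the coercivity. *)
Lemma normal_away_sign (a b p : R * R) : crs (a - p) (b - a) != 0 -> a != b ->
  exists2 e : R, e ^+ 2 = 1 &
    enorm (b - a) *: normal_away a b p = e *: (- (b - a).2, (b - a).1).
Proof.
move=> c0 ab; exists (Num.sg (dot (- (b - a).2, (b - a).1) (a - p))).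
  rewrite sqr_sg (_ : dot _ _ = - crs (a - p) (b - a)) ?oppr_eq0 ?c0//.
  by rewrite /dot /crs /=; ring.
have n0 : enorm (b - a) != 0 by rewrite gt_eqF// enorm_gt0// subr_eq0 eq_sym.
rewrite /normal_away scalerA; congr (_ *: _).
by rewrite mulrC divfK.
Qed.

(** The cross product of [x e + y v] with [v] is [x * crs e v], and with [e] it is [- y * crs e v];
    Lagrange's identity bounds both. *)
Lemma combination_ge (e v : R * R) (x y : R) :
  x ^+ 2 * crs e v ^+ 2 <= ((x * e.1 + y * v.1) ^+ 2 + (x * e.2 + y * v.2) ^+ 2) * enorm v ^+ 2 /\
  y ^+ 2 * crs e v ^+ 2 <= ((x * e.1 + y * v.1) ^+ 2 + (x * e.2 + y * v.2) ^+ 2) * enorm e ^+ 2.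
Proof.
rewrite !enorm_sqr /crs; split; rewrite -subr_ge0.
  have -> : ((x * e.1 + y * v.1) ^+ 2 + (x * e.2 + y * v.2) ^+ 2) * (v.1 ^+ 2 + v.2 ^+ 2) -
    x ^+ 2 * (e.1 * v.2 - e.2 * v.1) ^+ 2 =
    ((x * e.1 + y * v.1) * v.1 + (x * e.2 + y * v.2) * v.2) ^+ 2 by ring.
  exact: sqr_ge0.
have -> : ((x * e.1 + y * v.1) ^+ 2 + (x * e.2 + y * v.2) ^+ 2) * (e.1 ^+ 2 + e.2 ^+ 2) -
    y ^+ 2 * (e.1 * v.2 - e.2 * v.1) ^+ 2 =
    ((x * e.1 + y * v.1) * e.1 + (x * e.2 + y * v.2) * e.2) ^+ 2 by ring.
exact: sqr_ge0.
Qed.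

Lemma AD_quadratic d (x y : R) (w := (x * m_sigma d) *: n_sigmaK d + (y * m_sigmas d) *: n_sigmasKs d) :
  dot (x, y) (mxapp (AD Lambda d) (x, y)) =
  (4 * area (diamond d))^-1 * dot (mxapp (LambdaD Lambda d) w) w.
Proof.
have sym := LambdaD_sym d; have m0 := area_diamond_gt0 d.
rewrite /w /AD; move: sym m0.
move: (LambdaD Lambda d) (area (diamond d)) (n_sigmaK d) (n_sigmasKs d) (m_sigma d) (m_sigmas d).
move=> L m [n1 n2] [k1 k2] p q sym m0; rewrite /dot /mxapp /mx22 !mxE /= !scaleE sym.
by field; rewrite gt_eqF.
Qed.

Lemma coercivity_arithmetic (X Y W De Th p q : R) :
  0 < De -> 0 <= W -> X * De ^+ 2 <= W * q -> Y * De ^+ 2 <= W * p ->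
  p + q <= 2 * Th * De -> De * (X + Y) <= 2 * Th * W.
Proof.
move=> De0 W0 c1 c2 /(ler_wpM2l W0) c3.
by rewrite -(ler_pM2l De0) mulrA -expr2; lra.
Qed.

(** The matrix is the form of [LambdaD] on the combination [w] of the scaled normals. By regularity
    [De * (x ^+ 2 + y ^+ 2)] is at most [2 * Theta] times the squared norm of [w], and the area is
    at most [2 * De]; with the factor $1/4$ this gives [16 * Theta], and 32 leaves room. *)
Lemma AD_coercive d (v : R * R) :
  lm / (32 * Theta) * (v.1 ^+ 2 + v.2 ^+ 2) <= dot v (mxapp (AD Lambda d) v).
Proof.
case: v => x y /=; rewrite AD_quadratic.
set w := _ *: _ + _ *: _.
have D0 := diag_crs_neq0 d.
have [s s1 sE] := @normal_away_sign (xKs d) (xLs d) (xK d)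
  ltac:(by have := tri_K_crs M (edge_K d); apply: contra => /eqP h; apply/eqP; rewrite -h /xK /crs /=; ring)
  ltac:(by rewrite eq_sym; exact: xKs_neq_xLs M d).
have [t t1 tE] := @normal_away_sign (xK d) (xL d) (xKs d)
  ltac:(by have := tri_s_crs M (vertex_Ks d); apply: contra => /eqP h; apply/eqP; rewrite -h /xKs /crs /=; ring)
  ltac:(by rewrite eq_sym; exact: xL_xK M d).
have wE : w = (x * s) *: (- (xLs d - xKs d).2, (xLs d - xKs d).1) + (y * t) *: (- (xL d - xK d).2, (xL d - xK d).1).
  rewrite /w -!scalerA; congr (_ *: _ + _ *: _); [exact: sE|exact: tE].
have := LambdaD_coercive d w; set Q := dot _ w => hQ.
have [c1 c2] := combination_ge (xLs d - xKs d) (xL d - xK d) (x * s) (y * t).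
pose W := (x * s * (xLs d - xKs d).1 + y * t * (xL d - xK d).1) ^+ 2 +
  (x * s * (xLs d - xKs d).2 + y * t * (xL d - xK d).2) ^+ 2.
rewrite -/W in c1 c2.
have W2 : w.1 ^+ 2 + w.2 ^+ 2 = W by rewrite wE /W /= !scaleE; ring.
rewrite W2 in hQ.
rewrite -/(diag_crs d) -/(m_sigmas d) exprMn s1 mulr1 in c1.
rewrite -/(diag_crs d) -/(m_sigma d) exprMn t1 mulr1 in c2.
have T0 : 0 < Theta by exact: lt_le_trans ltr01 Theta1.
have A0 := area_diamond_gt0 d.
have h1 := diag_lengths d; have h2 := area_diamond_le d.
set De := `|diag_crs d| in h1 h2.
have De0 : 0 < De by rewrite normr_gt0.
have D2 : diag_crs d ^+ 2 = De * De by rewrite /De -expr2 real_normK ?num_real.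
have W0 : 0 <= W by rewrite -W2 addr_ge0// sqr_ge0.
have key : De * (x ^+ 2 + y ^+ 2) <= 2 * Theta * W.
  rewrite D2 -expr2 in c1 c2.
  exact: (coercivity_arithmetic De0 W0 c1 c2 h1).
rewrite [leRHS]mulrC ler_pdivlMr; last by rewrite mulr_gt0.
have S0 : 0 <= x ^+ 2 + y ^+ 2 by rewrite addr_ge0// sqr_ge0.
have lmW : 0 <= lm * W by rewrite mulr_ge0// ltW.
have e1 := ler_wpM2l (ltW lm0) key.
have e2 := ler_wpM2l (ltW lm0) (ler_wpM2l S0 h2).
have e3 := ler_wpM2l (ltW T0) hQ.
have e4 := mulr_ge0 (ltW T0) lmW.
move: A0 T0 e1 e2 e3 e4.
generalize (area (diamond d)), (x ^+ 2 + y ^+ 2), De, W, Q => m Z De' W' Q' m0 {}T0 e1 e2 e3 e4.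
have -> : lm / (32 * Theta) * Z * (4 * m) = lm * (Z * m) / (8 * Theta).
  by field; rewrite gt_eqF.
by rewrite ler_pdivrMr ?mulr_gt0//; lra.
Qed.

End DiamondArea.

(** * Entropy *)

Section Entropy.
Variable R : realType.
Implicit Types (x y : R).

Lemma ln_le_sub1 x : 0 < x -> ln x <= x - 1.
Proof.
by move=> x0; have := @le_ln1Dx R (x - 1); rewrite (_ : 1 + (x - 1) = x); [apply; lra|ring].
Qed.

Lemma Phi1_le_sqr x : 0 < x -> Phi1 x <= (x - 1) ^+ 2.
Proof.
move=> x0; have := ler_wpM2l (ltW x0) (ln_le_sub1 x0).
by rewrite /Phi1 expr2; lra.
Qed.

Lemma Phi1_convex x y : 0 < x -> 0 <= y -> Phi1 x + ln x * (y - x) <= Phi1 y.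
Proof.
move=> x0; rewrite le_eqVlt => /orP[/eqP <-|y0].
  by rewrite /Phi1 mul0r; lra.
have := ler_wpM2l (ltW y0) (ln_le_sub1 (divr_gt0 x0 y0)).
rewrite ln_div ?posrE// (_ : y * (x / y - 1) = x - y); first by rewrite /Phi1; lra.
by field; rewrite gt_eqF.
Qed.

Lemma Phi1_ge0 x : 0 <= x -> 0 <= Phi1 x.
Proof.
move=> x0; have := @Phi1_convex 1 x ltr01 x0.
by rewrite ln1 mul0r addr0 /Phi1 ln1; lra.
Qed.

Lemma Cauchy_Schwarz_weighted (D : finType) (r l a : D -> R) :
  (forall d, 0 < r d) ->
  (\sum_d a d * (r d * l d)) ^+ 2 <= (\sum_d r d * l d ^+ 2) * (\sum_d a d ^+ 2 * r d).
Proof.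
move=> r0; set S := \sum_d a d * (r d * l d); set A := \sum_d _; set B := \sum_d _.
have B0 : 0 <= B by apply: sumr_ge0 => d _; rewrite mulr_ge0 ?sqr_ge0// ltW.
have [Bz|Bn] := eqVneq B 0.
  have /psumr_eq0P h : B = 0 by [].
  have a0 d : a d = 0.
    have /eqP := h (fun i _ => mulr_ge0 (sqr_ge0 (a i)) (ltW (r0 i))) d isT.
    by rewrite mulf_eq0 sqrf_eq0 (gt_eqF (r0 d)) orbF => /eqP.
  by rewrite /S big1 ?expr0n ?Bz ?mulr0// => d _; rewrite a0 mul0r.
have Bp : 0 < B by rewrite lt_neqAle eq_sym Bn.
have expand b c : \sum_d r d * (b * l d - c * a d) ^+ 2 = b ^+ 2 * A + - (2 * b * c) * S + c ^+ 2 * B.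
  by rewrite /A /S /B !mulr_sumr -!big_split /=; apply: eq_bigr => d _; ring.
have : 0 <= \sum_d r d * (B * l d - S * a d) ^+ 2.
  by apply: sumr_ge0 => d _; rewrite mulr_ge0 ?sqr_ge0// ltW.
rewrite expand (_ : _ + _ = B * (A * B - S ^+ 2)); last by ring.
by rewrite pmulr_rge0// subr_ge0.
Qed.

Lemma mean_ln (r : R -> R -> R) x y : mean_function r -> 0 < x -> 0 < y ->
  `|x - y| <= r x y * `|ln x - ln y|.
Proof.
move=> mr x0 y0; have [<-|xy] := eqVneq x y.
  by rewrite subrr normr0 mulr_ge0// ltW// (mean_gt0 mr).
have /andP[h _] := mean_bounds mr x0 y0 xy.
have l0 : ln x - ln y != 0.
  by rewrite subr_eq0; apply: contra xy => /eqP/(ln_inj x0 y0)->.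
have -> : `|x - y| = `|(x - y) / (ln x - ln y)| * `|ln x - ln y| by rewrite -normrM divfK.
apply: ler_wpM2r => //; rewrite ger0_norm//.
have [xy'|xy'] := ltP x y.
  have : ln x - ln y < 0 by rewrite subr_lt0 ltr_ln.
  by move=> h0; rewrite mulr_le0// ?invr_le0 ltW// subr_lt0.
by rewrite mulr_ge0 ?invr_ge0 ?subr_ge0// ler_ln.
Qed.

Lemma mean_le_max (r : R -> R -> R) x y : mean_function r -> 0 < x -> 0 < y ->
  r x y <= Num.max x y.
Proof.
move=> mr x0 y0; have [<-|xy] := eqVneq x y; first by rewrite (mean_diag mr)// maxxx.
by have /andP[] := mean_bounds mr x0 y0 xy.
Qed.

Variables (Omega : set (R * R)) (C c1 c2 ka : R).
Hypotheses (C0 : 0 <= C) (c10 : 0 < c1) (c20 : 0 <= c2) (ka0 : 0 <= ka).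
Hypothesis (bO : bd Omega).
Hypothesis oO : open Omega.
Hypothesis BV : forall (I D : finType) F e1 e2 S X, @jump_complex R Omega I D F e1 e2 S X ->
   forall g : I -> R, exists t,
     \sum_i (g i - t) ^+ 2 * area (F i) <= C * total_jump e1 e2 S g ^+ 2.

(** From the left: [c2] removes the weights [m], [C] is the total variation constant and [ka] the
    weight bound. The rest bounds the unweighted mass of [w], as [c1] times it is at most the
    weighted mass, itself at most [c2 * area Omega]. *)
Definition log_sobolev_const : R := c2 * (C * (ka * (c2 / c1 * area Omega))).

Lemma discrete_log_sobolev (I D : finType) F e1 e2 S X (m w : I -> R) (r : R -> R -> R) :
  @jump_complex R Omega I D F e1 e2 S X ->
  (forall i, c1 <= m i <= c2) -> (forall i, 0 < w i) ->
  (forall v : I -> R, (forall i, 0 <= v i) ->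
     \sum_d enorm ((S d).2 - (S d).1) ^+ 2 * Num.max (v (e1 d)) (v (e2 d))
       <= ka * \sum_i area (F i) * v i) ->
  \sum_i area (F i) * (m i * w i) = \sum_i area (F i) * m i ->
  mean_function r ->
  \sum_i area (F i) * (m i * Phi1 (w i)) <=
  log_sobolev_const * \sum_d r (w (e1 d)) (w (e2 d)) * (ln (w (e1 d)) - ln (w (e2 d))) ^+ 2.
Proof.
move=> jc m12 w0 wt ms mr.
have a0 i : 0 <= area (F i) by exact: area_ge0.
have mpos i : 0 < m i by have /andP[h _] := m12 i; exact: lt_le_trans h.
have areaE : \sum_i area (F i) = area Omega.
  have := jump_complex_area bO jc oO (@subset_refl _ Omega); move=> <-; apply: eq_bigr => i _.
  by congr area; apply/esym/setIidl; exact: jc_sub jc _.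
have [t ht] := BV jc w.
set E := \sum_d r _ _ * _ ^+ 2.
have rp d : 0 < r (w (e1 d)) (w (e2 d)) by rewrite (mean_gt0 mr).
have E0 : 0 <= E by apply: sumr_ge0 => d _; rewrite mulr_ge0 ?sqr_ge0// ltW.
have h1 : \sum_i area (F i) * (m i * Phi1 (w i)) <= \sum_i area (F i) * (m i * (w i - t) ^+ 2).
  apply: (@le_trans _ _ (\sum_i area (F i) * (m i * (w i - 1) ^+ 2))).
    apply: ler_sum => i _; apply: ler_wpM2l => //; apply: ler_wpM2l; first exact: ltW.
    exact: Phi1_le_sqr.
  have -> : \sum_i area (F i) * (m i * (w i - t) ^+ 2) =
      \sum_i area (F i) * (m i * (w i - 1) ^+ 2) +
      2 * (1 - t) * (\sum_i area (F i) * (m i * w i) - \sum_i area (F i) * m i) +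
      (1 - t) ^+ 2 * \sum_i area (F i) * m i.
    rewrite mulrBr !mulr_sumr -sumrB -!big_split /=; apply: eq_bigr => i _; ring.
  rewrite ms subrr mulr0 addr0 lerDl mulr_ge0 ?sqr_ge0//.
  by apply: sumr_ge0 => i _; rewrite mulr_ge0// ltW.
apply: (le_trans h1).
have h2 : \sum_i area (F i) * (m i * (w i - t) ^+ 2) <= c2 * \sum_i (w i - t) ^+ 2 * area (F i).
  rewrite mulr_sumr; apply: ler_sum => i _; rewrite mulrC -mulrA.
  apply: ler_wpM2r; first by rewrite mulr_ge0// sqr_ge0.
  by case/andP: (m12 i).
apply: (le_trans h2); rewrite /log_sobolev_const -mulrA; apply: ler_wpM2l => //.
apply: (le_trans ht); rewrite -mulrA; apply: ler_wpM2l => //.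
have T0 : 0 <= total_jump e1 e2 S w by apply: sumr_ge0 => d _; rewrite mulr_ge0// enorm_ge0.
have Tle : total_jump e1 e2 S w <= \sum_d enorm ((S d).2 - (S d).1) *
    (r (w (e1 d)) (w (e2 d)) * `|ln (w (e1 d)) - ln (w (e2 d))|).
  apply: ler_sum => d _; apply: ler_wpM2l; first exact: enorm_ge0.
  exact: mean_ln.
apply: (@le_trans _ _ ((\sum_d enorm ((S d).2 - (S d).1) *
    (r (w (e1 d)) (w (e2 d)) * `|ln (w (e1 d)) - ln (w (e2 d))|)) ^+ 2)).
  by rewrite ler_pXn2r// nnegrE (le_trans T0).
apply: (le_trans (Cauchy_Schwarz_weighted _ _ _)); first exact: rp.
have -> : \sum_d r (w (e1 d)) (w (e2 d)) * `|ln (w (e1 d)) - ln (w (e2 d))| ^+ 2 = E.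
  by apply: eq_bigr => d _; rewrite real_normK ?num_real.
rewrite [leRHS]mulrC; apply: ler_wpM2l => //.
apply: (@le_trans _ _ (\sum_d enorm ((S d).2 - (S d).1) ^+ 2 * Num.max (w (e1 d)) (w (e2 d)))).
  by apply: ler_sum => d _; apply: ler_wpM2l; [exact: sqr_ge0|exact: mean_le_max].
apply: (le_trans (wt _ (fun i => ltW (w0 i)))); apply: ler_wpM2l => //.
rewrite mulrAC ler_pdivlMr// -areaE mulr_sumr.
apply: (@le_trans _ _ (\sum_i area (F i) * (m i * w i))).
  rewrite mulr_suml; apply: ler_sum => i _; rewrite -mulrA; apply: ler_wpM2l => //.
  by rewrite mulrC; apply: ler_wpM2r; [exact: ltW|case/andP: (m12 i)].
rewrite ms; apply: ler_sum => i _; rewrite mulrC; apply: ler_wpM2r => //.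
by case/andP: (m12 i).
Qed.

Lemma log_sobolev_const_ge0 : 0 <= log_sobolev_const.
Proof.
have c1' := ltW c10; have AO := area_ge0 Omega.
by rewrite /log_sobolev_const !mulr_ge0// invr_ge0.
Qed.

(** Homogeneity and monotonicity of [r] turn the means of [w] into means of [a], since
    [c1 * rho * w i <= a i]. The normalisation [rho] cancels, and the price is the factor
    [1 / c1]. *)
Lemma entropy_dissipation (I D : finType) F e1 e2 S X (m a : I -> R) (r : R -> R -> R) (rho : R) :
  @jump_complex R Omega I D F e1 e2 S X ->
  (forall i, c1 <= m i <= c2) -> (forall i, 0 < a i) -> 0 < rho ->
  (forall v : I -> R, (forall i, 0 <= v i) ->
     \sum_d enorm ((S d).2 - (S d).1) ^+ 2 * Num.max (v (e1 d)) (v (e2 d))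
       <= ka * \sum_i area (F i) * v i) ->
  \sum_i area (F i) * a i = \sum_i area (F i) * (rho * m i) ->
  mean_function r ->
  \sum_i area (F i) * (rho * m i * Phi1 (a i / (rho * m i))) <=
  log_sobolev_const / c1 * \sum_d r (a (e1 d)) (a (e2 d)) *
    (ln (a (e1 d) / (rho * m (e1 d))) - ln (a (e2 d) / (rho * m (e2 d)))) ^+ 2.
Proof.
move=> jc m12 a0 rho0 wt ms mr.
have m0 i : 0 < m i by have /andP[h _] := m12 i; exact: lt_le_trans h.
pose w i := a i / (rho * m i).
have w0 i : 0 < w i by rewrite divr_gt0// mulr_gt0.
have aE i : a i = rho * m i * w i by rewrite /w mulrC divfK// gt_eqF// mulr_gt0.
have msw : \sum_i area (F i) * (m i * w i) = \sum_i area (F i) * m i.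
  apply: (mulfI (lt0r_neq0 rho0)); rewrite !mulr_sumr.
  have -> : \sum_i rho * (area (F i) * (m i * w i)) = \sum_i area (F i) * a i.
    by apply: eq_bigr => i _; rewrite aE; ring.
  by rewrite ms; apply: eq_bigr => i _; rewrite mulrCA.
have := ler_wpM2l (ltW rho0) (discrete_log_sobolev jc m12 w0 wt msw mr).
have <- : \sum_i area (F i) * (rho * m i * Phi1 (w i)) =
    rho * \sum_i area (F i) * (m i * Phi1 (w i)).
  by rewrite mulr_sumr; apply: eq_bigr => i _; ring.
move=> h.
apply: (le_trans h).
have L0 := log_sobolev_const_ge0.
rewrite mulrCA -mulrA; apply: ler_wpM2l => //.
rewrite [leRHS]mulrC ler_pdivlMr// mulrAC (mulrC rho) mulr_sumr; apply: ler_sum => d _.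
rewrite mulrA; apply: ler_wpM2r; first exact: sqr_ge0.
have q0 : 0 < c1 * rho by rewrite mulr_gt0.
have le i : c1 * rho * w i <= a i.
  rewrite aE; apply: ler_wpM2r; first exact: ltW.
  by rewrite mulrC; apply: ler_wpM2l; [exact: ltW|case/andP: (m12 i)].
by rewrite -(mean_homog mr)//; apply: (mean_le mr) => //; exact: mulr_gt0.
Qed.

(** Concavity of [ln]: [1 + nu * dt] is the convex combination of [1 + nu * k] and 1 with weight
    [dt / k]. *)
Lemma power_decay (nu dt k : R) (n : nat) : 0 < nu -> 0 < dt -> 0 < k -> dt <= k ->
  (1 + nu * dt) ^- n <= expR (- (ln (1 + nu * k) / k) * (n%:R * dt)).
Proof.
move=> nu0 dt0 k0 dtk.
have p1 : 0 < 1 + nu * dt by rewrite addr_gt0// mulr_gt0.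
have p2 : 0 < 1 + nu * k by rewrite addr_gt0// mulr_gt0.
have key : dt / k * ln (1 + nu * k) <= ln (1 + nu * dt).
  have tangent y : 0 < y -> ln y - ln (1 + nu * dt) <= y / (1 + nu * dt) - 1.
    by move=> y0; rewrite -ln_div ?posrE//; apply: ln_le_sub1; exact: divr_gt0.
  have t0 : 0 <= dt / k by rewrite divr_ge0// ltW.
  have t1 : 0 <= 1 - dt / k by rewrite subr_ge0 ler_pdivrMr// mul1r.
  have := lerD (ler_wpM2l t0 (tangent _ p2)) (ler_wpM2l t1 (tangent _ ltr01)).
  rewrite ln1 (_ : dt / k * ((1 + nu * k) / (1 + nu * dt) - 1) + _ = 0); first by lra.
  by field; rewrite !gt_eqF.
rewrite -[leLHS]lnK ?posrE ?invr_gt0 ?exprn_gt0// ler_expR lnV ?posrE ?exprn_gt0// lnXn//.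
rewrite !mulNr lerN2 -[leRHS]mulr_natl.
have -> : ln (1 + nu * k) / k * (n%:R * dt) = n%:R * (dt / k * ln (1 + nu * k)) by field; rewrite gt_eqF.
exact: ler_wpM2l.
Qed.

End Entropy.

(** * The scheme *)

Section Potential.
Variables (R : realType) (Omega : set (R * R)).
Hypotheses (oO : open Omega) (pO : polygonal Omega) (bO : bd Omega).

Lemma bd_compact_closure : compact (closure Omega).
Proof.
case: bO => B OB.
have cQ : compact (`[- B, B]%classic `*` `[- B, B]%classic : set (R * R)).
  by apply: compact_setX; exact: segment_compact.
apply: (subclosed_compact _ cQ); first exact: closed_closure.
have QE : closed (`[- B, B]%classic `*` `[- B, B]%classic : set (R * R)).
  by apply: compact_closed => //; exact: norm_hausdorff.
rewrite [X in _ `<=` X](iffLR (closure_id _) QE); apply: closureS => p /OB[].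
by rewrite !ler_norml => h1 h2; split; rewrite /= in_itv.
Qed.

Lemma bounded_on_closure (V : R * R -> R) : {within closure Omega, continuous V} ->
  exists2 B, 0 <= B & forall x, closure Omega x -> `|V x| <= B.
Proof.
move=> cV; have := compact_bounded (continuous_compact cV bd_compact_closure).
move=> /pinfty_ex_gt0[B B0 h]; exists B; first exact: ltW.
by move=> x Ox; apply: h; exists x.
Qed.

Variable T : mesh R.
Hypothesis M : ddfv_mesh Omega T.

Lemma pcenter_closure (K : primal T) : closure Omega (pcenter K).
Proof.
case: (primal_partition M) => /(_ K)[_ [z Kz]] _ _ _.
have [d Kd _] := cell_tri M Kz.
apply: (closureS (@cell_sub _ _ _ M K)).
have : tri_K K d (pcenter K).
  by exists (0, 0); rewrite /= ?scale0r ?addr0//; split; rewrite ?addr0.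
rewrite -(tri_K_closure M Kd) -(cap_K M Kd).1; apply: closureS.
by move=> p [].
Qed.

Lemma vert_closure (s : vertex T) : closure Omega (vert s).
Proof.
have [d sd] := vertex_of_edge M s.
apply: (tri_s_sub M sd).
by exists (0, 0); rewrite /= ?scale0r ?addr0//; split; rewrite ?addr0.
Qed.

End Potential.

(** * One time step, entropy and mass *)

Section Step.
Variables (R : realType) (Omega : set (R * R)) (T : mesh R).
Hypotheses (oO : open Omega) (pO : polygonal Omega) (bO : bd Omega) (O0 : Omega !=set0).
Hypothesis M : ddfv_mesh Omega T.
Variables (V : R * R -> R) (M1 B : R).
Hypotheses (M10 : 0 < M1) (VB : forall x, closure Omega x -> `|V x| <= B).

Lemma expR_bounds x : closure Omega x -> expR (- B) <= expR (- V x) <= expR B.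
Proof. by move=> /VB; rewrite ler_norml !ler_expR lerN2 lerNl andbC. Qed.

Lemma normalizer_gt0 (I D : finType) F e1 e2 S X (m : I -> R) :
  @jump_complex R Omega I D F e1 e2 S X ->
  (forall i, expR (- B) <= m i) -> 0 < \sum_i area (F i) * m i.
Proof.
move=> jc mB.
have fO : fm Omega by apply: (fm_open bO).
have AO := open_area_gt0 fO oO O0.
have areaE : \sum_i area (F i) = area Omega.
  have := jump_complex_area bO jc oO (@subset_refl _ Omega); move=> <-; apply: eq_bigr => i _.
  by congr area; apply/esym/setIidl; exact: jc_sub jc _.
apply: (@lt_le_trans _ _ (\sum_i area (F i) * expR (- B))).
  by rewrite -mulr_suml areaE mulr_gt0// expR_gt0.
by apply: ler_sum => i _; apply: ler_wpM2l => //; exact: area_ge0.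
Qed.

Let ZK := \sum_(K : primal T) area (cell K) * expR (- V (pcenter K)).
Let Zs := \sum_(s : vertex T) area (dual_cell s) * expR (- V (vert s)).

Lemma primal_normalizer_gt0 : 0 < ZK.
Proof.
apply: (normalizer_gt0 (primal_complex oO M)) => K.
by case/andP: (expR_bounds (@pcenter_closure _ _ _ M K)).
Qed.

Lemma dual_normalizer_gt0 : 0 < Zs.
Proof.
apply: (normalizer_gt0 (dual_complex oO pO M)) => s.
by case/andP: (expR_bounds (@vert_closure _ _ _ M s)).
Qed.

Lemma steadyT_gt0 (i : unknown T) : 0 < steadyT V M1 i.
Proof.
have k0 := primal_normalizer_gt0; have s0 := dual_normalizer_gt0.
by case: i => [K|s]; rewrite /steadyT mulr_gt0 ?expR_gt0// divr_gt0.
Qed.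

Lemma entropy1E (u : unknown T -> R) : entropy1 V M1 u = 2^-1 *
  (\sum_(K : primal T) area (cell K) *
     (steadyT V M1 (inl (inl K)) * Phi1 (u (inl (inl K)) / steadyT V M1 (inl (inl K))))
   + \sum_(s : vertex T) area (dual_cell s) *
     (steadyT V M1 (inr s) * Phi1 (u (inr s) / steadyT V M1 (inr s)))).
Proof.
by rewrite /entropy1 /prodT; congr (_ * (_ + _)); apply: eq_bigr => i _; rewrite mulr1.
Qed.

Lemma entropy1_ge0 (u : unknown T -> R) : (forall i, 0 <= u i) -> 0 <= entropy1 V M1 u.
Proof.
move=> u0; rewrite entropy1E mulr_ge0 ?invr_ge0// addr_ge0//; apply: sumr_ge0 => i _;
  rewrite mulr_ge0 ?area_ge0// mulr_ge0 ?(ltW (steadyT_gt0 _))// Phi1_ge0//;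
  by rewrite divr_ge0// ltW// steadyT_gt0.
Qed.

Definition primal_mass (u : unknown T -> R) : R := \sum_(K : primal T) area (cell K) * u (inl (inl K)).
Definition dual_mass (u : unknown T -> R) : R := \sum_(s : vertex T) area (dual_cell s) * u (inr s).

Lemma steady_primal_mass : primal_mass (@steadyT R T V M1) = M1.
Proof.
have k0 := primal_normalizer_gt0.
rewrite /primal_mass /steadyT /= -/ZK.
under eq_bigr => K _ do rewrite mulrCA.
by rewrite -mulr_sumr divfK// gt_eqF.
Qed.

Lemma steady_dual_mass : dual_mass (@steadyT R T V M1) = M1.
Proof.
have k0 := dual_normalizer_gt0.
rewrite /dual_mass /steadyT /= -/Zs.
under eq_bigr => K _ do rewrite mulrCA.
by rewrite -mulr_sumr divfK// gt_eqF.
Qed.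

(* [ln (v / steady)] is the gradient of the entropy at [v]. *)
Lemma entropy1_convex (u v : unknown T -> R) : (forall i, 0 <= u i) -> (forall i, 0 < v i) ->
  entropy1 V M1 v + prodT (fun i => u i - v i) (fun i => ln (v i / steadyT V M1 i)) <= entropy1 V M1 u.
Proof.
move=> u0 v0; rewrite !entropy1E /prodT -mulrDr; apply: ler_wpM2l; first by rewrite invr_ge0.
have step (i : unknown T) (a : R) : 0 <= a ->
    a * (steadyT V M1 i * Phi1 (v i / steadyT V M1 i)) + a * ln (v i / steadyT V M1 i) * (u i - v i)
    <= a * (steadyT V M1 i * Phi1 (u i / steadyT V M1 i)).
  move=> a0; have s0 := steadyT_gt0 i.
  have := Phi1_convex (divr_gt0 (v0 i) s0) (divr_ge0 (u0 i) (ltW s0)).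
  move=> /(ler_wpM2l (mulr_ge0 a0 (ltW s0))) h; rewrite [leRHS]mulrA; apply: le_trans h.
  rewrite le_eqVlt; apply/orP; left; apply/eqP.
  move: s0 (ln _) (Phi1 _); move: (steadyT V M1 i) (u i) (v i) => s p q s0 l phi.
  by field; rewrite gt_eqF.
rewrite addrACA -!big_split /=; apply: lerD; apply: ler_sum => i _.
  exact: (step (inl (inl i)) _ (area_ge0 _)).
exact: (step (inr i) _ (area_ge0 _)).
Qed.

Section Scheme.
Variables (Theta lm lM C : R) (Lambda : R * R -> 'M[R]_2) (r f : R -> R -> R).
Hypotheses (reg : mesh_regularity T Theta) (Theta1 : 1 <= Theta).
Hypotheses (ani : anisotropy_tensor Omega lm lM Lambda) (lm0 : 0 < lm).
Hypotheses (mr : mean_function r) (mf : max_or_average f) (C0 : 0 <= C).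
Hypothesis BV : forall (I D : finType) F e1 e2 S X, @jump_complex R Omega I D F e1 e2 S X ->
   forall g : I -> R, exists t,
     \sum_i (g i - t) ^+ 2 * area (F i) <= C * total_jump e1 e2 S g ^+ 2.

Definition dissipation (v : unknown T -> R) : R := \sum_(d : diam T) rD r f d v *
  dot (deltaD d (fun i => ln (v i) + sampleT V i))
    (mxapp (AD Lambda d) (deltaD d (fun i => ln (v i / steadyT V M1 i)))).

(** The two arguments differ by [ln rho] on the primal unknowns and by [ln rhos] on the dual ones;
    [deltaD] subtracts only within one mesh, so these constants disappear. *)
Lemma deltaD_steady (v : unknown T -> R) d : (forall i, 0 < v i) ->
  deltaD d (fun i => ln (v i / steadyT V M1 i)) = deltaD d (fun i => ln (v i) + sampleT V i).
Proof.
move=> v0; have k0 := primal_normalizer_gt0; have s0 := dual_normalizer_gt0.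
have rK : 0 < M1 / ZK by exact: divr_gt0.
have rs : 0 < M1 / Zs by exact: divr_gt0.
have lnE (x rho a : R) : 0 < x -> 0 < rho -> ln (x / (rho * expR (- a))) = ln x + a - ln rho.
  move=> x0 rho0; rewrite ln_div ?posrE// ?mulr_gt0 ?expR_gt0//.
  by rewrite lnM ?posrE ?expR_gt0// expRK; ring.
rewrite /deltaD /= -/ZK -/Zs !lnE//.
by congr (_, _); rewrite /sampleT /=; ring.
Qed.

(** A maximum is at least the half-sum, so both choices of [f] lead to the same bound, in which the
    two meshes no longer interact. *)
Lemma rD_ge (v : unknown T -> R) d : (forall i, 0 < v i) ->
  2^-1 * (r (v (inl (inl (dK d)))) (v (inl (dL d))) + r (v (inr (dKs d))) (v (inr (dLs d))))
  <= rD r f d v.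
Proof.
move=> v0; rewrite /rD; case: mf => ->; last by rewrite mulrC.
by move: (r _ _) (r _ _) => a b; case: (leP a b); lra.
Qed.

Definition primal_dissipation (v : unknown T -> R) : R :=
  \sum_(d : diam T) r (v (inl (inl (dK d)))) (v (inl (inl (primal_right d)))) *
    (ln (v (inl (inl (dK d))) / steadyT V M1 (inl (inl (dK d)))) -
     ln (v (inl (inl (primal_right d))) / steadyT V M1 (inl (inl (primal_right d))))) ^+ 2.

Definition dual_dissipation (v : unknown T -> R) : R :=
  \sum_(d : diam T) r (v (inr (dKs d))) (v (inr (dLs d))) *
    (ln (v (inr (dKs d)) / steadyT V M1 (inr (dKs d))) -
     ln (v (inr (dLs d)) / steadyT V M1 (inr (dLs d)))) ^+ 2.

(** After coercivity the mixed products of a mean on one mesh with a squared jump on the other are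
    nonnegative and are dropped; so is the jump toward a boundary unknown, which carries no mass. *)
Lemma dissipation_ge (v : unknown T -> R) : (forall i, 0 < v i) ->
  lm / (32 * Theta) / 2 * (primal_dissipation v + dual_dissipation v) <= dissipation v.
Proof.
move=> v0; rewrite /primal_dissipation /dual_dissipation -big_split /= mulr_sumr.
apply: ler_sum => d _.
have c0 : 0 <= lm / (32 * Theta).
  by rewrite divr_ge0 ?mulr_ge0// ?(ltW lm0)// (le_trans ler01).
rewrite -deltaD_steady//.
have := AD_coercive oO bO M reg Theta1 ani lm0 d (deltaD d (fun i => ln (v i / steadyT V M1 i))).
have := rD_ge d v0; move: (mxapp _ _) => Aw; rewrite {1 2 3}/deltaD /=.
set x := ln _ - ln _; set y := ln _ - ln _; set w := deltaD _ _.
set r1 := r _ _; set r2 := r _ _ => hr hA.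
have r10 : 0 < r1 by exact: (mean_gt0 mr).
have r20 : 0 < r2 by exact: (mean_gt0 mr).
have S0 : 0 <= x ^+ 2 + y ^+ 2 by rewrite addr_ge0// sqr_ge0.
apply: (@le_trans _ _ (2^-1 * (r1 + r2) * (lm / (32 * Theta) * (x ^+ 2 + y ^+ 2)))); last first.
  apply: ler_pM => //; last by apply: mulr_ge0.
  by rewrite mulr_ge0 ?invr_ge0// addr_ge0// ltW.
apply: (@le_trans _ _ (lm / (32 * Theta) / 2 * (r1 * x ^+ 2 + r2 * y ^+ 2))).
  apply: ler_wpM2l; first by rewrite divr_ge0.
  apply: lerD => //; rewrite /primal_right /r1 /x.
  case: (dL d) => // b; rewrite subrr expr0n mulr0.
  by rewrite mulr_ge0 ?sqr_ge0// ltW// (mean_gt0 mr).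
have := mulr_ge0 c0 (mulr_ge0 (ltW r20) (sqr_ge0 x)).
have := mulr_ge0 c0 (mulr_ge0 (ltW r10) (sqr_ge0 y)).
by move: (lm / _) (x ^+ 2) (y ^+ 2) => c X Y; lra.
Qed.

(** The weights $e^{-V}$ lie between $e^{-B}$ and $e^{B}$, and [128 * Theta ^+ 2] is the weight
    bound of both meshes. The added 1 keeps the value positive, as the decay rate is obtained by
    dividing by it. *)
Definition decay_const : R :=
  (log_sobolev_const Omega C (expR (- B)) (expR B) (128 * Theta ^+ 2) + 1) / expR (- B).

Lemma decay_const_gt0 : 0 < decay_const.
Proof.
rewrite divr_gt0 ?expR_gt0// ltr_wpDl//.
have ka0 : 0 <= 128 * Theta ^+ 2 by rewrite mulr_ge0// sqr_ge0.
exact: (log_sobolev_const_ge0 Omega C0 (expR_gt0 _) (ltW (expR_gt0 _)) ka0).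
Qed.

Lemma entropy1_le_dissipation (v : unknown T -> R) : (forall i, 0 < v i) ->
  primal_mass v = M1 -> dual_mass v = M1 ->
  entropy1 V M1 v <= decay_const / (lm / (32 * Theta)) * dissipation v.
Proof.
move=> v0 pm dm; rewrite entropy1E.
have ka0 : 0 <= 128 * Theta ^+ 2 by rewrite mulr_ge0// sqr_ge0.
have c10 := expR_gt0 (- B); have c20 := ltW (expR_gt0 B).
have rK : 0 < M1 / ZK by rewrite divr_gt0// primal_normalizer_gt0.
have rs : 0 < M1 / Zs by rewrite divr_gt0// dual_normalizer_gt0.
have h1 := entropy_dissipation C0 c10 c20 ka0 bO oO BV (primal_complex oO M)
  (fun K => expR_bounds (@pcenter_closure _ _ _ M K)) (fun K => v0 (inl (inl K))) rK
  (primal_weight bO M reg Theta1) (etrans pm (esym steady_primal_mass)) mr.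
have h2 := entropy_dissipation C0 c10 c20 ka0 bO oO BV (dual_complex oO pO M)
  (fun s => expR_bounds (@vert_closure _ _ _ M s)) (fun s => v0 (inr s)) rs
  (dual_weight bO M reg Theta1 pO) (etrans dm (esym steady_dual_mass)) mr.
have DK0 : 0 <= primal_dissipation v.
  by apply: sumr_ge0 => d _; rewrite mulr_ge0 ?sqr_ge0// ltW// (mean_gt0 mr).
have Ds0 : 0 <= dual_dissipation v.
  by apply: sumr_ge0 => d _; rewrite mulr_ge0 ?sqr_ge0// ltW// (mean_gt0 mr).
have Lle : log_sobolev_const Omega C (expR (- B)) (expR B) (128 * Theta ^+ 2) / expR (- B) <= decay_const.
  by apply: ler_wpM2r; [rewrite invr_ge0 ltW|rewrite lerDl].
have h1' := le_trans h1 (ler_wpM2r DK0 Lle).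
have h2' := le_trans h2 (ler_wpM2r Ds0 Lle).
have T0 : 0 < Theta by exact: lt_le_trans ltr01 Theta1.
have cA0 : 0 < lm / (32 * Theta) by rewrite divr_gt0// mulr_gt0.
have dc0 := ltW decay_const_gt0.
apply: (@le_trans _ _ (decay_const / 2 * (primal_dissipation v + dual_dissipation v))).
  have -> : decay_const / 2 * (primal_dissipation v + dual_dissipation v) =
      2^-1 * (decay_const * primal_dissipation v + decay_const * dual_dissipation v) by ring.
  by apply: ler_wpM2l; [rewrite invr_ge0|exact: lerD].
have := ler_wpM2l (divr_ge0 dc0 (ltW cA0)) (dissipation_ge v0); apply: le_trans.
rewrite le_eqVlt; apply/orP; left; apply/eqP.
move: cA0 (primal_dissipation v + _); move: (lm / _) decay_const => c k c0 S.
by field; rewrite gt_eqF.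
Qed.

(** Testing the scheme with the gradient of the entropy at [v], convexity shows that the entropy
    drops by at least [dt * dissipation v], which in turn dominates a multiple of the new
    entropy. *)
Lemma entropy1_decay (u v : unknown T -> R) (dt : R) : 0 < dt ->
  (forall i, 0 <= u i) -> (forall i, 0 < v i) ->
  primal_mass v = M1 -> dual_mass v = M1 ->
  prodT (fun i => (v i - u i) / dt) (fun i => ln (v i / steadyT V M1 i)) + dissipation v = 0 ->
  (1 + lm / (32 * Theta) / decay_const * dt) * entropy1 V M1 v <= entropy1 V M1 u.
Proof.
move=> dt0 u0 v0 pm dm sch.
have := entropy1_convex u0 v0.
have -> : prodT (fun i => u i - v i) (fun i => ln (v i / steadyT V M1 i)) = dt * dissipation v.
  move/eqP: sch; rewrite addrC addr_eq0 => /eqP ->.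
  rewrite /prodT mulrN mulrCA -mulrN; congr (_ * _).
  rewrite mulrDr opprD; congr (_ + _); rewrite mulr_sumr -sumrN; apply: eq_bigr => i _;
    by field; rewrite gt_eqF.
have T0 : 0 < Theta by exact: lt_le_trans ltr01 Theta1.
have cA0 : 0 < lm / (32 * Theta) by rewrite divr_gt0// mulr_gt0.
have dc0 := decay_const_gt0.
have := entropy1_le_dissipation v0 pm dm.
move=> /(ler_wpM2l (ltW (mulr_gt0 dt0 (divr_gt0 cA0 dc0)))) h; apply: le_trans.
rewrite mulrDl mul1r lerD2l (mulrC _ dt); apply: (le_trans h).
rewrite le_eqVlt; apply/orP; left; apply/eqP; move: cA0 dc0.
move: (lm / _) decay_const (dissipation v) => c k D c0 k0.
by field; rewrite !gt_eqF.
Qed.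

End Scheme.

(** The indicator of all primal unknowns, boundary ones included, and that of all dual unknowns have
    zero differences on every diamond. Tested with them, the scheme conserves the two masses
    separately. *)
Lemma scheme_mass (u : nat -> unknown T -> R) (u0 : R * R -> R) Lambda r f dt :
  square_integrable Omega u0 -> M1 = \int[mu2 R]_(x in Omega) u0 x -> 0 < dt ->
  ddfv_solution V u0 Lambda r f dt u ->
  forall n, primal_mass (u n) = M1 /\ dual_mass (u n) = M1.
Proof.
move=> su0 M1E dt0 [u0E _ sch].
have fO : fm Omega by exact: (fm_open bO).
have Iu0 := square_integrable_integrable fO su0.
elim=> [|n [IHp IHd]].
  rewrite u0E M1E; split; first exact: (jump_complex_mass bO oO (primal_complex oO M)).
  exact: (jump_complex_mass bO oO (dual_complex oO pO M)).
have zero (psi : unknown T -> R) : (forall d, deltaD d psi = (0, 0)) ->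
    prodT (fun i => u n.+1 i - u n i) psi = 0.
  move=> psi0; have /= := sch n psi; rewrite big1 ?addr0.
    move=> h; apply: (mulfI (lt0r_neq0 (divr_gt0 ltr01 dt0))); rewrite mulr0 -[RHS]h.
    rewrite /prodT mulrCA; congr (_ * _); rewrite mulrDr !mulr_sumr; congr (_ + _);
      by apply: eq_bigr => i _; field; rewrite gt_eqF.
  by move=> d _; rewrite psi0 /mxapp /dot /= !mulr0 addr0 !mulr0 addr0 mulr0.
split.
- have := zero (fun i => if i is inl _ then 1 else 0).
  rewrite /prodT [X in _ + X]big1 => [|s _]; last by rewrite mulr0 mul0r.
  rewrite addr0 => h; rewrite -IHp; apply/eqP; rewrite -subr_eq0 /primal_mass -sumrB.
  have /eqP := h (fun d => ltac:(by rewrite /deltaD /= !subrr)).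
  rewrite mulf_eq0 invr_eq0 pnatr_eq0 /=.
  by under eq_bigr => K _ do rewrite mulr1 mulrBr.
- have := zero (fun i => if i is inr _ then 1 else 0).
  rewrite /prodT big1 => [|s _]; last by rewrite mulr0 mul0r.
  rewrite add0r => h; rewrite -IHd; apply/eqP; rewrite -subr_eq0 /dual_mass -sumrB.
  have /eqP := h (fun d => ltac:(by rewrite /deltaD /= !subrr)).
  rewrite mulf_eq0 invr_eq0 pnatr_eq0 /=.
  by under eq_bigr => s _ do rewrite mulr1 mulrBr.
Qed.

Lemma initT_ge0 (u0 : R * R -> R) (i : unknown T) : square_integrable Omega u0 ->
  {ae mu2 R, forall x, Omega x -> 0 <= u0 x} -> 0 <= initT u0 i.
Proof.
move=> su0 pos.
have fO : fm Omega by exact: (fm_open bO).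
have Iu0 := square_integrable_integrable fO su0.
have nonneg A : open A -> A `<=` Omega -> 0 <= (area A)^-1 * \int[mu2 R]_(x in A) u0 x.
  move=> oA AO; rewrite mulr_ge0 ?invr_ge0 ?area_ge0//.
  have fA : fm A by exact: (fm_open bO).
  apply: ae_Rintegral_ge0 => //.
    by apply: (integrableS fO.1 fA.1).
  by apply: (ae_imp pos) => x /= h /AO.
case: i => [[K|b]|s] //=.
  by apply: nonneg; [exact: (cell_open M)|exact: (cell_sub M)].
by apply: nonneg; [exact: dual_open|exact: (dual_sub pO M)].
Qed.

End Step.

Theorem theorem4p3 (R : realType) (Omega : set (R * R))
    (V u0 : R * R -> R) (M1 lm lM Theta : R)
    (hOmega : polygonal_domain Omega)
    (hV : C1_closure Omega V)
    (hu0 : square_integrable Omega u0)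
    (hu0_ge0 : {ae mu2 R, forall x, Omega x -> 0 <= u0 x})
    (hM1 : M1 = \int[mu2 R]_(x in Omega) u0 x)
    (hM1_gt0 : 0 < M1)
    (hlm : 0 < lm) (hlM : lm <= lM) (hTheta : 1 <= Theta) :
  exists nu : R, 0 < nu /\
    forall (Lambda : R * R -> 'M[R]_2) (T : mesh R) (r f : R -> R -> R)
           (dt : R) (u : nat -> unknown T -> R),
      anisotropy_tensor Omega lm lM Lambda ->
      ddfv_mesh Omega T ->
      mesh_regularity T Theta ->
      mean_function r ->
      max_or_average f ->
      0 < dt ->
      ddfv_solution V u0 Lambda r f dt u ->
      (forall n : nat,
         entropy1 V M1 (u n) <= (1 + nu * dt) ^- n * entropy1 V M1 (u 0%N)) /\
      (forall k : R, 0 < k -> dt <= k ->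
         forall n : nat,
           entropy1 V M1 (u n)
             <= expR (- (ln (1 + nu * k) / k) * (n%:R * dt))
                * entropy1 V M1 (u 0%N)).
Proof.
have [pO _ oO /bounded_bd bO] := hOmega.
have O0 : Omega !=set0.
  apply/set0P; apply: contraTneq hM1_gt0 => O0.
  by rewrite hM1 O0 /Rintegral integral_set0 ltxx.
have [C C0 BV] := bv_inequality hOmega O0.
have [B _ VB] := bounded_on_closure bO hV.1.
have T0 : 0 < Theta by exact: lt_le_trans ltr01 hTheta.
(* Coercivity constant over the constant comparing entropy with dissipation; [C] depends on [Omega]
   alone and [B] bounds [V]. All this is fixed before the mesh, the tensor, the means and the time
   step. *)
pose nu := lm / (32 * Theta) / decay_const Omega B Theta C.
have dc0 := decay_const_gt0 Omega B Theta C0.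
have nu0 : 0 < nu by rewrite divr_gt0// divr_gt0// mulr_gt0.
exists nu; split => // Lambda T r f dt u ani M reg mr mf dt0 sol.
have u0i i : 0 <= u 0%N i by case: sol => -> _ _; exact: (initT_ge0 oO pO bO M).
have upos n i : 0 < u n.+1 i by case: sol => _ h _; exact: h.
have uge0 n i : 0 <= u n i by case: n => [|n]; [exact: u0i|exact: ltW].
have decay n : entropy1 V M1 (u n) <= (1 + nu * dt) ^- n * entropy1 V M1 (u 0%N).
  have p0 : 0 < 1 + nu * dt by rewrite addr_gt0// mulr_gt0.
  elim: n => [|n IH]; first by rewrite expr0 invr1 mul1r.
  have [pm dm] := scheme_mass oO pO bO M hu0 hM1 dt0 sol n.+1.
  have [_ _ sch] := sol.
  have := sch n (fun i => ln (u n.+1 i / steadyT V M1 i)).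
  move=> /(entropy1_decay oO pO bO O0 M hM1_gt0 VB reg hTheta ani hlm mr mf C0 BV dt0 (uge0 n) (upos n) pm dm) h.
  rewrite exprS invfM -mulrA ler_pdivlMl//; exact: le_trans h IH.
split=> // k k0 dtk n; apply: (le_trans (decay n)); apply: ler_wpM2r.
  exact: (entropy1_ge0 oO pO bO O0 M hM1_gt0 VB).
exact: power_decay.
Qed.
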